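(* Let $(X_{nk})_{n\in\mathbb N,\ s_n\le k\le k_n}$ be a square-integrable $\mathbb R^d$-valued lag martingale difference array adapted to $(\mathcal X_{nk})_{0\le k\le k_n,\,n\in\mathbb N}$, with lags $p_{nk}$. Assume that: (1) for every $\epsilon>0$, $\sum_{k=s_n}^{k_n}\mathbb E\big(\|D_{nk}\|^2\,1\{\|D_{nk}\|\ge\epsilon\}\,\big|\,\mathcal X_{n,k-1}\big)\to 0$ in probability as $n\to\infty$; (2) $\sum_{k=s_n}^{k_n}\mathbb E(D_{nk}D_{nk}^{\top}\mid\mathcal X_{n,k-1})\to\Psi$ in probability as $n\to\infty$ for some $\mathcal G$-measurable symmetric positive semidefinite random matrix $\Psi$; (3) $\overline R_n\to 0_d$ in probability as $n\to\infty$. Then $\overline X_n:=\sum_{k=s_n}^{k_n}X_{nk}\to\Psi^{1/2}Z_d$ $\mathcal G$-stably as $n\to\infty$, where $Z_d$ is a standard Gaussian random vector in $\mathbb R^d$ that is independent of $\mathcal G$.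
   Context: Setup. $(k_n)_{n\in\mathbb N}$ is a nondecreasing sequence in $\mathbb N$ with $k_n\ge n$. On a probability space $(\Omega,\mathcal X,P)$, for each $n$, $(\mathcal X_{nk})_{0\le k\le k_n}$ is a filtration of sub-$\sigma$-fields of $\mathcal X$. Let $1\le s_n\le k_n$ and let $p_{nk}\in\{0,1,\dots,k-1\}$ for $s_n\le k\le k_n$ (nonrandom integers). An array $(X_{nk})_{n\in\mathbb N,\,s_n\le k\le k_n}$ of $\mathbb R^d$-valued random vectors, with each $X_{nk}$ being $\mathcal X_{nk}$-measurable, is a lag martingale difference array (with lags $p_{nk}$) if every component of every $X_{nk}$ is integrable and $\mathbb E(X_{nk}\mid\mathcal X_{n,k-p_{nk}-1})=0_d$ for all $n$ and $s_n\le k\le k_n$. It is square-integrable if all components are in $L^2(P)$. Conventions: $X_{nr}=0_d$ and $p_{nr}=0$ for $r>k_n$. $\|\cdot\|$ is the Euclidean norm. Projection horizon: $q_{n,s_n-1}=0$ and, recursively for $s_n\le k\le k_n$, $q_{nk}=\min\{q\in\{q_{n,k-1},q_{n,k-1}+1,\dots\}:\ q\ge p_{n,k+q}\}$. Projections: $E_{njl}=\mathbb E(X_{nj}\mid\mathcal X_{nl})$, $D_{n,k+i,k}=E_{n,k+i,k}-E_{n,k+i,k-1}$, $D_{nk}=\sum_{i=0}^{q_{nk}}D_{n,k+i,k}$. Remainder: $U_{nk}=\sum_{i=0}^{q_{nk}-1}E_{n,k+i,k-1}$, $W_{nk}=\sum_{i=1}^{q_{nk}}E_{n,k+i,k}$,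 $\overline R_n=\sum_{k=s_n}^{k_n}(U_{nk}-W_{nk})$. $\sigma$-fields: $\mathcal G_n=\bigcap_{m\ge n}\mathcal X_{m,k_n}$ and $\mathcal G=\sigma\big(\bigcup_{n\ge1}\mathcal G_n\big)$. For a symmetric positive semidefinite $Q$, $Q^{1/2}$ is its unique symmetric positive semidefinite square root. $Y_n\to Y$ $\mathcal G$-stably means that $(Y_n,V)\to(Y,V)$ in distribution for every $\mathcal G$-measurable random variable $V$ (the limit $Y$ may live on an extension of the probability space). *)

(* Defs.v *)
From HB Require Import structures.
From mathcomp Require Import all_boot all_order all_algebra.
From mathcomp Require Import all_classical all_reals all_analysis.

Set Implicit Arguments.
Unset Strict Implicit.
Unset Printing Implicit Defensive.

Import Order.TTheory GRing.Theory Num.Theory.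
Import numFieldNormedType.Exports.

Local Open Scope classical_set_scope.
Local Open Scope ring_scope.

Section linear_algebra.
Context {R : realType} {d : nat}.

(* The norm `|v| that the library puts on matrices is the sup norm. *)
Definition enorm (v : 'cV[R]_d) : R := Num.sqrt (\sum_i v i 0 ^+ 2).

Definition psd (A : 'M[R]_d) : Prop :=
  A^T = A /\ forall v : 'cV[R]_d, 0 <= (v^T *m A *m v) 0 0.

(* For A symmetric positive semidefinite the set below is a singleton; the
   default value 0 is only used for other matrices. *)
Definition psd_sqrt (A : 'M[R]_d) : 'M[R]_d :=
  xget 0 [set S | psd S /\ S *m S = A].

End linear_algebra.

Section sub_sigma_algebras.
Context {disp : measure_display} {T : measurableType disp} {R : realType}.
Implicit Types (P : probability T R) (F : set (set T)).

Definition filtration (N : nat) (F : nat -> set (set T)) : Prop :=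
  [/\ forall k, (k <= N)%N -> sigma_algebra setT (F k),
      forall k, (k <= N)%N -> F k `<=` measurable &
      forall k l, (k <= l)%N -> (l <= N)%N -> F k `<=` F l].

Definition measurable_wrt F (f : T -> R) : Prop :=
  measurable_fun [set: g_sigma_algebraType F] (f : g_sigma_algebraType F -> R).

Definition measurable_mx m n F (A : T -> 'M[R]_(m, n)) : Prop :=
  forall i j, measurable_wrt F (fun w => A w i j).

Definition is_condexp P F (X Y : T -> R) : Prop :=
  [/\ measurable_wrt F Y,
      P.-integrable setT (EFin \o Y) &
      forall A, F A ->
        (\int[P]_(w in A) (Y w)%:E = \int[P]_(w in A) (X w)%:E)%E].

(* A fixed version of E(X | F). Versions exist, and are almost surely unique,
   as soon as X is integrable and F is a sub-sigma-algebra of measurable; the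
   default value 0 is only used otherwise. *)
Definition condexp P F (X : T -> R) : T -> R :=
  xget (cst 0) [set Y | is_condexp P F X Y].

Definition condexp_mx m n P F (X : T -> 'M[R]_(m, n)) : T -> 'M[R]_(m, n) :=
  fun w => \matrix_(i, j) condexp P F (fun w' => X w' i j) w.

Definition sigma_vec d (X : T -> 'cV[R]_d) : set (set T) :=
  <<s \bigcup_(i in [set: 'I_d])
        preimage_set_system setT (fun w => X w i 0) measurable >>.

Definition independent_sets P (F H : set (set T)) : Prop :=
  forall A B, F A -> H B -> P (A `&` B) = (P A * P B)%E.

(* The law of Z is the d-fold product of the law N(0, 1). *)
Definition standard_gaussian d P (Z : T -> 'cV[R]_d) : Prop :=
  (forall i, measurable_fun setT (fun w => Z w i 0)) /\
  forall B : 'I_d -> set R, (forall i, measurable (B i)) ->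
    P [set w | forall i, B i (Z w i 0)] =
      (\prod_(i < d) normal_prob 0%R 1%R (B i))%E.

Definition cvg_in_probability (V : normedModType R) P
    (Y_ : nat -> T -> V) (Y : T -> V) : Prop :=
  forall e : R, 0 < e ->
    P [set w | e <= `|Y_ n w - Y w|] @[n --> \oo] --> 0%E.

End sub_sigma_algebras.

Section modes_of_convergence.
Context {disp disp' : measure_display} {T : measurableType disp}
  {T' : measurableType disp'} {R : realType}.
Variables (P : probability T R) (P' : probability T' R).

Definition cvg_in_distribution (S : topologicalType)
    (Y_ : nat -> T -> S) (Y : T' -> S) : Prop :=
  forall f : S -> R, continuous f -> bounded_fun f ->
    'E_P[f \o Y_ n]%E @[n --> \oo] --> 'E_(P')[f \o Y]%E.

(* (T', P') extends (T, P) through pi: a random variable V on T is identified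
   with V \o pi, and a sub-sigma-algebra G of T with its preimage by pi. *)
Definition extension (pi : T' -> T) : Prop :=
  measurable_fun setT pi /\
  forall A, measurable A -> P' (pi @^-1` A) = P A.

Definition stable_cvg d (G : set (set T)) (pi : T' -> T)
    (Y_ : nat -> T -> 'cV[R]_d) (Y : T' -> 'cV[R]_d) : Prop :=
  forall V : T -> R, measurable_wrt G V ->
    cvg_in_distribution (fun n w => (Y_ n w, V w)) (fun w => (Y w, V (pi w))).

End modes_of_convergence.

Section horizon.
Variables (kn : nat) (p : nat -> nat) (s : nat).

Definition lag (r : nat) : nat := if (r <= kn)%N then p r else 0.

Lemma next_horizon_ex (k q0 : nat) :
  exists q, (q0 <= q)%N && (lag (k + q) <= q)%N.
Proof.
exists (q0 + kn.+1)%N; rewrite leq_addr /= /lag ifF//.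
by apply/negbTE; rewrite -ltnNge addnA addnS ltnS leq_addl.
Qed.

Definition next_horizon (k q0 : nat) : nat := ex_minn (next_horizon_ex k q0).

(* horizon_rec j is the horizon at time s - 1 + j. *)
Fixpoint horizon_rec (j : nat) : nat :=
  if j is j'.+1 then next_horizon (s + j') (horizon_rec j') else 0.

Definition horizon (k : nat) : nat := horizon_rec (k.+1 - s).

End horizon.

(* The array index n ranges over {1, 2, ...}; values at n = 0 are irrelevant.
   The entry X n k is meaningful for sn n <= k <= kn n only. *)
Section lag_martingale.
Context {disp : measure_display} {T : measurableType disp} {R : realType}
  {d : nat}.
Variables (P : probability T R) (kn sn : nat -> nat)
  (F : nat -> nat -> set (set T)) (p : nat -> nat -> nat)
  (X : nat -> nat -> T -> 'cV[R]_d).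

Definition lag_martingale_difference : Prop :=
  forall n k, (0 < n)%N -> (sn n <= k <= kn n)%N ->
  [/\ measurable_mx (F n k) (X n k),
      forall i, (fun w => X n k w i 0) \in Lfun P 1 &
      {ae P, forall w, condexp_mx P (F n (k - p n k - 1)%N) (X n k) w = 0}].

Definition square_integrable : Prop :=
  forall n k i, (0 < n)%N -> (sn n <= k <= kn n)%N ->
  (fun w => X n k w i 0) \in Lfun P 2%:E.

Definition Xext (n r : nat) : T -> 'cV[R]_d :=
  if (r <= kn n)%N then X n r else cst 0.

Definition qh (n k : nat) : nat := horizon (kn n) (p n) (sn n) k.

Definition proj (n j l : nat) : T -> 'cV[R]_d :=
  condexp_mx P (F n l) (Xext n j).

Definition Dproj (n k : nat) (w : T) : 'cV[R]_d :=
  \sum_(0 <= i < (qh n k).+1)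
    (proj n (k + i) k w - proj n (k + i) (k - 1) w).

Definition Urem (n k : nat) (w : T) : 'cV[R]_d :=
  \sum_(0 <= i < qh n k) proj n (k + i) (k - 1) w.

Definition Wrem (n k : nat) (w : T) : 'cV[R]_d :=
  \sum_(1 <= i < (qh n k).+1) proj n (k + i) k w.

Definition Rrem (n : nat) (w : T) : 'cV[R]_d :=
  \sum_(sn n <= k < (kn n).+1) (Urem n k w - Wrem n k w).

Definition Xbar (n : nat) (w : T) : 'cV[R]_d :=
  \sum_(sn n <= k < (kn n).+1) X n k w.

Definition Gn (n : nat) : set (set T) :=
  \bigcap_(m in [set m | (n <= m)%N]) F m (kn n).

Definition Ginf : set (set T) :=
  <<s \bigcup_(n in [set n | (1 <= n)%N]) Gn n >>.

Definition lindeberg_sum (e : R) (n : nat) (w : T) : R :=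
  \sum_(sn n <= k < (kn n).+1)
    condexp P (F n (k - 1)%N)
      (fun w' => enorm (Dproj n k w') ^+ 2 *
                 \1_[set w'' | e <= enorm (Dproj n k w'')] w') w.

Definition condcov_sum (n : nat) (w : T) : 'M[R]_d :=
  \sum_(sn n <= k < (kn n).+1)
    condexp_mx P (F n (k - 1)%N)
      (fun w' => Dproj n k w' *m (Dproj n k w')^T) w.

End lag_martingale.

(* Main.v *)
Require Import Defs.
From HB Require Import structures.
From mathcomp Require Import all_boot all_order all_algebra.
From mathcomp Require Import all_classical all_reals all_analysis.
From mathcomp Require Import measurable_realfun ring lra.

(** The sum of the array is, almost surely, the sum of the martingale
    differences D_nk plus the remainder.  Indeed for each time k the sums
    defining D_nk + U_nk - W_nk telescope to the projection of X_nk at time k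
    minus the projection at time k - 1 of the entry at time k + q, where q is
    the horizon at k.  The first term is X_nk; the second one vanishes by the tower
    property, because q is at least the lag of the entry at time k + q, so that
    this entry is centred given the past up to time k - 1
    ([lag_horizon], [E_horizon], [Xbar_decomposition]).  The remainder is then
    removed by Slutsky's argument [cos_slutsky], and what is left is a stable
    central limit theorem for a martingale difference array, carried by cosines
    of linear projections.

    Let S_k be the partial sums of a scalar martingale difference array and V_k
    those of its conditional variances.  A second order expansion shows that
    cos(S_k + th) e^{V_k / 2} is almost a martingale; the error is controlled by
    the conditional Lindeberg sum once the process is stopped before V exceeds a
    constant C and before the Lindeberg sum exceeds e^2.  Tested against a
    bounded weight known at a fixed time m, the m initial steps cost O(m e) and
    the later ones O(e) altogether, so the weighted mean at the end stays close
    to cos th times the mean of the weight ([exp_mart_bound]).  The fields G_n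
    are increasing and G_n is contained in the field at the fixed time k_n of
    every later row, hence variables measurable for G_n are admissible weights
    in all later rows; they approximate in L1 every bounded G-measurable
    variable ([bounded_approximable]).  Applied to the weight
    eta e^{-A / 2}, with A the limit of the conditional variances, this gives
    E eta cos(S_n + th) --> cos th E eta e^{-A / 2} ([stable_cos]).

    On the limit side the right hand side is the mean of
    eta cos(u . Psi^{1/2} Z + th): conditionally on G the projection is a centred
    Gaussian variable of variance u^T Psi u.  This follows by integrating out
    the coordinates of Z one at a time ([gaussian_mixture]) with the Gaussian
    characteristic function ([gaussian_cf]), once Psi^{1/2} is known to be
    measurable, which holds because the square root is a limit of polynomials
    ([psd_sqrt_measurable]).

    Taking cos(s V) and sin(s V) for eta gives convergence of the means of
    cos(u . Xbar_n + s V + th), that is of the characteristic function of the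
    pair (Xbar_n, V).  The passage to bounded continuous test functions is
    Levy's continuity theorem ([levy_continuity]): on a cube such a function is
    a uniform limit of trigonometric polynomials with the same bound, by means
    of the Fejer kernel, and the mass outside the cube is controlled by a
    Gaussian average of characteristic functions. *)

Set Implicit Arguments.
Unset Strict Implicit.
Unset Printing Implicit Defensive.

Import Order.TTheory GRing.Theory Num.Theory.
Import numFieldNormedType.Exports.

Local Open Scope classical_set_scope.
Local Open Scope ring_scope.

(** * Real-valued expectation *)

Lemma measurable_ge {disp : measure_display} {T : measurableType disp} {R : realType}
    (f : T -> R) r : measurable_fun setT f -> measurable [set w | r <= f w].
Proof.
move=> mf; have := mf measurableT `[r, +oo[%classic (measurable_itv _).
by rewrite setTI; congr measurable; apply/seteqP; split => w /=; rewrite in_itv/= andbT.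
Qed.

Section expectation.
Context {disp : measure_display} {T : measurableType disp} {R : realType}.
Variable P : probability T R.
Implicit Types (f g h X Y : T -> R) (A B : set T).

Definition L1 f := P.-integrable setT (EFin \o f).

Definition bounded_by (K : R) f := forall w, `|f w| <= K.

Lemma L1_meas f : L1 f -> measurable_fun setT f.
Proof. by case/integrableP => /measurable_EFinP. Qed.

Lemma L1_bounded K f : measurable_fun setT f -> bounded_by K f -> L1 f.
Proof.
move=> mf fK; apply: measurable_bounded_integrable => //.
  by rewrite (le_lt_trans (probability_le1 P _))// ltry.
by exists K; split => [|M KM]; rewrite ?num_real //= => w _ /=; rewrite (le_trans (fK w)) ?ltW.
Qed.

Lemma L1_le f g : measurable_fun setT f -> L1 g ->
  (forall w, `|f w| <= g w) -> L1 f.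
Proof.
move=> mf ig fg; apply: le_integrable ig => //; first exact/measurable_EFinP.
by move=> w _ /=; rewrite lee_fin (le_trans (fg w)) ?ler_norm.
Qed.

Lemma L1_cst c : L1 (cst c).
Proof. by apply: (@L1_bounded `|c|). Qed.

Lemma L1D f g : L1 f -> L1 g -> L1 (fun w => f w + g w).
Proof. by move=> L1f L1g; exact: (integrableD measurableT L1f L1g). Qed.

Lemma L1Z c f : L1 f -> L1 (fun w => c * f w).
Proof. by move=> L1f; exact: (integrableZl measurableT c L1f). Qed.

Lemma L1B f g : L1 f -> L1 g -> L1 (fun w => f w - g w).
Proof. by move=> L1f L1g; exact: (integrableB measurableT L1f L1g). Qed.

Lemma L1_sum (I : Type) (s : seq I) (Q : pred I) (F : I -> T -> R) :
  (forall i, Q i -> L1 (F i)) -> L1 (fun w => \sum_(i <- s | Q i) F i w).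
Proof.
move=> L1F; elim: s => [|i s IH].
  by under eq_fun do rewrite big_nil; exact: L1_cst.
under eq_fun do rewrite big_cons; case: (boolP (Q i)) => Qi //.
by apply: L1D => //; exact: L1F.
Qed.

Lemma L1_norm f : L1 f -> L1 (fun w => `|f w|).
Proof. by move=> L1f; exact: integrable_norm. Qed.

Lemma L1_mulb K h f : measurable_fun setT h -> bounded_by K h -> L1 f ->
  L1 (fun w => h w * f w).
Proof.
move=> mh hK L1f; apply: (@L1_le _ (fun w => K * `|f w|)).
- by apply: measurable_funM => //; exact: L1_meas.
- by apply/L1Z/L1_norm.
- by move=> w; rewrite normrM ler_wpM2r.
Qed.

(** Expectation as a real number: it is only meaningful for integrable variables,
    and linear on them, which is why integrability is carried along as [L1]. *)
Definition Ex f : R := (\int[P]_w f w)%R.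

Lemma ExE f : L1 f -> (\int[P]_w (f w)%:E)%E = (Ex f)%:E.
Proof. by move=> L1f; rewrite fineK//; exact: integrable_fin_num. Qed.

Lemma eq_Ex f g : f =1 g -> Ex f = Ex g.
Proof. by move=> /funext ->. Qed.

Lemma ExD f g : L1 f -> L1 g -> Ex (fun w => f w + g w) = Ex f + Ex g.
Proof. by move=> ? ?; exact: RintegralD. Qed.

Lemma ExB f g : L1 f -> L1 g -> Ex (fun w => f w - g w) = Ex f - Ex g.
Proof. by move=> ? ?; exact: RintegralB. Qed.

Lemma ExZ c f : L1 f -> Ex (fun w => c * f w) = c * Ex f.
Proof. by move=> ?; exact: RintegralZl. Qed.

Lemma Ex_cst c : Ex (cst c) = c.
Proof.
have := Rintegral_cst P measurableT c.
by rewrite [X in fine X](probability_setT P) /= mulr1.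
Qed.

Lemma Ex_sum (I : Type) (s : seq I) (Q : pred I) (F : I -> T -> R) :
  (forall i, Q i -> L1 (F i)) ->
  Ex (fun w => \sum_(i <- s | Q i) F i w) = \sum_(i <- s | Q i) Ex (F i).
Proof.
move=> L1F; elim: s => [|i s IH].
  by under eq_Ex do rewrite big_nil; rewrite big_nil; exact: Ex_cst.
under eq_Ex do rewrite big_cons; rewrite big_cons; case: (boolP (Q i)) => Qi //.
by rewrite ExD ?IH//; [exact: L1F|exact: L1_sum].
Qed.

Lemma Ex_le f g : L1 f -> L1 g -> (forall w, f w <= g w) -> Ex f <= Ex g.
Proof. by move=> ? ? fg; apply: le_Rintegral => // w _; exact: fg. Qed.

Lemma Ex_ge0 f : (forall w, 0 <= f w) -> 0 <= Ex f.
Proof. by move=> f0; apply: Rintegral_ge0. Qed.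

Lemma Ex_norm_le f g : L1 f -> L1 g -> (forall w, `|f w| <= g w) ->
  `|Ex f| <= Ex g.
Proof.
move=> L1f L1g fg; apply: (@le_trans _ _ (Ex (fun w => `|f w|))).
  exact: le_normr_Rintegral.
by apply: Ex_le => //; exact: L1_norm.
Qed.

Lemma Ex_norm_bounded K f : measurable_fun setT f -> bounded_by K f ->
  `|Ex f| <= K.
Proof.
move=> mf fK; rewrite -(Ex_cst K); apply: (@Ex_norm_le f (cst K)) => //; last exact: L1_cst.
exact: (L1_bounded mf fK).
Qed.

Lemma bounded_by_indic A : bounded_by 1 (\1_A : T -> R).
Proof. by move=> w; rewrite indicE normr_nat; case: (_ \in _). Qed.

Lemma L1_indic A : measurable A -> L1 (\1_A).
Proof. by move=> mA; apply: (L1_bounded _ (bounded_by_indic A)); exact: measurable_indic. Qed.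

Lemma Ex_indic A : measurable A -> Ex (\1_A) = fine (P A).
Proof. by move=> mA; rewrite /Ex /Rintegral integral_indic// setIT. Qed.

Lemma Ex_indicM A f : measurable A ->
  Ex (fun w => \1_A w * f w) = fine (\int[P]_(w in A) (f w)%:E).
Proof.
move=> mA; rewrite /Ex /Rintegral [in RHS]integral_mkcond; congr fine.
apply: eq_integral => w _; rewrite patchE indicE.
by case: (w \in A); rewrite ?mul1r ?mul0r.
Qed.

Lemma eq_Ex_ae f g : measurable_fun setT f -> measurable_fun setT g ->
  {ae P, forall w, f w = g w} -> Ex f = Ex g.
Proof.
move=> mf mg fg; congr fine; apply: ae_eq_integral => //.
- exact/measurable_EFinP.
- exact/measurable_EFinP.
by apply: filterS fg => w /= -> _.
Qed.

Lemma dominated_Ex (f_ : nat -> T -> R) f g :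
  (forall n, measurable_fun setT (f_ n)) -> measurable_fun setT f ->
  (forall w, f_ ^~ w @ \oo --> f w) -> L1 g ->
  (forall n w, `|f_ n w| <= g w) ->
  Ex (f_ n) @[n --> \oo] --> Ex f.
Proof.
move=> mf_ mf cvf L1g fg.
have L1f : L1 f.
  apply: (L1_le mf L1g) => w.
  have cvn : `|f_ n w| @[n --> \oo] --> `|f w| by apply: cvg_norm; exact: cvf.
  rewrite -(cvg_lim _ cvn)//; apply: limr_le; first exact: (cvgP _ cvn).
  by apply: nearW => n; exact: fg.
have cvE : {ae P, forall w, setT w ->
    (fun n => (f_ n w)%:E) @ \oo --> (EFin \o f) w}.
  by apply: aeW => w _; apply: cvg_EFin; [exact: nearW|exact: cvf].
have bdE : {ae P, forall w n, setT w -> (`|(f_ n w)%:E| <= (EFin \o g) w)%E}.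
  by apply: aeW => w n _; rewrite lee_fin; exact: fg.
have [_ _] := @dominated_convergence _ _ _ P _ measurableT
  (fun n w => (f_ n w)%:E) (EFin \o f) (EFin \o g)
  (fun n => (measurable_EFinP _ _).2 (mf_ n)) ((measurable_EFinP _ _).2 mf)
  cvE L1g bdE.
by rewrite /= ExE// => /fine_cvg.
Qed.

End expectation.

(** * Sub-sigma-algebras and conditional expectation *)

Section sub_sigma_algebra.
Context {disp : measure_display} {T : measurableType disp} {R : realType}.
Implicit Types (F G : set (set T)) (f g h : T -> R) (A B : set T).

Lemma measurable_wrtW F G f : F `<=` <<s G >> ->
  measurable_wrt F f -> measurable_wrt G f.
Proof.
move=> FG mf _ B mB; have := mf measurableT B mB.
by apply: smallest_sub => //; exact: smallest_sigma_algebra.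
Qed.

Lemma measurable_wrtS F G f : F `<=` G ->
  measurable_wrt F f -> measurable_wrt G f.
Proof.
by move=> FG; apply: measurable_wrtW => A /FG; exact: sub_sigma_algebra.
Qed.

Lemma sub_measurable F : F `<=` measurable -> <<s F >> `<=` measurable.
Proof.
move=> Fm; apply: smallest_sub => //; exact: sigma_algebra_measurable.
Qed.

Lemma measurable_wrt_fun F f : F `<=` measurable ->
  measurable_wrt F f -> measurable_fun setT f.
Proof.
by move=> Fm mf _ B mB; have := mf measurableT B mB; exact: sub_measurable.
Qed.

Lemma measurable_wrt_preimage F f (D : set R) : sigma_algebra setT F ->
  measurable_wrt F f -> measurable D -> F (f @^-1` D).
Proof.
move=> sF mf mD; have := mf measurableT D mD.
by rewrite setTI /measurable/= sigma_algebra_id.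
Qed.

Lemma measurable_wrt_indic F A : F A -> measurable_wrt F (\1_A : T -> R).
Proof.
move=> FA; apply: (@measurable_indic _ (g_sigma_algebraType F) R).
exact: sub_sigma_algebra.
Qed.

(** A number of [0, 1] is recovered, up to 1/M, from the count of the levels
    j/M below it. *)
Lemma layer_cake (M : nat) (x : R) : (0 < M)%N -> 0 <= x <= 1 ->
  `|x - M%:R^-1 * \sum_(j < M) (j.+1%:R <= M%:R * x)%R%:R| <= M%:R^-1.
Proof.
move=> M0 /andP[x0 x1].
have M0R : 0 < M%:R :> R by rewrite ltr0n.
set y := M%:R * x; have y0 : 0 <= y by rewrite mulr_ge0// ltW.
have [ty yt] := andP (truncn_itv y0).
have tM : (Num.truncn y <= M)%N.
  by rewrite -(ler_nat R) (le_trans ty)// /y ler_piMr// ltW.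
have -> : \sum_(j < M) (j.+1%:R <= y)%R%:R = (Num.truncn y)%:R :> R.
  rewrite -natr_sum; congr (_%:R).
  rewrite (eq_bigr (fun j : 'I_M => (j < Num.truncn y)%N : nat)); last first.
    by move=> j _; rewrite truncn_gt_nat.
  rewrite -(big_mkord xpredT (fun j => (j < Num.truncn y)%N : nat)).
  rewrite (big_cat_nat (leq0n _) tM)//= big_nat (eq_bigr (fun=> 1%N)); last first.
    by move=> j /andP[_ ->].
  rewrite -big_nat sum_nat_const_nat subn0 muln1 big_nat big1 ?addn0//.
  by move=> j /andP[+ _]; rewrite ltnNge => ->.
have -> : x = M%:R^-1 * y by rewrite /y mulrA mulVf ?mul1r// gt_eqF.
rewrite -mulrBr normrM gtr0_norm ?invr_gt0// ler_piMr ?invr_ge0 ?ltW//.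
rewrite ger0_norm ?subr_ge0// ltrBlDr addrC natr1.
by [].
Qed.

(** Bounded measurable functions are uniform limits of linear combinations of
    indicators, by slicing the range with [layer_cake]; so a linear property
    stable under uniform limits has to be checked on indicators only. *)
Lemma bounded_measurable_ind F (Q : (T -> R) -> Prop) :
  sigma_algebra setT F ->
  (forall A, F A -> Q (\1_A)) ->
  (forall a f g, Q f -> Q g -> Q (fun w => a * f w + g w)) ->
  (forall f, measurable_wrt F f ->
    (forall e : R, 0 < e -> exists2 g, Q g & forall w, `|f w - g w| <= e) -> Q f) ->
  forall K f, measurable_wrt F f -> bounded_by K f -> Q f.
Proof.
move=> sF Qind Qlin Qlim K f mf fK; apply: Qlim => // e e0.
have Q1 : Q (cst 1).
  rewrite (_ : cst 1 = \1_setT); last by apply/funext => w; rewrite indicT.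
  by apply: Qind; case: sF => F0 FC _; rewrite -(setD0 setT); exact: FC.
have Q0 : Q (cst 0).
  rewrite (_ : cst 0 = \1_(set0 : set T)); last first.
    by apply/funext => w; rewrite indic0.
  by apply: Qind; case: sF.
pose L := `|K| + 1.
have L0 : 0 < L by rewrite ltr_wpDl.
have fL w : `|f w| <= L by rewrite (le_trans (fK w))// ler_wpDr// ler_norm.
(* f takes its values in [-L, L]; M slices make the mesh 2 L / M at most e *)
pose M := (Num.truncn (2 * L / e)).+1.
have M0R : 0 < M%:R :> R by rewrite ltr0n.
have Me : 2 * L * M%:R^-1 <= e.
  rewrite ler_pdivrMr// [e * _]mulrC -ler_pdivrMr// ltW//.
  exact: truncnS_gt.
pose A j := f @^-1` [set` `[(j.+1%:R / M%:R) * (2 * L) - L, +oo[ ].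
have QA n : Q (fun w => \sum_(j < n) \1_(A j) w).
  elim: n => [|n IH].
    by rewrite (_ : (fun _ => _) = cst 0)//; apply/funext => w; rewrite big_ord0.
  rewrite (_ : (fun _ => _) =
     fun w => 1 * \1_(A n) w + \sum_(j < n) \1_(A j) w); last first.
    by apply/funext => w; rewrite big_ord_recr/= addrC mul1r.
  by apply: Qlin => //; apply: Qind; exact: measurable_wrt_preimage.
exists (fun w => (2 * L / M%:R) * (\sum_(j < M) \1_(A j) w) +
                 (- L * cst 1 w + cst 0 w)).
  exact: (Qlin _ _ _ (QA M) (Qlin _ _ _ Q1 Q0)).
move=> w; rewrite /cst /= addr0 mulr1.
pose x := (f w + L) / (2 * L).
have L20 : 0 < 2 * L by rewrite mulr_gt0.
have x01 : 0 <= x <= 1.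
  have := fL w; rewrite ler_norml => /andP[fl fu].
  by rewrite /x ler_pdivlMr// mul0r ler_pdivrMr// mul1r; apply/andP; split; lra.
have fx : f w = 2 * L * x - L.
  by rewrite /x mulrC divfK ?gt_eqF// addrK.
have ind j : \1_(A j) w = (j.+1%:R <= M%:R * x)%R%:R :> R.
  rewrite indicE; congr ((nat_of_bool _)%:R).
  rewrite /A; apply/idP/idP; rewrite inE/= in_itv/= andbT fx.
  - by rewrite lerBlDr subrK mulrC ler_pM2l// ler_pdivrMr// mulrC.
  - by rewrite lerBlDr subrK [X in _ -> X <= _]mulrC ler_pM2l// ler_pdivrMr// [x * _]mulrC.
under eq_bigr do rewrite ind.
rewrite (_ : _ - _ = 2 * L *
  (x - M%:R^-1 * \sum_(j < M) (j.+1%:R <= M%:R * x)%R%:R)); last by rewrite fx; ring.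
rewrite normrM gtr0_norm// (le_trans _ Me)// ler_pM2l//.
exact: layer_cake.
Qed.

End sub_sigma_algebra.

(** P as a measure on the smaller sigma-algebra generated by F, the base measure
    with respect to which conditional expectations are densities. *)
Definition trace_prob {disp : measure_display} {T : measurableType disp}
    {R : realType} (P : probability T R) (F : set (set T))
    (Fm : F `<=` measurable) (A : set (g_sigma_algebraType F)) : \bar R :=
  P A.

(** The charge with density f, seen on the sigma-algebra generated by F. *)
Definition trace_charge {disp : measure_display} {T : measurableType disp}
    {R : realType} (P : probability T R) (F : set (set T))
    (Fm : F `<=` measurable) (f : T -> R) (L1f : L1 P f)
    (A : set (g_sigma_algebraType F)) : \bar R :=
  induced_charge L1f A.

Section trace_of_probability.
Context {disp : measure_display} {T : measurableType disp} {R : realType}.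
Variables (P : probability T R) (F : set (set T)) (Fm : F `<=` measurable).
Local Notation PF := (trace_prob P Fm).

Let trace0 : PF set0 = 0%E. Proof. exact: measure0. Qed.

Let trace_ge0 A : (0 <= PF A)%E. Proof. exact: measure_ge0. Qed.

Let measurable_trace (A : set (g_sigma_algebraType F)) :
  measurable A -> (measurable : set (set T)) A.
Proof. exact: (sub_measurable Fm). Qed.

Let trace_sigma_additive : semi_sigma_additive PF.
Proof.
move=> A mA tA mUA; apply: (@measure_semi_sigma_additive _ _ _ P A) => //.
- by move=> i; exact: measurable_trace.
- exact: measurable_trace.
Qed.

HB.instance Definition _ := isMeasure.Build _ _ _
  PF trace0 trace_ge0 trace_sigma_additive.

Let trace_setT : PF setT = 1%E. Proof. exact: probability_setT. Qed.

HB.instance Definition _ :=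
  Measure_isProbability.Build _ _ _ PF trace_setT.

Section charge.
Variables (f : T -> R) (L1f : L1 P f).
Local Notation nu := (trace_charge Fm L1f).

Let nu0 : nu set0 = 0%E. Proof. exact: charge0. Qed.

Let nu_fin A : measurable A -> nu A \is a fin_num.
Proof. by move=> /measurable_trace mA; exact: fin_num_measure. Qed.

Let nu_sigma_additive : semi_sigma_additive nu.
Proof.
move=> A mA tA mUA.
apply: (@charge_semi_sigma_additive _ _ _ (induced_charge L1f) A) => //.
- by move=> i; exact: measurable_trace.
- exact: measurable_trace.
Qed.

HB.instance Definition _ := isCharge.Build _ _ _
  nu nu0 nu_fin nu_sigma_additive.

Lemma trace_charge_dominates : nu `<< PF.
Proof.
apply/null_content_dominatesP => A mA PA0.
apply: null_set_integral => //; first exact: measurable_trace.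
by apply/measurable_EFinP/measurable_funTS; exact: L1_meas L1f.
Qed.

End charge.

Lemma measurable_fun_trace : measurable_fun setT (idfun : T -> g_sigma_algebraType F).
Proof. by move=> _ A mA; rewrite setTI; exact: measurable_trace. Qed.

(** The restricted measure is the image of P by the identity map from the big
    sigma-algebra to the small one, so integrals are transported by change of
    variables. *)
Lemma integrable_trace (f : T -> R) : measurable_wrt F f ->
  PF.-integrable setT (EFin \o f) -> L1 P f.
Proof.
move=> mf /integrableP[_ lty]; apply/integrableP; split.
  by apply/measurable_EFinP; exact: (measurable_wrt_fun Fm).
apply: le_lt_trans lty.
rewrite (_ : PF = pushforward P (idfun : T -> g_sigma_algebraType F))//.
rewrite ge0_integral_pushforward//; first exact: measurable_fun_trace.
by apply/measurable_EFinP; apply: measurableT_comp.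
Qed.

Lemma integral_trace (f : T -> R) A : measurable_wrt F f -> L1 P f -> <<s F >> A ->
  (\int[PF]_(w in A) (f w)%:E = \int[P]_(w in A) (f w)%:E)%E.
Proof.
move=> mf L1f FA.
have := @integral_pushforward _ _ T (g_sigma_algebraType F) R idfun
  measurable_fun_trace P A (EFin \o f).
apply => //; first exact/measurable_EFinP.
by apply: integrableS L1f => //; exact: measurable_trace.
Qed.

End trace_of_probability.

Lemma eq_of_dist_le {R : realType} (a b c : R) :
  (forall e : R, 0 < e -> `|a - b| <= e * c) -> a = b.
Proof.
move=> abc; apply/eqP; rewrite -subr_eq0 -normr_eq0 eq_le normr_ge0 andbT.
apply/ler_addgt0Pr => e e0; rewrite add0r.
have c0 : 0 < `|c| + 1 by rewrite ltr_wpDl.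
apply: (le_trans (abc (e / (`|c| + 1)) (divr_gt0 e0 c0))).
rewrite mulrAC ler_pdivrMr// ler_pM2l//.
by rewrite (le_trans (ler_norm _))// lerDl.
Qed.

Section conditional_expectation.
Context {disp : measure_display} {T : measurableType disp} {R : realType}.
Variables (P : probability T R) (F : set (set T)).
Hypotheses (sF : sigma_algebra setT F) (Fm : F `<=` measurable).
Implicit Types (X Y h : T -> R) (A : set T).

(** The Radon-Nikodym derivative of the charge A |-> E(X 1_A), restricted to F,
    with respect to the restriction of P is a conditional expectation; hence the
    chosen version is one. *)
Lemma condexpP X : L1 P X -> is_condexp P F X (condexp P F X).
Proof.
move=> L1X; apply: xgetPex.
have dom := trace_charge_dominates (Fm := Fm) L1X.
have := fun w => Radon_Nikodym_fin_num w dom.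
have := Radon_Nikodym_integrable dom.
have := fun A : set (g_sigma_algebraType F) =>
  @Radon_Nikodym_integral _ _ _ _ _ A dom.
set RN := Radon_Nikodym _ _ => RNE iRN RNfin.
pose Y : T -> R := fun w => fine (RN w).
have YE w : (Y w)%:E = RN w by rewrite /Y fineK//; exact: RNfin.
have EY : EFin \o Y = RN by apply/funext => w; rewrite /= YE.
have iY : (trace_prob P Fm).-integrable setT (EFin \o Y) by rewrite EY.
have mY : measurable_wrt F Y.
  by case/integrableP: iY => /measurable_EFinP.
have L1Y := integrable_trace mY iY.
exists Y; split => // A FA.
have sA : <<s F >> A by exact: sub_sigma_algebra.
rewrite -(integral_trace Fm)//.
under eq_integral do rewrite YE.
by rewrite -RNE.
Qed.

(** The defining identity on events extends to bounded weights because both sides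
    are linear and continuous for uniform convergence of the weight. *)
Lemma condexp_pull X Y : L1 P X -> is_condexp P F X Y ->
  forall K h, measurable_wrt F h -> bounded_by K h ->
  Ex P (fun w => h w * X w) = Ex P (fun w => h w * Y w).
Proof.
move=> L1X [mY L1Y XY] K h mh hK.
pose Q g := [/\ measurable_wrt F g, exists C, bounded_by C g &
  Ex P (fun w => g w * X w) = Ex P (fun w => g w * Y w)].
suff : Q h by case.
apply: (bounded_measurable_ind sF _ _ _ mh hK).
- move=> A FA; split; first exact: measurable_wrt_indic.
    by exists 1; exact: bounded_by_indic.
  by rewrite !Ex_indicM ?XY//; exact: Fm.
- move=> a f g [mf [Cf fC] fE] [mg [Cg gC] gE]; split.
  + by apply: measurable_funD => //; apply: measurable_funM.
  + exists (`|a| * Cf + Cg) => w.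
    by rewrite (le_trans (ler_normD _ _))// lerD// normrM ler_wpM2l.
  + have E V : L1 P V -> Ex P (fun w => (a * f w + g w) * V w) =
        a * Ex P (fun w => f w * V w) + Ex P (fun w => g w * V w).
      move=> L1V; have L1fV := L1_mulb (measurable_wrt_fun Fm mf) fC L1V.
      have L1gV := L1_mulb (measurable_wrt_fun Fm mg) gC L1V.
      rewrite -ExZ// -ExD//; last exact: L1Z.
      by apply: eq_Ex => w; rewrite mulrDl mulrA.
    by rewrite !E// fE gE.
- move=> f mf lim_f.
  have fC : exists C, bounded_by C f.
    have [g [_ [C gC] _] fg] := lim_f 1 ltr01; exists (1 + C) => w.
    by rewrite -(subrK (g w) (f w)) (le_trans (ler_normD _ _))// lerD.
  split => //; apply: (@eq_of_dist_le _ _ _ (Ex P (fun w => `|X w|) + Ex P (fun w => `|Y w|))).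
  move=> e e0; have [g [mg [C gC] gE] fg] := lim_f e e0; have [C' fC'] := fC.
  have D V : L1 P V -> `|Ex P (fun w => f w * V w) - Ex P (fun w => g w * V w)|
      <= e * Ex P (fun w => `|V w|).
    move=> L1V; have L1fV := L1_mulb (measurable_wrt_fun Fm mf) fC' L1V.
    have L1gV := L1_mulb (measurable_wrt_fun Fm mg) gC L1V.
    rewrite -ExB// -ExZ; last exact: L1_norm.
    apply: Ex_norm_le; [exact: L1B|exact/L1Z/L1_norm|move=> w].
    by rewrite -mulrBl normrM ler_wpM2r.
  rewrite mulrDr -(subrK (Ex P (fun w => g w * X w)) (Ex P (fun w => f w * X w))).
  rewrite -addrA (le_trans (ler_normD _ _))// lerD// ?D//.
  by rewrite gE distrC D.
Qed.

Lemma condexp_uniq0 Y : measurable_wrt F Y -> L1 P Y ->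
  (forall A, F A -> (\int[P]_(w in A) (Y w)%:E = 0)%E) ->
  {ae P, forall w, Y w = 0}.
Proof.
move=> mY L1Y Y0.
have iY : (trace_prob P Fm).-integrable setT (EFin \o Y).
  apply/integrableP; split; first exact/measurable_EFinP.
  have := @ge0_integral_pushforward _ _ T (g_sigma_algebraType F) R idfun
    (measurable_fun_trace Fm) P setT (fun w => `|(Y w)%:E|%E).
  rewrite preimage_setT => ->//; last first.
    by apply/measurable_EFinP; apply: measurableT_comp.
  by case/integrableP: L1Y.
have := @integral_ae_eq _ (g_sigma_algebraType F) _ (trace_prob P Fm) setT
  measurableT (cst 0%E) (EFin \o Y) iY (measurable_cst _).
case=> [A _ sA|N [mN N0 subN]].
  rewrite integral0 (integral_trace Fm)// Y0//.
  by move: sA; rewrite /measurable/= sigma_algebra_id.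
exists N; split => //; first exact: (sub_measurable Fm).
by move=> w /= Yw; apply: subN => /= /(_ I) [].
Qed.

Lemma Ex0_ae f : L1 P f -> (forall w, 0 <= f w) -> Ex P f = 0 ->
  {ae P, forall w, f w = 0}.
Proof.
move=> L1f f0 Ef; have mf : measurable_fun setT (EFin \o f).
  by apply/measurable_EFinP; exact: L1_meas L1f.
have [+ _] := ae_eq_integral_abs P measurableT mf.
case.
  rewrite (eq_integral (EFin \o f)); first by rewrite ExE// Ef.
  by move=> w _ /=; rewrite ger0_norm.
by move=> N [mN N0 subN]; exists N; split => // w /= fw; apply: subN => /= /(_ I) [].
Qed.

(** The event where the conditional expectation is negative belongs to F, and the
    mean of X over it is nonnegative. *)
Lemma condexp_ge0 X Y : L1 P X -> is_condexp P F X Y ->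
  (forall w, 0 <= X w) -> {ae P, forall w, 0 <= Y w}.
Proof.
move=> L1X cXY X0; have [mY L1Y _] := cXY.
pose N := [set w | Y w < 0].
have FN : F N.
  rewrite (_ : N = Y @^-1` [set` `]-oo, 0[]).
    exact: measurable_wrt_preimage.
  by apply/seteqP; split => w /=; rewrite in_itv.
have mN := Fm FN.
have b1 : bounded_by 1 (\1_N : T -> R) by exact: bounded_by_indic.
have mind : measurable_fun setT (\1_N : T -> R) by exact: measurable_indic.
have L1NY := L1_mulb mind b1 L1Y.
have NY0 w : 0 <= -1 * (\1_N w * Y w).
  rewrite mulN1r oppr_ge0 indicE; have [|_] := boolP (w \in N); last by rewrite mul0r.
  by rewrite inE mul1r => /ltW.
have E0 : Ex P (fun w => -1 * (\1_N w * Y w)) = 0.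
  apply/eqP; rewrite eq_le Ex_ge0// andbT ExZ// mulN1r oppr_le0.
  rewrite -(condexp_pull L1X cXY (measurable_wrt_indic FN) b1).
  by apply: Ex_ge0 => w; rewrite mulr_ge0// indicE.
have := Ex0_ae (L1Z (-1) L1NY) NY0 E0.
apply: filterS => w; rewrite indicE; have [|] := boolP (w \in N).
  by rewrite inE /N/= mul1r mulN1r => Yw /eqP; rewrite oppr_eq0 => /eqP ->.
by move=> /negP; rewrite inE /N/= => /negP; rewrite -leNgt.
Qed.

Lemma is_condexp_uniq X Y Y' : is_condexp P F X Y -> is_condexp P F X Y' ->
  {ae P, forall w, Y w = Y' w}.
Proof.
move=> [mY L1Y YX] [mY' L1Y' Y'X].
have := @condexp_uniq0 (fun w => Y w - Y' w); case.
- by apply: measurable_funB.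
- exact: L1B.
- move=> A FA; have mA := Fm FA.
  under eq_integral do rewrite EFinB.
  rewrite integralB//; [|by apply: integrableS L1Y|by apply: integrableS L1Y'].
  rewrite YX// Y'X// subee//.
  by rewrite -YX//; apply: integrable_fin_num => //; apply: integrableS L1Y.
- move=> N [mN N0 sub]; exists N; split => // w /= YY'; apply: sub => /= /eqP.
  by rewrite subr_eq0 => /eqP.
Qed.

Lemma is_condexp_self X : measurable_wrt F X -> L1 P X -> is_condexp P F X X.
Proof. by []. Qed.

(** Conditional expectation contracts L2: with h the truncation of Y at level n,
    E h^2 = E h X <= (E h^2 + E X^2) / 2, and n tends to infinity.  Truncation is
    needed since the integrability of Y^2 is what is being proved. *)
Lemma condexp_L2 X Y : L1 P X -> L1 P (fun w => X w ^+ 2) ->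
  is_condexp P F X Y -> L1 P (fun w => Y w ^+ 2).
Proof.
move=> L1X L2X cXY; have [mY L1Y _] := cXY.
have mYT := measurable_wrt_fun Fm mY.
pose B (n : nat) := [set w | `|Y w| <= n%:R].
have FB n : F (B n).
  rewrite (_ : B n = Y @^-1` [set` `[- n%:R, n%:R]]).
    exact: measurable_wrt_preimage.
  by apply/seteqP; split => w; rewrite /B/= in_itv/= ler_norml.
pose h n w := \1_(B n) w * Y w.
have hn n w : `|h n w| <= n%:R.
  rewrite /h indicE; have [|_] := boolP (w \in B n); last by rewrite mul0r normr0.
  by rewrite inE /B/= mul1r.
have mh n : measurable_wrt F (h n).
  by apply: measurable_funM => //; exact: measurable_wrt_indic.
have mhT n := measurable_wrt_fun Fm (mh n).
have h2E n w : h n w * Y w = h n w ^+ 2.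
  rewrite /h indicE; case: (w \in B n); last by rewrite !mul0r expr0n.
  by rewrite !mul1r expr2.
have L1h2 n : L1 P (fun w => h n w ^+ 2).
  apply: (@L1_bounded _ _ _ _ (n%:R ^+ 2)); first exact: measurable_funX.
  by move=> w; rewrite normrX lerXn2r ?nnegrE.
have Eh n : Ex P (fun w => h n w ^+ 2) <= Ex P (fun w => X w ^+ 2).
  have -> : Ex P (fun w => h n w ^+ 2) = Ex P (fun w => h n w * X w).
    by rewrite (condexp_pull L1X cXY (mh n) (hn n)); apply: eq_Ex => w; rewrite h2E.
  have L1hX := L1_mulb (mhT n) (hn n) L1X.
  have : 2 * Ex P (fun w => h n w * X w) <=
         Ex P (fun w => h n w ^+ 2) + Ex P (fun w => X w ^+ 2).
    rewrite -ExZ// -ExD//; apply: Ex_le; [exact: L1Z|exact: L1D|move=> w].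
    by have := sqr_ge0 (h n w - X w); rewrite sqrrB -mulr_natl; lra.
  have -> : Ex P (fun w => h n w * X w) = Ex P (fun w => h n w ^+ 2).
    by rewrite (condexp_pull L1X cXY (mh n) (hn n)); apply: eq_Ex => w; rewrite h2E.
  lra.
apply/integrableP; split; first by apply/measurable_EFinP; exact: measurable_funX.
under eq_integral do rewrite /= ger0_norm ?sqr_ge0//.
have limh w : (h n w ^+ 2)%:E @[n --> \oo] --> (Y w ^+ 2)%:E.
  apply: cvg_near_cst; near=> n; rewrite /h indicE (_ : w \in _) ?mul1r//.
  rewrite inE /B/=; near: n; exact: nbhs_infty_ger.
have cvh : (\int[P]_w (h n w ^+ 2)%:E)%E @[n --> \oo] -->
    (\int[P]_w (Y w ^+ 2)%:E)%E.
  rewrite (eq_integral (fun w => limn (fun n => (h n w ^+ 2)%:E))); last first.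
    by move=> w _; apply/esym/cvg_lim => //; exact: limh.
  apply: cvg_monotone_convergence => //.
  - by move=> n; apply/measurable_EFinP; exact: measurable_funX.
  - by move=> n w _; rewrite lee_fin sqr_ge0.
  - move=> w _ m n mn; rewrite lee_fin /h !indicE.
    have [|_] := boolP (w \in B m); last by rewrite mul0r expr0n sqr_ge0.
    rewrite inE /B/= => Ym; rewrite (_ : w \in _)// inE/=.
    by rewrite (le_trans Ym)// ler_nat.
apply: (@le_lt_trans _ _ (Ex P (fun w => X w ^+ 2))%:E); last exact: ltry.
rewrite -(cvg_lim _ cvh)//; apply: lime_le; first by apply/cvg_ex; eexists; exact: cvh.
by apply: nearW => n; rewrite ExE// lee_fin.
Unshelve. all: by end_near. Qed.

End conditional_expectation.

(** * Second order expansions of cosine and exponential *)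

Section measurable_trigo.
Context {disp : measure_display} {T : measurableType disp} {R : realType}.
Implicit Types (f : T -> R).

Lemma measurable_cos_comp f : measurable_fun setT f ->
  measurable_fun setT (fun w => cos (f w)).
Proof.
move=> mf; apply: measurableT_comp => //.
by apply: continuous_measurable_fun; exact: continuous_cos.
Qed.

Lemma measurable_sin_comp f : measurable_fun setT f ->
  measurable_fun setT (fun w => sin (f w)).
Proof.
move=> mf; apply: measurableT_comp => //.
by apply: continuous_measurable_fun; exact: continuous_sin.
Qed.

End measurable_trigo.

Section real_bounds.
Context {R : realType}.
Implicit Types (x y a e : R).

Lemma mvt_abs (f df : R -> R) (K y : R) :
  (forall t, is_derive t (1 : R) f (df t)) ->
  (forall t, `|t| <= `|y| -> `|df t| <= K) -> `|f y - f 0| <= K * `|y|.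
Proof.
move=> fdf dfK.
have cf a b : {within `[a, b], continuous f}.
  apply: continuous_subspaceT => t; apply: differentiable_continuous.
  exact/derivable1_diffP.
have [y0|y0] := leP 0 y.
- have [c cab ->] := MVT_segment y0 (fun t _ => fdf t) (cf _ _).
  rewrite subr0 normrM ler_wpM2r// dfK//.
  by move: cab; rewrite in_itv/= => /andP[c0 cy]; rewrite !ger0_norm.
- have [c cab] := MVT_segment (ltW y0) (fun t _ => fdf t) (cf _ _).
  rewrite distrC sub0r => ->; rewrite normrM normrN ler_wpM2r// dfK//.
  move: cab; rewrite in_itv/= => /andP[yc c0].
  by rewrite (ler0_norm c0) (ltr0_norm y0) lerN2.
Qed.

Lemma sin_abs_le y : `|sin y| <= `|y|.
Proof.
have := @mvt_abs sin cos 1 y; rewrite sin0 subr0 mul1r; apply.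
by move=> t _; exact: cos_max.
Qed.

Lemma cos_sub1_abs_le y : `|1 - cos y| <= `|y|.
Proof.
have := @mvt_abs cos (fun t => - sin t) 1 y; rewrite cos0 mul1r distrC; apply.
by move=> t _; rewrite normrN; exact: sin_max.
Qed.

Lemma cos_sub1_le_sqr y : `|1 - cos y| <= y ^+ 2.
Proof.
have := @mvt_abs cos (fun t => - sin t) `|y| y.
rewrite cos0 -expr2 real_normK ?num_real// distrC; apply.
by move=> t ty; rewrite normrN (le_trans (sin_abs_le _)).
Qed.

Lemma sub_sin_le y (K : R) : (forall t, `|t| <= `|y| -> `|1 - cos t| <= K) ->
  `|y - sin y| <= K * `|y|.
Proof.
move=> yK; have := @mvt_abs (fun t => t - sin t) (fun t => 1 - cos t) K y.
by rewrite sin0 !subr0; apply.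
Qed.

Lemma sub_sin_le_sqr y : `|y - sin y| <= y ^+ 2.
Proof.
rewrite -real_normK ?num_real// expr2; apply: sub_sin_le => t ty.
by rewrite (le_trans (cos_sub1_abs_le _)).
Qed.

Lemma sub_sin_le_cube y : `|y - sin y| <= `|y| ^+ 3.
Proof.
rewrite exprSr; apply: sub_sin_le => t ty.
by rewrite (le_trans (cos_sub1_le_sqr _))// -real_normK ?num_real// lerXn2r ?nnegrE.
Qed.

Lemma cos_taylor2_le y (K : R) : (forall t, `|t| <= `|y| -> `|t - sin t| <= K) ->
  `|cos y - 1 + y ^+ 2 / 2| <= K * `|y|.
Proof.
move=> yK.
have := @mvt_abs (fun t => cos t + 2^-1 * t ^+ 2) (fun t => t - sin t) K y.
rewrite cos0 expr0n/= mulr0 addr0.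
rewrite (_ : cos y - 1 + y ^+ 2 / 2 = cos y + 2^-1 * y ^+ 2 - 1); last by ring.
apply => // t; apply: is_derive_eq.
by rewrite /GRing.scale/=; field.
Qed.

(** The remainder is quadratic for large increments and cubic for small ones, so
    that it splits into a Lindeberg term and a term of order e times the
    variance. *)
Lemma cos_taylor2 x y e : 0 <= e ->
  `|cos (x + y) - cos x + y * sin x + y ^+ 2 / 2 * cos x| <=
  3 * (y ^+ 2 * (e <= `|y|)%R%:R + e * y ^+ 2).
Proof.
move=> e0.
have -> : cos (x + y) - cos x + y * sin x + y ^+ 2 / 2 * cos x =
   cos x * (cos y - 1 + y ^+ 2 / 2) + sin x * (y - sin y) by rewrite cosD; ring.
have split_le (A B : R) : `|cos y - 1 + y ^+ 2 / 2| <= A -> `|y - sin y| <= B ->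
  `|cos x * (cos y - 1 + y ^+ 2 / 2) + sin x * (y - sin y)| <= A + B.
  move=> yA yB; rewrite (le_trans (ler_normD _ _))// lerD// normrM.
  - by rewrite (le_trans _ yA)// ler_piMl// cos_max.
  - by rewrite (le_trans _ yB)// ler_piMl// sin_max.
have y20 : 0 <= y ^+ 2 by exact: sqr_ge0.
have [ey|ye] := leP e `|y|.
- rewrite mulr1; apply: (@le_trans _ _ (2 * y ^+ 2 + y ^+ 2)).
    apply: split_le; last exact: sub_sin_le_sqr.
    rewrite -[in leRHS]real_normK ?num_real// expr2 mulrA; apply: cos_taylor2_le => t ty.
    rewrite (le_trans (ler_normB _ _))//.
    by have := sin_abs_le t; have := ty; lra.
  by have : 0 <= e * y ^+ 2 by [rewrite mulr_ge0|]; lra.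
- rewrite mulr0 add0r; apply: (@le_trans _ _ (`|y| ^+ 3 + `|y| ^+ 3)).
    apply: split_le; last exact: sub_sin_le_cube.
    rewrite [`|y| ^+ 3]exprSr; apply: cos_taylor2_le => t ty.
    by rewrite (le_trans (sub_sin_le_sqr _))// -real_normK ?num_real// lerXn2r ?nnegrE.
  have : `|y| ^+ 3 <= e * y ^+ 2.
    by rewrite exprS -[in leRHS]real_normK ?num_real// ler_wpM2r ?exprn_ge0// ltW.
  have : 0 <= e * y ^+ 2 by rewrite mulr_ge0.
  lra.
Qed.

Lemma expRN_taylor1 a : 0 <= a -> `|1 - a - expR (- a)| <= a ^+ 2.
Proof.
move=> a0; have l : 1 - a <= expR (- a) by exact: expR_ge1Dx.
have u : expR (- a) <= 1 - a + a ^+ 2.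
  rewrite expRN -(ler_pM2l (expR_gt0 a)) divff ?gt_eqF ?expR_gt0//.
  have h : 1 + a <= expR a by exact: expR_ge1Dx.
  have h2 : 0 <= 1 - a + a ^+ 2 by have := sqr_ge0 (1 - 2 * a); nra.
  apply: (@le_trans _ _ ((1 + a) * (1 - a + a ^+ 2))); last by rewrite ler_wpM2r.
  rewrite (_ : (1 + a) * _ = 1 + a ^+ 3); last by ring.
  by rewrite lerDl exprn_ge0.
rewrite ler0_norm; lra.
Qed.

Lemma cosD_abs_le x y : `|cos (x + y) - cos x| <= `|y|.
Proof.
have := @mvt_abs (fun t => cos (x + t)) (fun t => - sin (x + t)) 1 y.
rewrite addr0 mul1r; apply; last by move=> t _; rewrite normrN sin_max.
move=> t; have -> : (fun t => cos (x + t)) = cos \o +%R x by [].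
apply: is_derive_eq.
by rewrite /GRing.scale/= add0r mulr1.
Qed.

End real_bounds.

Lemma sqr_le_of_norm {R : realType} (z e : R) : `|z| <= e -> z ^+ 2 <= e ^+ 2.
Proof.
move=> ze; rewrite -real_normK ?num_real// lerXn2r ?nnegrE//.
exact: le_trans ze.
Qed.

(** * The stopped exponential martingale *)

Section stopped_martingale.
Context {disp : measure_display} {T : measurableType disp} {R : realType}.
Variables (P : probability T R) (N : nat) (G : nat -> set (set T)).
Variables (xi v lam : nat -> T -> R) (eps C : R).
Hypotheses (filtG : filtration N G) (eps01 : 0 < eps <= 1) (C0 : 0 <= C).
Hypothesis xi_meas : forall k, (k < N)%N -> measurable_wrt (G k.+1) (xi k).
Hypothesis v_meas : forall k, (k < N)%N -> measurable_wrt (G k) (v k).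
Hypothesis lam_meas : forall k, (k < N)%N -> measurable_wrt (G k) (lam k).
Hypothesis v_ge0 : forall k w, 0 <= v k w.
Hypothesis lam_ge0 : forall k w, 0 <= lam k w.
Hypothesis xi_L2 : forall k, (k < N)%N -> L1 P (fun w => xi k w ^+ 2).
Hypothesis v_L1 : forall k, (k < N)%N -> L1 P (v k).
Hypothesis lam_L1 : forall k, (k < N)%N -> L1 P (lam k).

Let tail k w : R := xi k w ^+ 2 * (eps <= `|xi k w|)%R%:R.

Hypothesis xi_mart : forall k, (k < N)%N -> forall K h, measurable_wrt (G k) h ->
  bounded_by K h -> Ex P (fun w => h w * xi k w) = 0.
Hypothesis xi_var : forall k, (k < N)%N -> forall K h, measurable_wrt (G k) h ->
  bounded_by K h -> Ex P (fun w => h w * xi k w ^+ 2) = Ex P (fun w => h w * v k w).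
Hypothesis xi_lind : forall k, (k < N)%N -> forall K h, measurable_wrt (G k) h ->
  bounded_by K h -> (forall w, 0 <= h w) ->
  Ex P (fun w => h w * tail k w) <= Ex P (fun w => h w * lam k w).

(** Steps are kept as long as the conditional variances up to and including the
    step sum to at most C and the conditional Lindeberg masses to at most eps^2.
    Both sums are known before the step is made, so stopping preserves the
    martingale property. *)
Definition active k : set T :=
  [set w | \sum_(i < k.+1) v i w <= C /\ \sum_(i < k.+1) lam i w <= eps ^+ 2].

Definition tau k : T -> R := \1_(active k).

Definition stopped_sum k w := \sum_(j < k) tau j w * xi j w.

Definition stopped_var k w := \sum_(j < k) tau j w * v j w.

(** For independent centred Gaussian increments of variances v this is exactly a
    martingale, the real part of e^{i (S + th) + V / 2}; in general it is one up
    to the errors of a second order expansion. *)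
Definition exp_mart th k w :=
  cos (stopped_sum k w + th) * expR (stopped_var k w / 2).

Let G_sigma k : (k <= N)%N -> sigma_algebra setT (G k).
Proof. by case: filtG => + _ _; exact. Qed.

Let G_sub k : (k <= N)%N -> G k `<=` measurable.
Proof. by case: filtG => _ + _; exact. Qed.

Let G_mono k l (f : T -> R) : (k <= l <= N)%N -> measurable_wrt (G k) f ->
  measurable_wrt (G l) f.
Proof.
move=> /andP[kl lN]; apply: measurable_wrtS.
by case: filtG => _ _ + ; exact.
Qed.

Let G_fun k (f : T -> R) : (k <= N)%N -> measurable_wrt (G k) f -> measurable_fun setT f.
Proof. by move=> /G_sub; exact: measurable_wrt_fun. Qed.

Lemma tau01 k w : tau k w = 0 \/ tau k w = 1.
Proof. by rewrite /tau indicE; case: (_ \in _); [right|left]. Qed.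

Lemma tau_sq k w : tau k w ^+ 2 = tau k w.
Proof. by case: (tau01 k w) => ->; rewrite ?expr0n ?expr1n. Qed.

Lemma tau_ge0 k w : 0 <= tau k w.
Proof. by case: (tau01 k w) => ->. Qed.

Lemma tau_le1 k w : tau k w <= 1.
Proof. by case: (tau01 k w) => ->. Qed.

Lemma bounded_tau k : bounded_by 1 (tau k).
Proof. by move=> w; rewrite ger0_norm ?tau_ge0 ?tau_le1. Qed.

Let partial_meas (u : nat -> T -> R) k : (k < N)%N ->
  (forall j, (j < N)%N -> measurable_wrt (G j) (u j)) ->
  measurable_wrt (G k) (fun w => \sum_(i < k.+1) u i w).
Proof.
move=> kN mu; apply: measurable_sum => i.
apply: (@G_mono i); first by rewrite -ltnS ltn_ord ltnW.
by apply: mu; rewrite (leq_ltn_trans _ kN)// -ltnS.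
Qed.

Lemma tau_meas k : (k < N)%N -> measurable_wrt (G k) (tau k).
Proof.
move=> kN; apply: measurable_wrt_indic.
have sub (u : nat -> T -> R) c :
    (forall j, (j < N)%N -> measurable_wrt (G j) (u j)) ->
    G k [set w | \sum_(i < k.+1) u i w <= c].
  move=> mu; rewrite (_ : [set w | _] =
    (fun w => \sum_(i < k.+1) u i w) @^-1` [set` `]-oo, c]]); last first.
    by apply/seteqP; split => w /=; rewrite in_itv/=.
  apply: measurable_wrt_preimage => //; first exact/G_sigma/ltnW.
  exact: partial_meas.
have := sub _ C v_meas; have := sub _ (eps ^+ 2) lam_meas.
have sG := G_sigma (ltnW kN).
rewrite -[G k](sigma_algebra_id sG) => Gl Gv.
exact: (@measurableI _ (g_sigma_algebraType (G k)) _ _ Gv Gl).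
Qed.

(** The last active step bounds the whole stopped sum. *)
Let stopped_le (u : nat -> T -> R) c k w : 0 <= c ->
  (forall j, tau j w = 1 -> \sum_(i < j.+1) u i w <= c) ->
  (forall j, 0 <= u j w) -> \sum_(j < k) tau j w * u j w <= c.
Proof.
move=> c0 uc u0; elim: k => [|k IH]; first by rewrite big_ord0.
case: (tau01 k w) => tk.
  by rewrite big_ord_recr/= tk mul0r addr0.
apply: le_trans (uc k tk); apply: ler_sum => i _.
by rewrite ler_piMl// tau_le1.
Qed.

Lemma stopped_var_le k w : stopped_var k w <= C.
Proof.
apply: stopped_le => // j; rewrite /tau indicE.
case: (boolP (_ \in _)) => [|_ /eqP]; last by rewrite eq_sym oner_eq0.
by rewrite inE => -[].
Qed.

Lemma stopped_lam_le k w : \sum_(j < k) tau j w * lam j w <= eps ^+ 2.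
Proof.
apply: stopped_le => //; first exact: sqr_ge0.
move=> j; rewrite /tau indicE.
case: (boolP (_ \in _)) => [|_ /eqP]; last by rewrite eq_sym oner_eq0.
by rewrite inE => -[].
Qed.

Lemma stopped_var_ge0 k w : 0 <= stopped_var k w.
Proof. by apply: sumr_ge0 => i _; rewrite mulr_ge0// tau_ge0. Qed.

Lemma tau_var_le k w : tau k w * v k w <= C.
Proof.
apply: le_trans (stopped_var_le k.+1 w).
by rewrite /stopped_var big_ord_recr/= lerDr; exact: stopped_var_ge0.
Qed.

Lemma tau_lam_le k w : tau k w * lam k w <= eps ^+ 2.
Proof.
apply: le_trans (stopped_lam_le k.+1 w).
rewrite big_ord_recr/= lerDr; apply: sumr_ge0 => i _.
by rewrite mulr_ge0// tau_ge0.
Qed.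

Lemma stopped_sum_meas k : (k <= N)%N -> measurable_wrt (G k) (stopped_sum k).
Proof.
move=> kN; apply: measurable_sum => i.
have iN : (i < N)%N by exact: leq_trans (ltn_ord i) kN.
apply: measurable_funM.
- by apply: (@G_mono i); rewrite ?(ltnW (ltn_ord i))//; exact: tau_meas.
- by apply: (@G_mono i.+1); rewrite ?(ltn_ord i)//; exact: xi_meas.
Qed.

Lemma stopped_var_meas k : (k < N)%N -> measurable_wrt (G k) (stopped_var k.+1).
Proof.
move=> kN; apply: measurable_sum => i.
have ik : (i <= k)%N by rewrite -ltnS.
have iN : (i < N)%N by exact: leq_ltn_trans kN.
apply: measurable_funM.
- by apply: (@G_mono i); rewrite ?ik ?(ltnW kN)//; exact: tau_meas.
- by apply: (@G_mono i); rewrite ?ik ?(ltnW kN)//; exact: v_meas.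
Qed.

Lemma exp_var_meas k : (k <= N)%N ->
  measurable_wrt (G k) (fun w => expR (stopped_var k w / 2)).
Proof.
move=> kN; apply: measurableT_comp => //; apply: measurable_funM => //.
case: k kN => [|k] kN.
  rewrite (_ : stopped_var 0 = cst 0)//.
  by apply/funext => w; rewrite /stopped_var big_ord0.
by apply: (@G_mono k); [rewrite leqnSn|exact: stopped_var_meas].
Qed.

Lemma stopped_phase_meas th k : (k <= N)%N ->
  measurable_wrt (G k) (fun w => stopped_sum k w + th).
Proof. by move=> kN; apply: measurable_funD => //; exact: stopped_sum_meas. Qed.

Lemma exp_mart_meas th k : (k <= N)%N -> measurable_wrt (G k) (exp_mart th k).
Proof.
move=> kN; apply: measurable_funM; last exact: exp_var_meas.
by apply: measurable_cos_comp; exact: stopped_phase_meas.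
Qed.

Lemma bounded_exp_var k : bounded_by (expR (C / 2)) (fun w => expR (stopped_var k w / 2)).
Proof.
move=> w; rewrite ger0_norm ?expR_ge0// ler_expR ler_pM2r//.
exact: stopped_var_le.
Qed.

Lemma bounded_exp_mart th k : bounded_by (expR (C / 2)) (exp_mart th k).
Proof.
move=> w; rewrite normrM (le_trans _ (bounded_exp_var k w))// ler_piMl//.
exact: cos_max.
Qed.

Let xi_L1 k : (k < N)%N -> L1 P (xi k).
Proof.
move=> kN; apply: (@L1_le _ _ _ _ _ (fun w => 1 + xi k w ^+ 2)).
- by apply: G_fun (xi_meas kN).
- by apply: L1D; [exact: L1_cst|exact: xi_L2].
- move=> w; have := sqr_ge0 (`|xi k w| - 1).
  have := sqr_ge0 (xi k w); rewrite sqrrB1 real_normK ?num_real//; lra.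
Qed.

Let tail_L1 k : (k < N)%N -> L1 P (tail k).
Proof.
move=> kN; apply: (@L1_le _ _ _ _ _ (fun w => xi k w ^+ 2)); last 2 first.
- exact: xi_L2.
- move=> w; rewrite normrM ger0_norm ?sqr_ge0// normr_nat.
  by rewrite ler_piMr ?sqr_ge0// lern1; case: (_ <= _).
have mxi := G_fun kN (xi_meas kN).
apply: measurable_funM; first exact: measurable_funX.
rewrite (_ : (fun x => _) = \1_((fun w => `|xi k w|) @^-1` [set` `[eps, +oo[])); last first.
  by apply/funext => w; rewrite indicE; congr ((nat_of_bool _)%:R);
    apply/idP/idP; rewrite inE/= in_itv/= andbT.
apply: measurable_indic; rewrite -[X in measurable X]setTI.
by apply: measurableT_comp.
Qed.


Section one_step.
Variables (th K : R) (eta : T -> R) (k : nat).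
Hypotheses (kN : (k < N)%N) (eta_fun : measurable_fun setT eta).
Hypothesis eta_K : bounded_by K eta.

Let kN' : (k <= N)%N := ltnW kN.

Let K0 : 0 <= K.
Proof. by apply: le_trans (eta_K point). Qed.

Let e w := expR (stopped_var k.+1 w / 2).
Let x w := stopped_sum k w + th.

Let e_meas : measurable_wrt (G k) e.
Proof.
apply: measurableT_comp => //; apply: measurable_funM => //.
exact: stopped_var_meas.
Qed.

Let e_ge0 w : 0 <= e w. Proof. exact: expR_ge0. Qed.

Let e_le w : e w <= expR (C / 2).
Proof. by apply: le_trans (bounded_exp_var k.+1 w); rewrite ger0_norm. Qed.

Let incr w := eta w * (exp_mart th k.+1 w - exp_mart th k w).

(** Factoring out the predictable weight e leaves the difference between the
    cosine after the step and the Gaussian damping of the cosine before it. *)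
Let incrE w : incr w = eta w * e w *
  (cos (x w + tau k w * xi k w) - expR (- (tau k w * v k w / 2)) * cos (x w)).
Proof.
rewrite /incr /exp_mart /x /e {1}/stopped_sum big_ord_recr/= -/(stopped_sum k w).
have -> : stopped_sum k w + tau k w * xi k w + th =
  stopped_sum k w + th + tau k w * xi k w by ring.
have -> : expR (stopped_var k w / 2) =
  expR (stopped_var k.+1 w / 2) * expR (- (tau k w * v k w / 2)).
  rewrite -expRD; congr expR; rewrite /stopped_var big_ord_recr/=.
  by ring.
by ring.
Qed.

Let incr_L1 : L1 P incr.
Proof.
apply: (@L1_bounded _ _ _ _ (K * (expR (C / 2) + expR (C / 2)))).
  apply: measurable_funM => //.
  by apply: measurable_funB; apply: G_fun (exp_mart_meas _ _).
move=> w; rewrite /incr normrM ler_pM//.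
by rewrite (le_trans (ler_normB _ _))// lerD// bounded_exp_mart.
Qed.

Let E_tau_xi2 : Ex P (fun w => tau k w * xi k w ^+ 2) = Ex P (fun w => tau k w * v k w).
Proof. exact: xi_var (tau_meas kN) (bounded_tau k). Qed.

Let E_tau_tail : Ex P (fun w => tau k w * tail k w) <= Ex P (fun w => tau k w * lam k w).
Proof. exact: xi_lind (tau_meas kN) (bounded_tau k) (tau_ge0 k). Qed.

Let mtau : measurable_fun setT (tau k).
Proof. exact: G_fun (tau_meas kN). Qed.

Let tauL1 f : L1 P f -> L1 P (fun w => tau k w * f w).
Proof. by move=> L1f; exact: L1_mulb mtau (bounded_tau k) L1f. Qed.

Let tau_v_bounded : bounded_by C (fun w => tau k w * v k w).
Proof. by move=> w; rewrite ger0_norm ?tau_var_le// mulr_ge0// tau_ge0. Qed.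

Let tau_v_meas : measurable_wrt (G k) (fun w => tau k w * v k w).
Proof. by apply: measurable_funM; [exact: tau_meas|exact: v_meas]. Qed.

Let tvL1 f : L1 P f -> L1 P (fun w => tau k w * v k w * f w).
Proof. by move=> L1f; exact: L1_mulb (G_fun kN' tau_v_meas) tau_v_bounded L1f. Qed.

(** The expansion of the damping factor leaves v^2, which is dominated by
    splitting the step at level eps: v E(xi^2 | past) <= v (eps^2 + lam), with v
    at most C while active. *)
Let E_tau_v2 : Ex P (fun w => tau k w * v k w * v k w) <=
  eps ^+ 2 * Ex P (fun w => tau k w * v k w) + C * Ex P (fun w => tau k w * lam k w).
Proof.
rewrite -(xi_var kN tau_v_meas tau_v_bounded).
apply: (@le_trans _ _ (eps ^+ 2 * Ex P (fun w => tau k w * v k w) +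
    Ex P (fun w => tau k w * v k w * tail k w))).
  rewrite -ExZ; last exact/tauL1/v_L1.
  rewrite -ExD; last 2 first.
  - exact/L1Z/tauL1/v_L1.
  - exact/tvL1/tail_L1.
  apply: Ex_le.
  - exact/tvL1/xi_L2.
  - by apply: L1D; [exact/L1Z/tauL1/v_L1|exact/tvL1/tail_L1].
  move=> w; rewrite [leRHS](_ : _ = tau k w * v k w * (eps ^+ 2 + tail k w)); last by ring.
  rewrite ler_wpM2l ?mulr_ge0 ?tau_ge0// /tail.
  have [ex|xe] := leP eps `|xi k w|; first by rewrite mulr1 lerDr sqr_ge0.
  by rewrite mulr0 addr0 sqr_le_of_norm// ltW.
rewrite lerD2l (le_trans (xi_lind kN tau_v_meas tau_v_bounded _))//.
  by move=> w; rewrite mulr_ge0// tau_ge0.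
rewrite -ExZ; last exact/tauL1/lam_L1.
apply: Ex_le; [exact/tvL1/lam_L1|exact/L1Z/tauL1/lam_L1|move=> w].
have := tau_var_le k w; have [->|->] := tau01 k w; first by rewrite !mul0r mulr0.
by rewrite !mul1r => vC; rewrite ler_wpM2r.
Qed.

(** First order terms vanish by the martingale property and the second order ones
    cancel against the conditional variance; what remains is cubic, a Lindeberg
    tail, or quadratic in v. *)
Lemma exp_mart_step : measurable_wrt (G k) eta ->
  `|Ex P incr| <= K * expR (C / 2) *
    ((3 + C) * Ex P (fun w => tau k w * lam k w) +
     (3 * eps + eps ^+ 2) * Ex P (fun w => tau k w * v k w)).
Proof.
move=> eta_meas; have [eps0 eps1] := andP eps01.
(* predictable coefficients of xi and of xi^2 in the expansion of the increment *)
pose h1 w := - (eta w * e w * tau k w * sin (x w)).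
pose h2 w := - (eta w * e w * tau k w * cos (x w) / 2).
have m0 : measurable_wrt (G k) (fun w => eta w * e w * tau k w).
  by apply: measurable_funM; [exact: measurable_funM|exact: tau_meas].
have m1 : measurable_wrt (G k) h1.
  apply: measurableT_comp => //; apply: measurable_funM => //.
  by apply: measurable_sin_comp; exact: stopped_phase_meas.
have m2 : measurable_wrt (G k) h2.
  apply: measurableT_comp => //; apply: measurable_funM => //.
  apply: measurable_funM => //.
  by apply: measurable_cos_comp; exact: stopped_phase_meas.
have ee w : `|eta w * e w| <= K * expR (C / 2).
  by rewrite normrM ler_pM// ger0_norm// e_le.
have b0 w : `|eta w * e w * tau k w| <= K * expR (C / 2).
  rewrite normrM (le_trans _ (ee w))// ler_piMr//; exact: bounded_tau.
have b1 : bounded_by (K * expR (C / 2)) h1.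
  by move=> w; rewrite normrN normrM (le_trans _ (b0 w))// ler_piMr// sin_max.
have b2 : bounded_by (K * expR (C / 2)) h2.
  move=> w; rewrite normrN normrM (@ger0_norm _ 2^-1)// normrM.
  rewrite (le_trans _ (b0 w))// -mulrA ler_piMr//.
  by have := cos_max (x w); have := normr_ge0 (cos (x w)); lra.
have L1h1 : L1 P (fun w => h1 w * xi k w).
  exact: L1_mulb (G_fun kN' m1) b1 (xi_L1 kN).
have L1h2 : L1 P (fun w => h2 w * xi k w ^+ 2).
  exact: L1_mulb (G_fun kN' m2) b2 (xi_L2 kN).
have L1h2' : L1 P (fun w => h2 w * v k w).
  exact: L1_mulb (G_fun kN' m2) b2 (v_L1 kN).
pose B w := 3 * (tau k w * tail k w) + 3 * eps * (tau k w * xi k w ^+ 2) +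
  tau k w * v k w * v k w.
have iB : L1 P B.
  apply: L1D; last exact/tvL1/v_L1.
  by apply: L1D; apply/L1Z/tauL1; [exact: tail_L1|exact: xi_L2].
pose rest w := incr w - (h1 w * xi k w + (h2 w * xi k w ^+ 2 - h2 w * v k w)).
have L1h : L1 P (fun w => h1 w * xi k w + (h2 w * xi k w ^+ 2 - h2 w * v k w)).
  by apply: L1D => //; exact: L1B.
have L1rest : L1 P rest by exact: L1B.
have Erest : Ex P incr = Ex P rest.
  rewrite ExB// ExD//; last exact: L1B.
  rewrite ExB// (xi_mart kN m1 b1) (xi_var kN m2 b2) subrr addr0 subr0.
  by [].
have restB w : `|rest w| <= K * expR (C / 2) * B w.
  have -> : rest w = eta w * e w * ((cos (x w + tau k w * xi k w) - cos (x w) +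
     tau k w * xi k w * sin (x w) + (tau k w * xi k w) ^+ 2 / 2 * cos (x w)) +
     cos (x w) * (1 - tau k w * v k w / 2 - expR (- (tau k w * v k w / 2)))).
    by rewrite /rest incrE /h1 /h2 exprMn tau_sq; field.
  rewrite normrM; apply: ler_pM => //.
  rewrite (le_trans (ler_normD _ _))//; apply: lerD.
    have := cos_taylor2 (x w) (tau k w * xi k w) (ltW eps0).
    move/le_trans; apply; rewrite mulrDr exprMn tau_sq; apply: lerD; last by rewrite !mulrA.
    rewrite ler_pM2l// /tail mulrA; have [->|->] := tau01 k w; first by rewrite !mul0r.
    by rewrite !mul1r.
  rewrite normrM (@le_trans _ _ ((tau k w * v k w / 2) ^+ 2))//.
    rewrite (le_trans _ (expRN_taylor1 _))//; first by rewrite ler_piMl// cos_max.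
    by rewrite divr_ge0// mulr_ge0// tau_ge0.
  have [->|->] := tau01 k w; rewrite ?mul0r ?expr0n//= !mul1r exprMn.
  by have := sqr_ge0 (v k w); lra.
rewrite Erest; apply: (@le_trans _ _ (K * expR (C / 2) * Ex P B)).
  by rewrite -ExZ//; apply: Ex_norm_le => //; exact: L1Z.
rewrite ler_wpM2l ?mulr_ge0 ?expR_ge0// /B.
rewrite ExD; [|by apply: L1D; apply/L1Z/tauL1; [exact: tail_L1|exact: xi_L2]|exact/tvL1/v_L1].
rewrite ExD; [|exact/L1Z/tauL1/tail_L1|exact/L1Z/tauL1/xi_L2].
rewrite !ExZ; [|exact/tauL1/xi_L2|exact/tauL1/tail_L1].
by rewrite E_tau_xi2; have := E_tau_v2; have := E_tau_tail; lra.
Qed.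

(** For the steps made before the weight is known there is no cancellation to
    exploit; but an active step has conditional variance at most 2 eps^2, so its
    effect is O(eps) in the mean whatever the weight. *)
Lemma exp_mart_coarse_step : `|Ex P incr| <= K * expR (C / 2) * (4 * eps).
Proof.
have [eps0 eps1] := andP eps01.
pose B w := eps + eps^-1 * (tau k w * xi k w ^+ 2) + tau k w * v k w / 2.
have L1x : L1 P (fun w => eps^-1 * (tau k w * xi k w ^+ 2)) by exact/L1Z/tauL1/xi_L2.
have L1v : L1 P (fun w => tau k w * v k w / 2).
  have : L1 P (fun w => 2^-1 * (tau k w * v k w)) by exact/L1Z/tauL1/v_L1.
  by congr (L1 P _); apply/funext => w; rewrite mulrC.
have iB : L1 P B by do 2?apply: L1D => //; exact: L1_cst.
have Etv : Ex P (fun w => tau k w * v k w) <= 2 * eps ^+ 2.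
  rewrite -E_tau_xi2; apply: (@le_trans _ _ (eps ^+ 2 + Ex P (fun w => tau k w * tail k w))).
    rewrite -{1}(Ex_cst P (eps ^+ 2)) -ExD; [|exact: L1_cst|exact/tauL1/tail_L1].
    apply: Ex_le; [exact/tauL1/xi_L2|by apply: L1D; [exact: L1_cst|exact/tauL1/tail_L1]|].
    move=> w; rewrite /tail; have [->|->] := tau01 k w; first by rewrite !mul0r addr0 sqr_ge0.
    rewrite !mul1r; have [ex|xe] := leP eps `|xi k w|; first by rewrite mulr1 lerDr sqr_ge0.
    by rewrite mulr0 addr0 sqr_le_of_norm// ltW.
  rewrite mulr_natl mulr2n lerD2l (le_trans E_tau_tail)// -(Ex_cst P (eps ^+ 2)).
  apply: Ex_le; [exact/tauL1/lam_L1|exact: L1_cst|exact: tau_lam_le].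
have incB w : `|incr w| <= K * expR (C / 2) * B w.
  rewrite incrE normrM ler_pM// ?normrM ?ler_pM//; first by rewrite ger0_norm// e_le.
  set a := tau k w * v k w / 2; set y := tau k w * xi k w.
  have a0 : 0 <= a by rewrite divr_ge0// mulr_ge0// tau_ge0.
  have -> : cos (x w + y) - expR (- a) * cos (x w) =
    (cos (x w + y) - cos (x w)) + (1 - expR (- a)) * cos (x w) by ring.
  rewrite (le_trans (ler_normD _ _))// /B; apply: lerD.
    apply: (le_trans (cosD_abs_le _ _)); rewrite /y.
    have [->|->] := tau01 k w; first by rewrite !mul0r mulr0 addr0 normr0 ltW.
    rewrite !mul1r; set z := xi k w; have [zl|zl] := leP `|z| eps.
      by rewrite (le_trans zl)// lerDl mulr_ge0 ?sqr_ge0// invr_ge0 ltW.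
    rewrite (@le_trans _ _ (eps^-1 * z ^+ 2))//; last by rewrite lerDr ltW.
    rewrite ler_pdivlMl// -real_normK ?num_real// expr2.
    by rewrite ler_wpM2r// ltW.
  rewrite normrM (@le_trans _ _ `|1 - expR (- a)|)//; first by rewrite ler_piMr// cos_max.
  rewrite ger0_norm.
    by rewrite -/a; have := expR_ge1Dx (- a); lra.
  by rewrite subr_ge0 -expR0 ler_expR oppr_le0.
apply: (@le_trans _ _ (K * expR (C / 2) * Ex P B)).
  by rewrite -ExZ//; apply: Ex_norm_le => //; exact: L1Z.
rewrite ler_wpM2l ?mulr_ge0 ?expR_ge0// /B.
rewrite ExD; [|by apply: L1D => //; exact: L1_cst|by []].
rewrite ExD; [|exact: L1_cst|by []].
rewrite [Ex P (fun=> eps)]Ex_cst ExZ; last exact/tauL1/xi_L2.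
have -> : Ex P (fun w => tau k w * v k w / 2) = Ex P (fun w => tau k w * v k w) / 2.
  by rewrite mulrC -ExZ; [apply: eq_Ex => w; rewrite mulrC|exact/tauL1/v_L1].
rewrite E_tau_xi2; have e1 : eps^-1 * Ex P (fun w => tau k w * v k w) <= 2 * eps.
  by rewrite ler_pdivrMl//; apply: le_trans Etv _; rewrite expr2; lra.
have : eps ^+ 2 <= eps by rewrite expr2 ler_piMr// ltW.
by move: Etv e1; lra.
Qed.

End one_step.

(** The first m steps are estimated by [exp_mart_coarse_step], the others by
    [exp_mart_step], whose errors add up because the stopped sums of v and lam
    are bounded by C and eps^2.  The bound does not depend on the number N of
    steps. *)
Lemma exp_mart_bound th K eta m : (m <= N)%N -> measurable_wrt (G m) eta ->
  bounded_by K eta ->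
  `|Ex P (fun w => eta w * exp_mart th N w) - cos th * Ex P eta| <=
  K * expR (C / 2) * (eps * (4 * m%:R + 3 + 5 * C)).
Proof.
move=> mN eta_m etaK; have [eps0 eps1] := andP eps01.
have eta_fun := G_fun mN eta_m.
have K0 : 0 <= K by apply: le_trans (etaK point).
pose D k w := eta w * (exp_mart th k.+1 w - exp_mart th k w).
have mG k : (k <= N)%N -> measurable_fun setT (exp_mart th k).
  by move=> kN; apply: G_fun (exp_mart_meas th kN).
have L1D' k : (k < N)%N -> L1 P (D k).
  move=> kN; apply: (@L1_bounded _ _ _ _ (K * (expR (C / 2) + expR (C / 2)))).
    by apply: measurable_funM => //; apply: measurable_funB; apply: mG => //; exact: ltnW.
  move=> w; rewrite /D normrM ler_pM//.
  by rewrite (le_trans (ler_normB _ _))// lerD// bounded_exp_mart.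
have L1eta : L1 P eta by exact: L1_bounded etaK.
have L1etaG : L1 P (fun w => eta w * exp_mart th N w).
  apply: (L1_mulb eta_fun etaK); apply: L1_bounded (bounded_exp_mart th N).
  exact: mG.
rewrite -ExZ// -ExB//; last exact: L1Z.
have -> : Ex P (fun w => eta w * exp_mart th N w - cos th * eta w) =
    \sum_(k < N) Ex P (D k).
  rewrite -Ex_sum; last by move=> k _; exact: L1D'.
  apply: eq_Ex => w; rewrite -mulr_sumr -(big_mkord xpredT
    (fun k => exp_mart th k.+1 w - exp_mart th k w)) telescope_sumr//.
  rewrite {3}/exp_mart /stopped_sum /stopped_var !big_ord0 mul0r expR0 add0r.
  by ring.
pose tl k := Ex P (fun w => tau k w * lam k w).
pose tv k := Ex P (fun w => tau k w * v k w).
have mtau k : (k < N)%N -> measurable_fun setT (tau k).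
  by move=> kN; apply: G_fun (tau_meas kN); exact: ltnW.
have L1tl k : (k < N)%N -> L1 P (fun w => tau k w * lam k w).
  by move=> kN; exact: L1_mulb (mtau k kN) (bounded_tau k) (lam_L1 kN).
have L1tv k : (k < N)%N -> L1 P (fun w => tau k w * v k w).
  by move=> kN; exact: L1_mulb (mtau k kN) (bounded_tau k) (v_L1 kN).
have stl : \sum_(k < N) tl k <= eps ^+ 2.
  rewrite -Ex_sum; last by move=> k _; exact: L1tl.
  rewrite -(Ex_cst P (eps ^+ 2)); apply: Ex_le; last exact: stopped_lam_le.
    by apply: L1_sum => k _; exact: L1tl.
  exact: L1_cst.
have stv : \sum_(k < N) tv k <= C.
  rewrite -Ex_sum; last by move=> k _; exact: L1tv.
  rewrite -(Ex_cst P C); apply: Ex_le; last exact: stopped_var_le.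
    by apply: L1_sum => k _; exact: L1tv.
  exact: L1_cst.
have tl0 k : 0 <= tl k by apply: Ex_ge0 => w; rewrite mulr_ge0// tau_ge0.
have tv0 k : 0 <= tv k by apply: Ex_ge0 => w; rewrite mulr_ge0// tau_ge0.
pose b k := (k < m)%N%:R * (4 * eps) + ((3 + C) * tl k + (3 * eps + eps ^+ 2) * tv k).
have step k : (k < N)%N -> `|Ex P (D k)| <= K * expR (C / 2) * b k.
  move=> kN; rewrite /b; have [km|mk] := ltnP k m.
    apply: (le_trans (exp_mart_coarse_step th kN eta_fun etaK)).
    rewrite ler_wpM2l ?mulr_ge0 ?expR_ge0// mul1r lerDl.
    by rewrite addr_ge0// mulr_ge0 ?addr_ge0// ?mulr_ge0 ?sqr_ge0// ltW.
  rewrite mul0r add0r; apply: exp_mart_step => //.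
  by apply: (@G_mono m) => //; rewrite mk ltnW.
apply: (le_trans (ler_norm_sum _ _ _)).
apply: (@le_trans _ _ (\sum_(k < N) K * expR (C / 2) * b k)).
  by apply: ler_sum => k _; exact: step.
rewrite -mulr_sumr ler_wpM2l ?mulr_ge0 ?expR_ge0// /b !big_split/= -!mulr_sumr -mulr_suml.
have -> : \sum_(k < N) (k < m)%N%:R = m%:R :> R.
  rewrite -natr_sum; congr (_%:R).
  rewrite -(big_mkord xpredT (fun k => (k < m)%N : nat)) (big_cat_nat (leq0n _) mN)/=.
  rewrite big_nat (eq_bigr (fun=> 1%N)); last by move=> k /andP[_ ->].
  rewrite -big_nat sum_nat_const_nat subn0 muln1 big_nat big1 ?addn0//.
  by move=> k /andP[+ _]; rewrite ltnNge => ->.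
have eps2 : eps ^+ 2 <= eps by rewrite expr2 ler_piMr// ltW.
have h1 : (3 + C) * (\sum_(k < N) tl k) <= (3 + C) * eps.
  by rewrite ler_wpM2l ?addr_ge0// (le_trans stl).
have h2 : (3 * eps + eps ^+ 2) * (\sum_(k < N) tv k) <= (3 * eps + eps) * C.
  apply: ler_pM => //; first by rewrite addr_ge0 ?sqr_ge0// mulr_ge0// ltW.
  - by apply: sumr_ge0 => k _; exact: tv0.
  - by rewrite lerD2l.
by move: h1 h2; lra.
Qed.

End stopped_martingale.

(** * The Gaussian characteristic function *)

Section gaussian_characteristic_function.
Context {R : realType}.
Implicit Types (y z t : R).
Local Notation mu := (@lebesgue_measure R).
Local Notation phi := (normal_pdf (0 : R) 1).
Local Notation N01 := (normal_prob (0 : R) 1).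

Let peak : R := normal_peak 1.

Lemma normal_pdf01E z : phi z = peak * expR (2^-1 * - z ^+ 2).
Proof.
rewrite normal_pdfE ?oner_neq0// /normal_fun subr0 expr1n.
by congr (_ * expR _); rewrite [LHS]mulrC.
Qed.

Local Lemma is_derive_phi (z : R) : is_derive z (1 : R) phi (- z * phi z).
Proof.
have -> : phi = fun t => peak * expR (2^-1 * - t ^+ 2).
  by apply/funext => t; exact: normal_pdf01E.
apply: is_derive_eq.
by rewrite /GRing.scale/=; field.
Qed.

#[local] Existing Instance is_derive_phi.

Let phi_ge0 z : 0 <= phi z. Proof. exact: normal_pdf_ge0. Qed.

Let mphi : measurable_fun setT phi. Proof. exact: measurable_normal_pdf. Qed.

Let iphi : mu.-integrable setT (EFin \o phi).
Proof. exact: integrable_normal_pdf. Qed.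

Let mabs : measurable_fun setT (fun z : R => `|z| * phi z).
Proof. by apply: measurable_funM => //; exact: measurableT_comp. Qed.

(** A Gaussian density of variance 2 dominates |z| phi(z), since
    |z| <= e^{z^2 / 4}. *)
Let iabsphi : mu.-integrable setT (EFin \o (fun z => `|z| * phi z)).
Proof.
pose s : R := Num.sqrt 2.
have s0 : s != 0 by rewrite gt_eqF// sqrtr_gt0.
have p0 : 0 < normal_peak s by exact: normal_peak_gt0.
have := integrableZl measurableT (peak / normal_peak s) (integrable_normal_pdf 0 s).
apply: le_integrable => //; first exact/measurable_EFinP.
move=> z _; have a0 : 0 <= `|z| * phi z by rewrite mulr_ge0.
rewrite /= lee_fin (ger0_norm a0).
rewrite normal_pdf01E normal_pdfE// /normal_fun subr0 sqr_sqrtr//.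
have e0 : 0 <= peak / normal_peak s * (normal_peak s * expR (- z ^+ 2 / (2 *+ 2))).
  by rewrite !mulr_ge0 ?invr_ge0 ?normal_peak_ge0// expR_ge0.
rewrite (ger0_norm e0).
rewrite [leRHS]mulrA divfK ?gt_eqF// mulrCA ler_wpM2l ?normal_peak_ge0//.
rewrite (_ : 2^-1 * - z ^+ 2 = - z ^+ 2 / (2 *+ 2) + - z ^+ 2 / (2 *+ 2)); last by field.
rewrite expRD mulrA ler_piMl// mulNr expRN ler_pdivrMr ?expR_gt0// mul1r.
apply: le_trans (expR_ge1Dx _).
have := sqr_ge0 (1 - `|z| / 2); rewrite -[in z ^+ 2](real_normK (num_real z)).
by rewrite -mulr_natr; lra.
Qed.

Variable x : R.
Let f (y z : R) := cos (x + y * z) * phi z.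
Let df (y z : R) := - z * sin (x + y * z) * phi z.

Let mcos y : measurable_fun setT (fun z : R => cos (x + y * z)).
Proof.
by apply: measurable_cos_comp; apply: measurable_funD => //; exact: measurable_funM.
Qed.

Let msin y : measurable_fun setT (fun z : R => sin (x + y * z)).
Proof.
by apply: measurable_sin_comp; apply: measurable_funD => //; exact: measurable_funM.
Qed.

Let mf y : measurable_fun setT (f y).
Proof. exact: measurable_funM. Qed.

Let mdf y : measurable_fun setT (df y).
Proof.
by apply: measurable_funM => //; apply: measurable_funM => //; exact: measurableT_comp.
Qed.

Let i_f y : mu.-integrable setT (EFin \o f y).
Proof.
have m := mf y; apply: (le_integrable measurableT _ _ iphi).
  exact/measurable_EFinP.
by move=> z _; rewrite /= lee_fin normrM ler_piMl// cos_max.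
Qed.

Let df_le y z : `|df y z| <= `|z| * phi z.
Proof.
rewrite !normrM normrN (ger0_norm (phi_ge0 z)) ler_wpM2r// ler_piMr//.
exact: sin_max.
Qed.

Let i_df y : mu.-integrable setT (EFin \o df y).
Proof.
have m := mdf y; apply: (le_integrable measurableT _ _ iabsphi).
  exact/measurable_EFinP.
by move=> z _; rewrite /= lee_fin (le_trans (df_le _ _))// ler_norm.
Qed.

Let der_f (y : R) (z : R) : is_derive y (1 : R) (f ^~ z) (df y z).
Proof.
rewrite /f; apply: is_derive_eq.
by rewrite /df /GRing.scale/=; ring.
Qed.

Let Phi y := (\int[mu]_z f y z)%R.

(** Differentiation under the integral sign, dominated by |z| phi(z). *)
Let der_Phi (y : R) : is_derive y (1 : R) Phi (\int[mu]_z df y z)%R.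
Proof.
have Iy : [set` `]y - 1, y + 1[] y by rewrite /= in_itv/= ltrBlDr ltrDl ltr01 //= ltrDl ltr01.
have d1 t z : partial1of2 f t z = df t z.
  by rewrite partial1of2E; exact: derive_val.
have G_ub t z : [set` `]y - 1, y + 1[] t -> [set: R] z ->
   `|partial1of2 f t z| <= `|z| * phi z by rewrite d1.
have G0 z : 0 <= `|z| * phi z by rewrite mulr_ge0.
have der t z : [set` `]y - 1, y + 1[] t -> [set: R] z -> derivable (f ^~ z) t 1.
  by move=> _ _; exact: ex_derive.
have int t : [set` `]y - 1, y + 1[] t -> mu.-integrable setT (EFin \o f t).
  by move=> _; exact: i_f.
apply: DeriveDef.
  exact: (derivable_under_integral measurableT Iy int der G0 iabsphi G_ub).
rewrite -derive1E.
rewrite (differentiation_under_integral measurableT Iy int der G0 iabsphi G_ub).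
by apply: eq_Rintegral => z _; exact: d1.
Qed.

Let H y z := sin (x + y * z) * phi z.
Let dH y z := y * f y z + df y z.

Let der_H (y : R) (z : R) : is_derive z (1 : R) (H y) (dH y z).
Proof.
rewrite /H; apply: is_derive_eq.
by rewrite /dH /f /df /GRing.scale/=; ring.
Qed.

Let cts_H y : continuous (H y).
Proof.
move=> z; apply: differentiable_continuous; apply/derivable1_diffP.
by rewrite /H; exact: ex_derive.
Qed.

Let cts_dH y : continuous (dH y).
Proof.
move=> z; apply: differentiable_continuous; apply/derivable1_diffP.
by rewrite /dH /f /df; exact: ex_derive.
Qed.

Let H_small y (n : nat) z : `|z| = n.+1%:R -> `|H y z| <= peak * n.+1%:R^-1.
Proof.
move=> zn; rewrite /H normrM (ger0_norm (phi_ge0 z)).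
apply: (@le_trans _ _ (phi z)); first by rewrite ler_piMl// sin_max.
rewrite normal_pdf01E ler_wpM2l ?normal_peak_ge0// mulrN expRN.
rewrite lef_pV2 ?posrE ?expR_gt0// (le_trans _ (expR_ge1Dx _))// -zn.
rewrite -(real_normK (num_real z)).
by have := sqr_ge0 (1 - `|z|); lra.
Qed.

(** Integration by parts (Stein's identity): y f + df is the derivative in z of
    sin(x + y z) phi(z), which vanishes at infinity. *)
Let stein y : (\int[mu]_z df y z)%R = - y * Phi y.
Proof.
have idH : mu.-integrable setT (EFin \o dH y).
  exact: (integrableD measurableT (integrableZl measurableT y (i_f y)) (i_df y)).
suff E0 : (\int[mu]_z (dH y z)%:E)%E = 0%E.
  have : (\int[mu]_z dH y z)%R = 0 by rewrite /Rintegral E0.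
  rewrite /dH RintegralD//; last exact: (integrableZl measurableT y (i_f y)).
  by rewrite RintegralZl// => /eqP; rewrite addrC addr_eq0 mulNr => /eqP.
pose D (n : nat) : set R := [set` `[- n.+1%:R, n.+1%:R]].
have mD n : measurable (D n) by exact: measurable_itv.
pose h n := (EFin \o dH y) \_ (D n).
have [|||||_ _ cvh] := @dominated_convergence _ _ _ mu setT measurableT h (EFin \o dH y)
  (fun z => `|(EFin \o dH y) z|%E).
- move=> n; apply/(measurable_restrictT _ (mD n)).
  by apply: measurable_funTS; exact: measurable_int idH.
- exact: measurable_int idH.
- apply: aeW => z _; apply: cvg_near_cst; near=> n.
  rewrite /h patchE (_ : z \in D n)// inE /D/= in_itv/= -ler_norml.
  apply: (@le_trans _ _ n%:R); last by rewrite ler_nat.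
  by near: n; exact: nbhs_infty_ger.
- exact: integrable_abse.
- by apply: aeW => z n _; rewrite /h patchE; case: ifP => // _; rewrite abse0.
apply: (cvg_unique _ cvh) => //=.
have hE n : (\int[mu]_z h n z)%E = (H y n.+1%:R - H y (- n.+1%:R))%:E.
  rewrite -integral_mkcond (@continuous_FTC2 _ (dH y) (H y))//.
  - by rewrite -subr_gt0 opprK addr_gt0.
  - by apply: continuous_subspaceT; exact: cts_dH.
  - split; first by move=> z _; exact: ex_derive.
      by apply: cvg_at_right_filter; exact: cts_H.
    by apply: cvg_at_left_filter; exact: cts_H.
  - by move=> z _; rewrite derive1E; exact: derive_val.
under eq_fun do rewrite hE.
apply: cvg_EFin; first exact: nearW.
apply/norm_cvg0P.
apply: (@squeeze_cvgr _ _ _ _ (cst 0) (fun n => (peak + peak) * n.+1%:R^-1)).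
- apply: nearW => n; rewrite /= normr_ge0/= mulrDl (le_trans (ler_normB _ _))//.
  by rewrite lerD// H_small ?normrN// ger0_norm.
- exact: cvg_cst.
- rewrite -[X in _ --> X](mulr0 (peak + peak)); apply: cvgM; first exact: cvg_cst.
  exact: cvg_harmonic.
Unshelve. all: by end_near. Qed.

(** Stein's identity is the differential equation Phi' = - y Phi, so
    Phi(y) e^{y^2 / 2} is constant, and Phi(0) = cos x. *)
Lemma gaussian_cf_lebesgue y : Phi y = cos x * expR (- (y ^+ 2 / 2)).
Proof.
pose g t := Phi t * expR (2^-1 * t ^+ 2).
have der_g t : is_derive t (1 : R) g 0.
  have dPhi := der_Phi t; rewrite /g; apply: is_derive_eq.
  by rewrite stein /GRing.scale/=; field.
have := @mvt_abs _ g (cst 0) 0 y der_g.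
rewrite mul0r => /(_ _)/wrap[]; first by move=> t _; rewrite normr0.
rewrite normr_le0 subr_eq0 /g => /eqP.
rewrite expr0n/= mulr0 expR0 mulr1.
have -> : Phi 0 = cos x.
  rewrite /Phi /f; under eq_Rintegral do rewrite mul0r addr0.
  by rewrite RintegralZl// /Rintegral integral_normal_pdf mulr1.
by move=> <-; rewrite -mulrA -expRD (_ : _ + _ = 0) ?expR0 ?mulr1//; field.
Qed.

End gaussian_characteristic_function.

Section normal_law.
Context {R : realType}.
Local Notation mu := (@lebesgue_measure R).
Local Notation phi := (normal_pdf (0 : R) 1).
Local Notation N01 := (normal_prob (0 : R) 1).

Let iphi : mu.-integrable setT (EFin \o phi).
Proof. exact: integrable_normal_pdf. Qed.

Let mphi : measurable_fun setT phi. Proof. exact: measurable_normal_pdf. Qed.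

Let i_mul C (h : R -> R) : measurable_fun setT h -> bounded_by C h ->
  mu.-integrable setT (EFin \o (fun z => h z * phi z)).
Proof.
move=> mh hC; have m : measurable_fun setT (fun z => h z * phi z).
  exact: measurable_funM.
have C0 : 0 <= C by apply: le_trans (hC 0).
apply: (le_integrable measurableT _ _ (integrableZl measurableT C iphi)).
  exact/measurable_EFinP.
move=> z _; rewrite /= lee_fin !normrM (ger0_norm C0) ler_wpM2r//.
Qed.

(** The Gaussian law is given as a measure with density with respect to Lebesgue
    measure; the integral of h is compared with it by induction on bounded
    measurable functions, starting from indicators. *)
Lemma Ex_normal K (h : R -> R) : measurable_fun setT h -> bounded_by K h ->
  Ex N01 h = (\int[mu]_z (h z * phi z))%R.
Proof.
move=> mh hK; pose F : set (set R) := measurable.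
have sF : sigma_algebra setT F by exact: sigma_algebra_measurable.
have Fm : F `<=` measurable by [].
pose Q g := [/\ measurable_fun setT g, exists C, bounded_by C g &
  Ex N01 g = (\int[mu]_z (g z * phi z))%R].
suff : Q h by case.
have mhF : measurable_wrt F h.
  by move=> _ B mB; apply: sub_sigma_algebra; exact: mh.
apply: (bounded_measurable_ind sF _ _ _ mhF hK).
- move=> A mA; split; first exact: measurable_indic.
    by exists 1; exact: bounded_by_indic.
  rewrite Ex_indic//; congr fine; transitivity (\int[mu]_(z in A) (phi z)%:E)%E => //.
  rewrite [LHS]integral_mkcond.
  apply: eq_integral => z _; rewrite patchE indicE.
  by case: (z \in A); rewrite ?mul1r ?mul0r.
- move=> a f g [mf [Cf fC] fE] [mg [Cg gC] gE]; split.
  + by apply: measurable_funD => //; apply: measurable_funM.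
  + exists (`|a| * Cf + Cg) => w.
    by rewrite (le_trans (ler_normD _ _))// lerD// normrM ler_wpM2l.
  + have i1 := i_mul mf fC; have i2 := i_mul mg gC.
    have L1f : L1 N01 f by exact: L1_bounded fC.
    have L1g : L1 N01 g by exact: L1_bounded gC.
    rewrite ExD//; last exact: L1Z.
    rewrite ExZ// fE gE -RintegralZl// -RintegralD//.
      by apply: eq_Rintegral => z _; rewrite mulrDl mulrA.
    exact: (integrableZl measurableT a i1).
- move=> f mf lim_f.
  have {}mf : measurable_fun setT f by exact: (measurable_wrt_fun Fm).
  have [C fC] : exists C, bounded_by C f.
    have [g [_ [C gC] _] fg] := lim_f 1 ltr01; exists (1 + C) => w.
    by rewrite -(subrK (g w) (f w)) (le_trans (ler_normD _ _))// lerD.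
  split => //; first by exists C.
  apply: (@eq_of_dist_le _ _ _ (1 + 1)) => e e0.
  have [g [mg [C' gC'] gE] fg] := lim_f e e0.
  have L1f : L1 N01 f := @L1_bounded _ _ _ N01 C f mf fC.
  have L1g : L1 N01 g := @L1_bounded _ _ _ N01 C' g mg gC'.
  have i1 := i_mul mf fC; have i2 := i_mul mg gC'.
  rewrite -(subrK (Ex N01 g) (Ex N01 f)) -addrA.
  rewrite (le_trans (ler_normD _ _))// mulrDr mulr1 lerD//.
    rewrite -ExB//; apply: Ex_norm_bounded => //.
    exact: measurable_funB.
  rewrite gE -RintegralB//.
  apply: (le_trans (le_normr_Rintegral _ _)) => //.
    exact: (integrableB measurableT i2 i1).
  have -> : e = (\int[mu]_z (e * phi z))%R.
    by rewrite RintegralZl// /Rintegral integral_normal_pdf mulr1.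
  apply: le_Rintegral => //.
  - exact: (integrable_norm (integrableB measurableT i2 i1)).
  - exact: (integrableZl measurableT e iphi).
  - move=> z _; rewrite -mulrBl normrM distrC (ger0_norm (normal_pdf_ge0 _ _ _)).
    by rewrite ler_wpM2r// normal_pdf_ge0.
Qed.

Lemma gaussian_cf (x y : R) :
  Ex N01 (fun z => cos (x + y * z)) = cos x * expR (- (y ^+ 2 / 2)).
Proof.
rewrite (@Ex_normal 1) ?gaussian_cf_lebesgue//.
- by apply: measurable_cos_comp; apply: measurable_funD => //; exact: measurable_funM.
- by move=> z; exact: cos_max.
Qed.

End normal_law.

(** * Gaussian mixtures *)

Section freezing.
Context {disp : measure_display} {T : measurableType disp} {R : realType}.
Variables (P : probability T R).
Local Notation N01 := (normal_prob (0 : R) 1).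

(** Independence from a fixed event D passes from a pi-system to the
    sigma-algebra it generates: A |-> P(A D) and A |-> P(A) P(D) are two finite
    measures. *)
Lemma indep_generated (G : set (set T)) (D : set T) : setI_closed G ->
  G `<=` measurable -> G setT -> measurable D ->
  (forall A, G A -> P (A `&` D) = (P A * P D)%E) ->
  forall A, <<s G >> A -> P (A `&` D) = (P A * P D)%E.
Proof.
move=> GI Gm GT mD GD A GA.
have c0 : 0 <= fine (P D) by rewrite fine_ge0.
pose m1 := mrestr P mD; pose m2 := mscale (NngNum c0) P.
have E B : m2 B = (P B * P D)%E.
  by rewrite /m2 /mscale /= fineK ?fin_num_measure// muleC.
rewrite -E -[LHS]/(m1 A).
apply: (@g_sigma_algebra_measure_unique _ R _ G _ (fun=> setT)) => //.
- by apply/seteqP; split => // w _; exists 0%N.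
- by move=> B GB; apply: eq_trans (esym (E B)); exact: GD.
- move=> _; apply: le_lt_trans (ltry 1).
  by apply: probability_le1; exact: measurableI.
Qed.

Variables (H : set (set T)) (z : T -> R).
Hypotheses (sH : sigma_algebra setT H) (Hm : H `<=` measurable).
Hypothesis mz : measurable_fun setT z.
Hypothesis z_indep : forall A B, H A -> measurable B ->
  P (A `&` z @^-1` B) = (P A * N01 B)%E.

(** Under independence the law of w |-> (w, z w), with the first component
    observed through H only, is the product of P restricted to H and N(0, 1);
    Fubini then integrates out z with everything H-measurable frozen. *)
Lemma freeze K (g : g_sigma_algebraType H * measurableTypeR R -> R) : measurable_fun setT g ->
  (forall p, `|g p| <= K) ->
  Ex P (fun w => g (w, z w)) = Ex P (fun w => Ex N01 (fun t => g (w, t))).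
Proof.
move=> mg gK; pose X (w : T) : g_sigma_algebraType H * measurableTypeR R := (w, z w).
have mX : measurable_fun setT X.
  by apply: measurable_fun_pair => //; exact: (measurable_fun_trace Hm).
pose XX : {mfun T >-> (g_sigma_algebraType H * measurableTypeR R)%type} :=
  HB.pack X (isMeasurableFun.Build _ _ _ _ X mX).
have PX A : measurable A -> (trace_prob P Hm \x N01)%E A = distribution P XX A.
  apply: product_measure_unique => B C mB mC.
  rewrite /distribution/= /pushforward /trace_prob /=.
  rewrite -z_indep//; last by move: mB; rewrite /measurable/= sigma_algebra_id.
have ig : (trace_prob P Hm \x N01)%E.-integrable setT (EFin \o g).
  apply: (@measurable_bounded_integrable _ _ R) => //.
    by rewrite (le_lt_trans (probability_le1 _ _))// ltry.
  by exists K; split => [|M KM]; rewrite ?num_real//= => p _ /=; rewrite (le_trans (gK p)) ?ltW.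
have L1gX : L1 P (fun w => g (w, z w)).
  have mgX : measurable_fun setT (fun w => g (w, z w)) by exact: (measurableT_comp mg mX).
    apply: (@L1_bounded _ _ _ _ K) => // w; exact: gK.
rewrite {1}/Ex /Rintegral.
have -> : (\int[P]_w (g (w, z w))%:E)%E = (\int[trace_prob P Hm \x N01]_p (g p)%:E)%E.
  transitivity (\int[distribution P XX]_p (EFin \o g) p)%E.
    rewrite /distribution integral_pushforward//; first exact/measurable_EFinP.
  by apply: eq_measure_integral => A mA _; exact/esym/PX.
rewrite -(integral12_prod_meas1 ig).
have gwK w : bounded_by K (fun t => g (w, t)) by move=> t; exact: gK.
have mgw w : measurable_fun setT (fun t => g (w, t)) by exact: measurableT_comp.
have FE w : fubini_F N01 (EFin \o g) w = (Ex N01 (fun t => g (w, t)))%:E.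
  by rewrite /fubini_F/= ExE//; exact: L1_bounded (gwK w).
under eq_integral do rewrite FE.
rewrite (integral_trace Hm)//.
- have := measurable_fubini_F ig; rewrite (_ : fubini_F _ _ = fun w => (Ex N01 (fun t => g (w, t)))%:E).
    by move/measurable_EFinP.
  by apply/funext => w; exact: FE.
- apply: (@L1_bounded _ _ _ _ K); last by move=> w; exact: Ex_norm_bounded.
  apply: (measurable_wrt_fun Hm).
  have := measurable_fubini_F ig; rewrite (_ : fubini_F _ _ = fun w => (Ex N01 (fun t => g (w, t)))%:E).
    by move/measurable_EFinP.
  by apply/funext => w; exact: FE.
- exact: (@measurableT _ (g_sigma_algebraType H)).
Qed.

Lemma freeze_cos K (eta b c : T -> R) : measurable_wrt H eta ->
  measurable_wrt H b -> measurable_wrt H c -> bounded_by K eta ->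
  Ex P (fun w => eta w * cos (c w + b w * z w)) =
  Ex P (fun w => eta w * (cos (c w) * expR (- (b w ^+ 2 / 2)))).
Proof.
move=> meta mb mc etaK.
pose g (p : g_sigma_algebraType H * measurableTypeR R) : R := eta p.1 * cos (c p.1 + b p.1 * p.2).
have mg : measurable_fun setT g.
  apply: measurable_funM; first exact: (measurableT_comp meta).
  apply: measurable_cos_comp; apply: measurable_funD; first exact: (measurableT_comp mc).
  by apply: measurable_funM => //; exact: (measurableT_comp mb).
rewrite (@freeze K g mg); last first.
  by move=> p; rewrite normrM (le_trans _ (etaK p.1))// ler_piMr// cos_max.
apply: eq_Ex => w; rewrite /g /= -gaussian_cf ExZ//.
apply: (@L1_bounded _ _ _ _ 1).
  by apply: measurable_cos_comp; apply: measurable_funD => //; exact: measurable_funM.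
by move=> t; exact: cos_max.
Qed.

End freezing.

Section gaussian_mixture.
Context {disp : measure_display} {T : measurableType disp} {R : realType}.
Variables (P : probability T R) (d : nat) (Z : T -> 'cV[R]_d).
Variable (H : set (set T)).
Hypotheses (sH : sigma_algebra setT H) (Hm : H `<=` measurable).
Hypotheses (Z_gauss : standard_gaussian P Z).
Hypothesis Z_indep : independent_sets P H (sigma_vec Z).
Local Notation N01 := (normal_prob (0 : R) 1).

Let z (i : 'I_d) w := Z w i 0.

Let mz i : measurable_fun setT (z i). Proof. by case: Z_gauss => + _; exact. Qed.

Let box (B : 'I_d -> set R) : set T := [set w | forall i, B i (z i w)].

Let boxE B : box B = \bigcap_(i in [set: 'I_d]) (z i @^-1` B i).
Proof. by apply/seteqP; split => w /= h i; [move=> _; exact: h|exact: h]. Qed.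

Let box_sigma B : (forall i, measurable (B i)) -> sigma_vec Z (box B).
Proof.
move=> mB; rewrite boxE /sigma_vec; set C := (X in <<s X >>).
apply: (@fin_bigcap_measurable _ (g_sigma_algebraType C)).
  exact: finite_finset.
by move=> i _; apply: sub_sigma_algebra; exists i => //; exists (B i); rewrite ?setTI.
Qed.

Let box_measurable B : (forall i, measurable (B i)) -> measurable (box B).
Proof.
move=> mB; rewrite boxE; apply: fin_bigcap_measurable; first exact: finite_finset.
by move=> i _; rewrite -[X in measurable X]setTI; exact: mz.
Qed.

(** The pi-system of events of H intersected with a box in the first j
    coordinates of Z; it generates the information available when the coordinate
    of index j is integrated out. *)
Let cyl (j : nat) : set (set T) := [set E | exists A B,
  [/\ H A, forall i, measurable (B i), forall i : 'I_d, (j <= i)%N -> B i = setT &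
      E = A `&` box B]].

Let H_T : H setT.
Proof. by case: sH => H0 HC _; rewrite -(setD0 setT); exact: HC. Qed.

Let boxT : box (fun=> setT) = setT.
Proof. by apply/seteqP; split. Qed.

Let cylH j : H `<=` cyl j.
Proof. by move=> A HA; exists A, (fun=> setT); split => //; rewrite boxT setIT. Qed.

Let cylI j : setI_closed (cyl j).
Proof.
move=> _ _ [A [B [HA mB Bj ->]]] [A' [B' [HA' mB' B'j ->]]].
exists (A `&` A'), (fun i => B i `&` B' i); split => //.
- have := @measurableI _ (g_sigma_algebraType H) A A'.
  by rewrite /measurable/= sigma_algebra_id//; exact.
- by move=> i; exact: measurableI.
- by move=> i ji; rewrite Bj// B'j// setIT.
- apply/seteqP; split => w /=.
    by move=> [[Aw Bw] [A'w B'w]]; split => // i.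
  by move=> [[Aw A'w] Bw]; split; split => // i; have [] := Bw i.
Qed.

Let cyl_meas j : cyl j `<=` measurable.
Proof.
by move=> _ [A [B [HA mB _ ->]]]; apply: measurableI; [exact: Hm|exact: box_measurable].
Qed.

Let PB i B : measurable B -> P (z i @^-1` B) = N01 B.
Proof.
move=> mB; pose B' i' := if i' == i then B else setT.
have mB' i' : measurable (B' i') by rewrite /B'; case: ifP.
have -> : z i @^-1` B = box B'.
  apply/seteqP; split => w /=; first by move=> Bw j; rewrite /B'; case: eqP => // ->.
  by move=> /(_ i); rewrite /B' eqxx.
have [_ ->//] := Z_gauss.
rewrite (bigD1 i)//= /B' eqxx big1 ?mule1// => j /negbTE ->.
exact: probability_setT.
Qed.

Let next_indep (j : 'I_d) A B : <<s cyl j >> A -> measurable B ->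
  P (A `&` z j @^-1` B) = (P A * N01 B)%E.
Proof.
move=> cA mB; rewrite -(PB j mB).
apply: (indep_generated (@cylI j) (@cyl_meas j)) cA.
- exact/cylH/H_T.
- by rewrite -[X in measurable X]setTI; exact: mz.
move=> _ [A0 [C [HA0 mC Cj ->]]]; rewrite PB//.
pose C' i := if i == j then B else C i.
have mC' i : measurable (C' i) by rewrite /C'; case: ifP.
have -> : A0 `&` box C `&` z j @^-1` B = A0 `&` box C'.
  apply/seteqP; split => w /=.
    by move=> [[A0w Cw] Bw]; split => // i; rewrite /C'; case: eqP => // ->.
  move=> [A0w C'w]; split; last by have := C'w j; rewrite /C' eqxx.
  split => // i; have := C'w i; rewrite /C'; case: eqP => // -> _.
  by rewrite Cj.
rewrite !Z_indep//; [|exact: box_sigma..].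
have [_ Zb] := Z_gauss; rewrite !Zb// -muleA; congr (_ * _)%E.
rewrite (bigD1 j)//= [in RHS](bigD1 j)//= Cj// [X in (X * _ * _)%E](_ : _ = 1%E); last first.
  exact: probability_setT.
rewrite mul1e muleC /C' eqxx; congr (_ * _)%E.
by apply: eq_bigr => i /negbTE ->.
Qed.

Let sHj j : sigma_algebra setT <<s cyl j >>.
Proof. exact: smallest_sigma_algebra. Qed.

Let Hjm j : <<s cyl j >> `<=` measurable.
Proof. exact/sub_measurable/cyl_meas. Qed.

Let wrtH j (f : T -> R) : measurable_wrt H f -> measurable_wrt <<s cyl j >> f.
Proof.
by apply: measurable_wrtS => A HA; apply: sub_sigma_algebra; exact: cylH.
Qed.

Let wrtz (j : nat) (i : 'I_d) : (i < j)%N -> measurable_wrt <<s cyl j >> (z i).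
Proof.
move=> ij _ B mB; rewrite setTI; do 2 apply: sub_sigma_algebra.
exists setT, (fun i' => if i' == i then B else setT); split => //.
- by move=> i'; case: ifP.
- by move=> i' ji'; case: eqP => // ii'; move: ij; rewrite ltnNge -ii' ji'.
- rewrite setTI; apply/seteqP; split => w /=.
    by move=> Bw i'; case: eqP => // ->.
  by move=> /(_ i); rewrite eqxx.
Qed.

(** Induction on the number j of coordinates still present: freezing the last of
    them turns it into the damping factor e^{- b_j^2 / 2}. *)
Lemma gaussian_mixture (b : 'I_d -> T -> R) (c : T -> R) :
  (forall i, measurable_wrt H (b i)) -> measurable_wrt H c ->
  Ex P (fun w => cos (c w + \sum_i b i w * Z w i 0)) =
  Ex P (fun w => cos (c w) * expR (- ((\sum_i b i w ^+ 2) / 2))).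
Proof.
move=> mb mc.
pose eta (j : nat) w := expR (- ((\sum_(i < d | (j <= i)%N) b i w ^+ 2) / 2)).
pose ph (j : nat) w := c w + \sum_(i < d | (i < j)%N) b i w * z i w.
suff key j : (j <= d)%N ->
    Ex P (fun w => eta j w * cos (ph j w)) = Ex P (fun w => eta 0%N w * cos (ph 0%N w)).
  have := key d (leqnn d).
  have -> : (fun w => eta d w * cos (ph d w)) = fun w => cos (c w + \sum_i b i w * Z w i 0).
    apply/funext => w; rewrite /eta big_pred0 ?mul0r ?oppr0 ?expR0 ?mul1r; last first.
      by move=> i; rewrite leqNgt ltn_ord.
    by congr (cos (_ + _)); apply: eq_bigl => i; rewrite ltn_ord.
  move=> ->; apply: eq_Ex => w; rewrite mulrC /eta /ph [X in _ + X]big_pred0 ?addr0//.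
elim: j => [//|j IH] jd; rewrite -IH; last exact: ltnW.
pose j' := Ordinal jd.
have etaE w : eta j w = eta j.+1 w * expR (- (b j' w ^+ 2 / 2)).
  rewrite -expRD; congr expR; rewrite (bigD1 j')//= mulrDl opprD addrC.
  congr (- (_ / _) + _); apply: eq_bigl => i.
  by rewrite ltn_neqAle andbC eq_sym.
have phE w : ph j.+1 w = ph j w + b j' w * z j' w.
  rewrite /ph -addrA; congr (_ + _); rewrite (bigD1 j')//= addrC; congr (_ + _).
  by apply: eq_bigl => i; rewrite ltnS ltn_neqAle andbC.
under eq_Ex do rewrite phE.
rewrite (@freeze_cos _ _ _ P <<s cyl j >> (z j') _ _ (mz j') _ 1 (eta j.+1)).
- by apply: eq_Ex => w; rewrite etaE; ring.
- exact: sHj.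
- exact: Hjm.
- by move=> A B HA mB; apply: (@next_indep j').
- apply: measurableT_comp => //; apply: measurableT_comp => //; apply: measurable_funM => //.
  under eq_fun do rewrite big_mkcond/=.
  apply: measurable_sum => i; case: (j < i)%N => //.
  by apply: measurable_funX; exact: wrtH.
- exact: wrtH.
- apply: measurable_funD; first exact: wrtH.
  under eq_fun do rewrite big_mkcond/=.
  apply: measurable_sum => i; have [ij|_] := ltnP i j => //.
  by apply: measurable_funM; [exact: wrtH|exact: wrtz].
- move=> w; rewrite ger0_norm ?expR_ge0// -[leRHS]expR0 ler_expR oppr_le0.
  by rewrite divr_ge0// sumr_ge0// => i _; exact: sqr_ge0.
Qed.

End gaussian_mixture.

(** * The positive semidefinite square root *)

Section psd_square_root.
Context {R : realType} {d : nat}.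
Implicit Types (A B M S Q : 'M[R]_d) (u v w : 'cV[R]_d).

Definition qf Q v w : R := (v^T *m Q *m w) 0 0.

Definition nsq v : R := \sum_i v i 0 ^+ 2.

Lemma nsqE v : nsq v = (v^T *m v) 0 0.
Proof. by rewrite mxE; apply: eq_bigr => i _; rewrite mxE expr2. Qed.

Lemma qf1 v w : qf 1%:M v w = (v^T *m w) 0 0.
Proof. by rewrite /qf mulmx1. Qed.

Lemma qf1_nsq v : qf 1%:M v v = nsq v.
Proof. by rewrite qf1 nsqE. Qed.

Lemma nsq_ge0 v : 0 <= nsq v.
Proof. by apply: sumr_ge0 => i _; exact: sqr_ge0. Qed.

Lemma nsq_eq0 v : nsq v = 0 -> v = 0.
Proof.
move=> v0; apply/matrixP => i j; rewrite ord1 mxE; apply/eqP; rewrite -sqrf_eq0.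
by have /psumr_eq0P := v0; move=> -> // k _; exact: sqr_ge0.
Qed.

Lemma qfC Q v w : Q^T = Q -> qf Q v w = qf Q w v.
Proof.
move=> QT; rewrite /qf.
have -> : (v^T *m Q *m w) 0 0 = ((v^T *m Q *m w)^T) 0 0 by rewrite [RHS]mxE.
by rewrite !trmx_mul trmxK QT mulmxA.
Qed.

Lemma qfDl Q u v w : qf Q (u + v) w = qf Q u w + qf Q v w.
Proof. by rewrite /qf linearD/= !mulmxDl mxE. Qed.

Lemma qfDr Q u v w : qf Q w (u + v) = qf Q w u + qf Q w v.
Proof. by rewrite /qf mulmxDr mxE. Qed.

Lemma qfZl Q a v w : qf Q (a *: v) w = a * qf Q v w.
Proof. by rewrite /qf linearZ/= -!scalemxAl mxE. Qed.

Lemma qfZr Q a v w : qf Q w (a *: v) = a * qf Q w v.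
Proof. by rewrite /qf -scalemxAr mxE. Qed.

Lemma psd_cauchy_schwarz Q v w : psd Q -> qf Q v w ^+ 2 <= qf Q v v * qf Q w w.
Proof.
move=> [QT Q0].
have P t : 0 <= qf Q v v + 2 * t * qf Q v w + t ^+ 2 * qf Q w w.
  have := Q0 (v + t *: w); rewrite -/(qf Q _ _) qfDl !qfDr !qfZl !qfZr (qfC w v QT).
  by congr (0 <= _); ring.
have a0 : 0 <= qf Q w w by exact: Q0.
set a := qf Q w w in P a0 *; set b := qf Q v w in P *; set c := qf Q v v in P *.
have [a00|an0] := eqVneq a 0.
  rewrite a00 mulr0; have [->|b0] := eqVneq b 0; first by rewrite expr0n.
  have := P (- (c + 1) / (2 * b)); rewrite a00 mulr0 addr0.
  rewrite (_ : c + _ = - 1); first by rewrite oppr_ge0 ler10.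
  by field.
have ap : 0 < a by rewrite lt_neqAle eq_sym an0.
have := P (- b / a).
rewrite (_ : c + _ + _ = (c * a - b ^+ 2) / a); last by field.
by rewrite pmulr_lge0 ?invr_gt0// subr_ge0.
Qed.

Lemma psd1 : psd (1%:M : 'M[R]_d).
Proof. by split; [rewrite trmx1|move=> v; rewrite -/(qf _ _ _) qf1_nsq nsq_ge0]. Qed.

Definition opnorm_le M (m : R) := 0 <= m /\ forall v, nsq (M *m v) <= m ^+ 2 * nsq v.

Lemma dot_le v w a b c : 0 <= a -> 0 <= b -> 0 <= c ->
  nsq v <= a ^+ 2 * c -> nsq w <= b ^+ 2 * c -> `|(v^T *m w) 0 0| <= a * b * c.
Proof.
move=> a0 b0 c0 va wb; have := psd_cauchy_schwarz v w psd1.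
rewrite !qf1_nsq qf1 => h.
have abc0 : 0 <= a * b * c by rewrite !mulr_ge0.
rewrite -(@ler_pXn2r _ 2) ?nnegrE// real_normK ?num_real//.
apply: (le_trans h); apply: (@le_trans _ _ ((a ^+ 2 * c) * (b ^+ 2 * c))).
  by apply: ler_pM => //; exact: nsq_ge0.
by rewrite (_ : _ * _ = (a * b * c) ^+ 2)//; ring.
Qed.

Lemma nsqD v w : nsq (v + w) = nsq v + 2 * (v^T *m w) 0 0 + nsq w.
Proof.
rewrite -!qf1_nsq qfDl !qfDr (qfC w v) ?trmx1// -qf1; ring.
Qed.

Lemma nsqZ a v : nsq (a *: v) = a ^+ 2 * nsq v.
Proof. by rewrite -!qf1_nsq qfZl qfZr; ring. Qed.

(** M is a polynomial in B without constant term, with nonnegative coefficients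
    whose sum m is recorded.  If B has operator norm at most 1 then M has operator
    norm at most m, so matrix estimates reduce to the scalar case B = 1. *)
Inductive nnpoly B : 'M[R]_d -> R -> Prop :=
| nnpoly0 : nnpoly B 0 0
| nnpoly_base : nnpoly B B 1
| nnpolyD M m M' m' : nnpoly B M m -> nnpoly B M' m' -> nnpoly B (M + M') (m + m')
| nnpolyZ (a : R) M m : 0 <= a -> nnpoly B M m -> nnpoly B (a *: M) (a * m)
| nnpolyM M m M' m' : nnpoly B M m -> nnpoly B M' m' -> nnpoly B (M *m M') (m * m').

Lemma nnpoly_comm B M m S : S *m B = B *m S -> nnpoly B M m -> S *m M = M *m S.
Proof.
move=> SB; elim=> {M m}.
- by rewrite mulmx0 mul0mx.
- exact: SB.
- by move=> M m M' m' _ h _ h'; rewrite mulmxDr mulmxDl h h'.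
- by move=> a M m _ _ h; rewrite -scalemxAr -scalemxAl h.
- by move=> M m M' m' _ h _ h'; rewrite mulmxA h -mulmxA h' mulmxA.
Qed.

Lemma nnpoly_sym B M m : B^T = B -> nnpoly B M m -> M^T = M.
Proof.
move=> BT; elim=> {M m}.
- exact: trmx0.
- exact: BT.
- by move=> M m M' m' _ h _ h'; rewrite linearD/= h h'.
- by move=> a M m _ _ h; rewrite linearZ/= h.
- move=> M m M' m' nM h nM' h'; rewrite trmx_mul h h'.
  by apply: (nnpoly_comm _ nM); apply/esym/(nnpoly_comm (erefl _) nM').
Qed.

Lemma nnpoly_opnorm B M m : opnorm_le B 1 -> nnpoly B M m -> opnorm_le M m.
Proof.
move=> B1; elim=> {M m}.
- by split => // v; rewrite mul0mx expr0n/= mul0r -qf1_nsq /qf mulmx0 mxE.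
- exact: B1.
- move=> M m M' m' _ [m0 Mm] _ [m'0 M'm']; split; first exact: addr_ge0.
  move=> v; rewrite mulmxDl nsqD.
  have := dot_le m0 m'0 (nsq_ge0 v) (Mm v) (M'm' v).
  have := ler_norm (((M *m v)^T *m (M' *m v)) 0 0).
  have := Mm v; have := M'm' v.
  rewrite (_ : (m + m') ^+ 2 * nsq v =
    m ^+ 2 * nsq v + 2 * (m * m' * nsq v) + m' ^+ 2 * nsq v); [lra|ring].
- move=> a M m a0 _ [m0 Mm]; split; first exact: mulr_ge0.
  move=> v; rewrite -scalemxAl nsqZ.
  rewrite [leRHS](_ : _ = a ^+ 2 * (m ^+ 2 * nsq v)); last by ring.
  by rewrite ler_wpM2l ?sqr_ge0.
- move=> M m M' m' _ [m0 Mm] _ [m'0 M'm']; split; first exact: mulr_ge0.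
  move=> v; rewrite -mulmxA (le_trans (Mm _))//.
  rewrite [leRHS](_ : _ = m ^+ 2 * (m' ^+ 2 * nsq v)); last by ring.
  by rewrite ler_wpM2l ?sqr_ge0.
Qed.

Lemma opnorm_entry M m i j : opnorm_le M m -> `|M i j| <= m.
Proof.
move=> [m0 Mm]; have := Mm (delta_mx j 0).
have -> : nsq (delta_mx j 0) = 1.
  rewrite /nsq (bigD1 j)//= mxE !eqxx expr1n big1 ?addr0// => k /negbTE kj.
  by rewrite mxE kj expr0n.
rewrite mulr1 => h; rewrite -(@ler_pXn2r _ 2) ?nnegrE// real_normK ?num_real//.
apply: le_trans h; rewrite /nsq -colE (bigD1 i)//= mxE lerDl.
by apply: sumr_ge0 => k _; exact: sqr_ge0.
Qed.

(** Visser's iteration.  A fixed point L of X |-> (B + X^2) / 2 satisfies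
    (1 - L)^2 = 1 - B, so that for B = 1 - A / c the matrix sqrt(c) (1 - L) is a
    square root of A. *)
Fixpoint visser B (k : nat) : 'M[R]_d :=
  if k is k'.+1 then 2^-1 *: (B + visser B k' *m visser B k') else 0.

(** The same iteration at B = 1, which dominates the matrix one. *)
Fixpoint visser1 (k : nat) : R :=
  if k is k'.+1 then 2^-1 * (1 + visser1 k' * visser1 k') else 0.

Lemma visser_nnpoly B k : nnpoly B (visser B k) (visser1 k).
Proof.
elim: k => [|k IH] /=; first exact: nnpoly0.
apply: nnpolyZ => //; apply: nnpolyD; first exact: nnpoly_base.
exact: nnpolyM.
Qed.

(** The increments again have nonnegative coefficients, since X_{k+2} - X_{k+1} =
    (X_{k+1} - X_k) (X_{k+1} + X_k) / 2; they are therefore dominated by those of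
    the scalar iteration. *)
Lemma visser_step_nnpoly B k :
  nnpoly B (visser B k.+1 - visser B k) (visser1 k.+1 - visser1 k).
Proof.
elim: k => [|k IH].
  by rewrite !subr0; exact: visser_nnpoly.
have -> : visser B k.+2 - visser B k.+1 =
    2^-1 *: ((visser B k.+1 - visser B k) *m (visser B k.+1 + visser B k)).
  have C : visser B k *m visser B k.+1 = visser B k.+1 *m visser B k.
    apply: (nnpoly_comm _ (visser_nnpoly B k.+1)).
    by apply/esym/(nnpoly_comm (erefl _) (visser_nnpoly B k)).
  rewrite [visser B k.+2]/= [X in _ - X = _]/= -scalerBr; congr (_ *: _).
  rewrite mulmxBl !mulmxDr -C -/(visser B k.+1).
  have E (p q r : 'M[R]_d) : (p + q) - (p + r) = q - r.
    by rewrite opprD addrACA subrr add0r.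
  by rewrite E [X in _ = X - _]addrC E.
have -> : visser1 k.+2 - visser1 k.+1 =
    2^-1 * ((visser1 k.+1 - visser1 k) * (visser1 k.+1 + visser1 k)).
  transitivity (2^-1 * (1 + visser1 k.+1 * visser1 k.+1) -
                2^-1 * (1 + visser1 k * visser1 k)) => //.
  by move: (visser1 k.+1) => y; ring.
by apply: nnpolyZ => //; apply: nnpolyM => //; apply: nnpolyD; exact: visser_nnpoly.
Qed.

Lemma visser1_le1 k : 0 <= visser1 k <= 1.
Proof.
elim: k => [|k /andP[x0 x1]] /=; first by rewrite lexx ler01.
by apply/andP; split; nra.
Qed.

Lemma visser1_step k : 0 <= visser1 k.+1 - visser1 k.
Proof.
rewrite (_ : _ - _ = 2^-1 * (1 - visser1 k) ^+ 2); first by rewrite mulr_ge0// sqr_ge0.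
transitivity (2^-1 * (1 + visser1 k * visser1 k) - visser1 k) => //.
by field.
Qed.

Lemma is_cvg_visser1 : cvgn visser1.
Proof.
apply: nondecreasing_is_cvgn.
  by apply/nondecreasing_seqP => k; rewrite -subr_ge0; exact: visser1_step.
by exists 1 => _ [k _ <-]; have /andP[] := visser1_le1 k.
Qed.

Lemma cvg_sum_fin (I : Type) (r : seq I) (f : I -> nat -> R) (l : I -> R) :
  (forall i, f i k @[k --> \oo] --> l i) ->
  \sum_(i <- r) f i k @[k --> \oo] --> \sum_(i <- r) l i.
Proof.
move=> fl; elim: r => [|i r IH].
  by rewrite big_nil; under eq_fun do rewrite big_nil; exact: cvg_cst.
by rewrite big_cons; under eq_fun do rewrite big_cons; exact: cvgD.
Qed.

Lemma cvg_mul_mx m n p (M_ : nat -> 'M[R]_(m, n)) (N_ : nat -> 'M[R]_(n, p))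
    (M' : 'M[R]_(m, n)) (N' : 'M[R]_(n, p)) i j :
  (forall i j, M_ k i j @[k --> \oo] --> M' i j) ->
  (forall i j, N_ k i j @[k --> \oo] --> N' i j) ->
  (M_ k *m N_ k) i j @[k --> \oo] --> (M' *m N') i j.
Proof.
move=> cM cN; rewrite mxE; under eq_fun do rewrite mxE.
by apply: cvg_sum_fin => l; apply: cvgM.
Qed.

Section limit.
Variable B : 'M[R]_d.
Hypotheses (BT : B^T = B) (B1 : opnorm_le B 1).

Let entry_step i j k : `|visser B k.+1 i j - visser B k i j| <= visser1 k.+1 - visser1 k.
Proof.
have := opnorm_entry i j (nnpoly_opnorm B1 (visser_step_nnpoly B k)).
by rewrite !mxE.
Qed.

(** Adding the dominating scalar iteration makes every entry nondecreasing. *)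
Lemma is_cvg_visser i j : cvgn (fun k => visser B k i j).
Proof.
have -> : (fun k => visser B k i j) =
    (fun k => visser B k i j + visser1 k) \- visser1.
  by apply/funext => k /=; rewrite addrK.
apply: is_cvgB; last exact: is_cvg_visser1.
apply: nondecreasing_is_cvgn.
  apply/nondecreasing_seqP => k; have := entry_step i j k.
  by rewrite ler_norml => /andP[+ _]; lra.
exists 2 => _ [k _ <-].
have := opnorm_entry i j (nnpoly_opnorm B1 (visser_nnpoly B k)).
have /andP[_ x1] := visser1_le1 k.
by move=> /(le_trans (ler_norm _)); lra.
Qed.

Definition visser_lim : 'M[R]_d := \matrix_(i, j) limn (fun k => visser B k i j).

Lemma cvg_visser i j : (fun k => visser B k i j) k @[k --> \oo] --> visser_lim i j.
Proof. by rewrite mxE; exact: is_cvg_visser. Qed.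

Lemma visser_limE : visser_lim = 2^-1 *: (B + visser_lim *m visser_lim).
Proof.
apply/matrixP => i j; have := @cvg_visser i j.
rewrite -(cvg_shiftS (fun k => visser B k i j)) => c.
apply: (cvg_unique _ c) => //=.
rewrite [X in _ --> X]mxE; under eq_fun do rewrite mxE.
apply: cvgM; first exact: cvg_cst.
rewrite [X in _ --> X]mxE; under eq_fun do rewrite mxE.
apply: cvgD; first exact: cvg_cst.
by apply: cvg_mul_mx; exact: cvg_visser.
Qed.

Lemma visser_lim_comm S : S *m B = B *m S -> S *m visser_lim = visser_lim *m S.
Proof.
move=> SB; apply/matrixP => i j.
have c1 : (S *m visser B k) i j @[k --> \oo] --> (S *m visser_lim) i j.
  by apply: cvg_mul_mx => *; [exact: cvg_cst|exact: cvg_visser].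
have c2 : (visser B k *m S) i j @[k --> \oo] --> (visser_lim *m S) i j.
  by apply: cvg_mul_mx => *; [exact: cvg_visser|exact: cvg_cst].
apply: (cvg_unique _ c1) => //; apply: cvg_trans c2; apply: near_eq_cvg.
by apply: nearW => k; rewrite (nnpoly_comm SB (visser_nnpoly B k)).
Qed.

Lemma visser_lim_psd : psd (1%:M - visser_lim).
Proof.
split.
  rewrite linearB/= trmx1; congr (_ - _); apply/matrixP => i j; rewrite !mxE.
  congr (limn _); apply/funext => k.
  by have /matrixP/(_ i j) := nnpoly_sym BT (visser_nnpoly B k); rewrite mxE.
move=> v; rewrite mulmxBr mulmxBl mxE [X in _ + X]mxE subr_ge0.
rewrite -/(qf 1%:M v v) qf1_nsq.
have c : (v^T *m visser B k *m v) 0 0 @[k --> \oo] --> (v^T *m visser_lim *m v) 0 0.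
  apply: (@cvg_mul_mx _ _ _ (fun k => v^T *m visser B k)) => i j; last exact: cvg_cst.
  by apply: cvg_mul_mx => *; [exact: cvg_cst|exact: cvg_visser].
rewrite -(cvg_lim _ c)//; apply: limr_le; first exact: (cvgP _ c).
apply: nearW => k; rewrite -mulmxA.
have [m0 Mm] := nnpoly_opnorm B1 (visser_nnpoly B k).
have /andP[x0 x1] := visser1_le1 k.
rewrite (le_trans (ler_norm _))//.
have := @dot_le v (visser B k *m v) 1 1 (nsq v) ler01 ler01 (nsq_ge0 v).
rewrite !mul1r !expr1n !mul1r; apply => //.
by rewrite (le_trans (Mm v))// ler_piMl ?nsq_ge0// expr_le1.
Qed.

End limit.

(** Any bound of the quadratic form of A by a multiple of the identity would do;
    this one is positive and visibly measurable in A. *)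
Definition psd_scale A : R := 1 + \sum_i \sum_j `|A i j|.

Lemma psd_scale_gt0 A : 0 < psd_scale A.
Proof. by rewrite ltr_pwDl// sumr_ge0// => i _; exact: sumr_ge0. Qed.

Lemma qf_le_scale A v : qf A v v <= psd_scale A * nsq v.
Proof.
rewrite /qf mxE /psd_scale mulrDl mul1r.
apply: (@le_trans _ _ ((\sum_i \sum_j `|A i j|) * nsq v)); last first.
  by rewrite lerDr nsq_ge0.
rewrite exchange_big/= mulr_suml; apply: ler_sum => j _.
rewrite mxE mulr_suml mulr_suml; apply: ler_sum => i _.
rewrite mxE (le_trans (ler_norm _))// !normrM mulrAC mulrC ler_wpM2l//.
have vi k : v k 0 ^+ 2 <= nsq v.
  by rewrite /nsq (bigD1 k)//= lerDl sumr_ge0// => l _; exact: sqr_ge0.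
have := vi i; have := vi j; have := sqr_ge0 (`|v i 0| - `|v j 0|).
by rewrite sqrrB !real_normK ?num_real// -mulr_natl; lra.
Qed.

Definition contraction A : 'M[R]_d := 1%:M - (psd_scale A)^-1 *: A.

(** B = 1 - A / c satisfies 0 <= B <= 1; Cauchy-Schwarz for the form B applied to
    v and B v gives |B v|^4 <= B(v, v) B(B v, B v) <= |v|^2 |B v|^2. *)
Lemma contraction_opnorm A : psd A -> opnorm_le (contraction A) 1.
Proof.
move=> [AT A0]; have c0 := psd_scale_gt0 A; split => // v; rewrite expr1n mul1r.
set B := contraction A.
have qB u : qf B u u = nsq u - (psd_scale A)^-1 * qf A u u.
  rewrite /qf /B /contraction mulmxBr mulmxBl mxE -qf1_nsq /qf; congr (_ + _).
  by rewrite mxE -scalemxAr -scalemxAl mxE.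
have BT : B^T = B by rewrite /B /contraction linearB/= trmx1 linearZ/= AT.
have psdB : psd B.
  split => // u; rewrite -/(qf B u u) qB subr_ge0 ler_pdivrMl//.
  exact: qf_le_scale.
have qB1 u : qf B u u <= nsq u.
  by rewrite qB gerBl mulr_ge0 ?invr_ge0 ?(ltW c0)//; exact: A0.
have := psd_cauchy_schwarz v (B *m v) psdB.
have -> : qf B v (B *m v) = nsq (B *m v).
  by rewrite nsqE trmx_mul BT /qf.
set n := nsq (B *m v) => h.
have n0 : 0 <= n by exact: nsq_ge0.
have [->|n1] := eqVneq n 0; first exact: nsq_ge0.
have np : 0 < n by rewrite lt_neqAle eq_sym n1.
rewrite -(ler_pM2r np) -expr2 (le_trans h)// ler_pM//; first exact: psdB.2.
exact: psdB.2.
Qed.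

Definition visser_sqrt A : 'M[R]_d :=
  Num.sqrt (psd_scale A) *: (1%:M - visser_lim (contraction A)).

Lemma contraction_sym A : psd A -> (contraction A)^T = contraction A.
Proof. by move=> [AT _]; rewrite /contraction linearB/= trmx1 linearZ/= AT. Qed.

Lemma visser_sqrt_psd A : psd A -> psd (visser_sqrt A).
Proof.
move=> pA; have [ST S0] := visser_lim_psd (contraction_sym pA) (contraction_opnorm pA).
split; first by rewrite linearZ/= ST.
by move=> v; rewrite -scalemxAr -scalemxAl mxE mulr_ge0// sqrtr_ge0.
Qed.

Lemma visser_sqrtK A : psd A -> visser_sqrt A *m visser_sqrt A = A.
Proof.
move=> pA; have c0 := psd_scale_gt0 A.
rewrite -scalemxAl -scalemxAr scalerA -expr2 sqr_sqrtr ?ltW//.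
have := visser_limE (contraction_opnorm pA); set L := visser_lim _ => LE.
have L2 : L *m L = 2 *: L - contraction A.
  by rewrite {3}LE scalerA divff// scale1r addrC addKr.
rewrite mulmxBr !mulmxBl !mulmx1 mul1mx L2 scaler_nat mulr2n /contraction.
apply/matrixP => i j; rewrite !mxE.
by field; rewrite gt_eqF.
Qed.

Lemma visser_sqrt_comm A S : psd A -> S *m A = A *m S ->
  S *m visser_sqrt A = visser_sqrt A *m S.
Proof.
move=> pA SA; rewrite -scalemxAr -scalemxAl mulmxBr mulmxBl mulmx1 mul1mx.
rewrite visser_lim_comm//; first exact: contraction_opnorm.
by rewrite /contraction mulmxBr mulmxBl mulmx1 mul1mx -scalemxAr -scalemxAl SA.
Qed.

Lemma psd_mul0 S v : psd S -> qf S v v = 0 -> S *m v = 0.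
Proof.
move=> pS v0; apply: nsq_eq0; apply/eqP; rewrite eq_le nsq_ge0 andbT.
have := psd_cauchy_schwarz v (S *m v) pS; rewrite v0 mul0r.
have -> : qf S v (S *m v) = nsq (S *m v) by rewrite nsqE trmx_mul pS.1.
have n0 := nsq_ge0 (S *m v); move=> h.
by rewrite -(@ler_pXn2r _ 2) ?nnegrE// expr0n.
Qed.

(** The iterative root V is a limit of polynomials in A, hence commutes with S.
    Then (S + V) (S - V) = 0, so for u = (S - V) v both S(u, u) and V(u, u)
    vanish, whence S u = V u = 0, and |u|^2 = v . (S - V) u = 0. *)
Lemma psd_sqrt_uniq A S : psd A -> psd S -> S *m S = A -> S = visser_sqrt A.
Proof.
move=> pA pS SA; set V := visser_sqrt A.
have pV : psd V by exact: visser_sqrt_psd.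
have VV : V *m V = A by exact: visser_sqrtK.
have SV : S *m V = V *m S by apply: visser_sqrt_comm => //; rewrite -SA mulmxA.
have E0 : (S + V) *m (S - V) = 0.
  by rewrite mulmxDl !mulmxBr SV SA VV addrA subrK subrr.
apply/eqP; rewrite -subr_eq0; apply/eqP; apply/matrixP => i j.
have DT : (S - V)^T = S - V by rewrite linearB/= pS.1 pV.1.
suff D0 v : (S - V) *m v = 0.
  have := D0 (delta_mx j 0); rewrite -colE => /matrixP/(_ i 0).
  by rewrite !mxE.
set u := (S - V) *m v.
have SVu : qf S u u + qf V u u = 0.
  have -> : qf S u u + qf V u u = (u^T *m ((S + V) *m u)) 0 0.
    by rewrite /qf mulmxDl mulmxDr [in RHS]mxE !mulmxA.
  by rewrite /u [(S + V) *m _]mulmxA E0 mul0mx mulmx0 mxE.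
have Su0 : qf S u u = 0.
  have := pS.2 u; have := pV.2 u; rewrite -!/(qf _ _ _); lra.
have Vu0 : qf V u u = 0.
  have := pS.2 u; have := pV.2 u; rewrite -!/(qf _ _ _); lra.
apply: nsq_eq0; rewrite nsqE {1}/u trmx_mul DT -mulmxA mulmxBl.
by rewrite !psd_mul0// subr0 mulmx0 mxE.
Qed.

Lemma psd_sqrtE A : psd A -> psd_sqrt A = visser_sqrt A.
Proof.
move=> pA; apply: xget_unique.
  by split; [exact: visser_sqrt_psd|exact: visser_sqrtK].
by move=> S [pS SA]; exact: psd_sqrt_uniq.
Qed.

Lemma psd_sqrtP A : psd A -> psd (psd_sqrt A) /\ psd_sqrt A *m psd_sqrt A = A.
Proof.
by move=> pA; rewrite psd_sqrtE//; split; [exact: visser_sqrt_psd|exact: visser_sqrtK].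
Qed.

End psd_square_root.

Lemma measurable_sqrt_comp {disp : measure_display} {T : measurableType disp}
    {R : realType} (f : T -> R) : (forall w, 0 <= f w) -> measurable_fun setT f ->
  measurable_fun setT (fun w => Num.sqrt (f w)).
Proof.
move=> f0 mf; rewrite (_ : (fun w => _) = fun w => (f w) `^ (2^-1)).
  have h := measurableT_comp (measurable_powR 2^-1) mf.
  exact: h.
by apply/funext => w; rewrite powR12_sqrt.
Qed.

Section psd_sqrt_measurable.
Context {disp : measure_display} {T : measurableType disp} {R : realType}.
Variables (d : nat) (F : set (set T)) (A : T -> 'M[R]_d).
Hypotheses (mA : measurable_mx F A) (pA : forall w, psd (A w)).

Let mscale : measurable_wrt F (fun w => psd_scale (A w)).
Proof.
apply: measurable_funD => //; apply: measurable_sum => i; apply: measurable_sum => j.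
by apply: measurableT_comp => //; exact: mA.
Qed.

Let minv (f : T -> R) : (forall w, 0 < f w) -> measurable_wrt F f ->
  measurable_wrt F (fun w => (f w)^-1).
Proof.
move=> f0 mf; rewrite (_ : (fun w => _) = fun w => (f w) `^ (-1)).
  exact: (measurableT_comp (measurable_powR (-1)) mf).
by apply/funext => w; rewrite powR_inv1// ltW.
Qed.

Let mcontr : measurable_mx F (fun w => contraction (A w)).
Proof.
move=> i j; rewrite (_ : (fun w => _) =
  fun w => (1%:M : 'M[R]_d) i j - (psd_scale (A w))^-1 * A w i j); last first.
  by apply/funext => w; rewrite !mxE.
apply: measurable_funB => //; apply: measurable_funM => //.
  by apply: minv => // w; exact: psd_scale_gt0.
exact: mA.
Qed.

Let mvisser k : measurable_mx F (fun w => visser (contraction (A w)) k).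
Proof.
elim: k => [|k IH] i j /=.
  exact: measurable_cst.
rewrite (_ : (fun w => _) = fun w => 2^-1 * (contraction (A w) i j +
  \sum_l visser (contraction (A w)) k i l * visser (contraction (A w)) k l j)).
  apply: measurable_funM => //; apply: measurable_funD; first exact: mcontr.
  by apply: measurable_sum => l; apply: measurable_funM; exact: IH.
by apply/funext => w; rewrite !mxE.
Qed.

(** The root is a pointwise limit of polynomials in the entries of A, up to the
    scaling factor. *)
Lemma psd_sqrt_measurable : measurable_mx F (fun w => psd_sqrt (A w)).
Proof.
move=> i j; rewrite (_ : (fun w => _) = fun w => Num.sqrt (psd_scale (A w)) *
   ((1%:M : 'M[R]_d) i j - visser_lim (contraction (A w)) i j)); last first.
  by apply/funext => w; rewrite psd_sqrtE// !mxE.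
apply: measurable_funM.
  by apply: measurable_sqrt_comp => // w; exact/ltW/psd_scale_gt0.
apply: measurable_funB => //.
apply: (@measurable_fun_cvg _ (g_sigma_algebraType F) _ _ (fun k w => visser (contraction (A w)) k i j)).
  by move=> k; exact: mvisser.
by move=> w _; apply: cvg_visser; exact: contraction_opnorm.
Qed.

End psd_sqrt_measurable.

(** * Approximation by trigonometric polynomials and the continuity theorem *)

Section trigonometric_polynomials.
Context {R : realType} {D : nat}.
Implicit Types (f g : 'rV[R]_D -> R) (x t : 'rV[R]_D).

Definition dotr t x : R := \sum_i t 0 i * x 0 i.

(** The phase th makes products and sine terms expressible by cosines alone. *)
Inductive trigpoly : ('rV[R]_D -> R) -> Prop :=
| trigpoly_cos a t th : trigpoly (fun x => a * cos (dotr t x + th))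
| trigpolyD f g : trigpoly f -> trigpoly g -> trigpoly (fun x => f x + g x).

Lemma trigpolyM f g : trigpoly f -> trigpoly g -> trigpoly (fun x => f x * g x).
Proof.
move=> pf; elim: pf g => {f} [a t th g|f f' _ IH _ IH' g pg]; last first.
  rewrite (_ : (fun x => _) = fun x => f x * g x + f' x * g x).
    by apply: trigpolyD; [exact: IH|exact: IH'].
  by apply/funext => x; rewrite mulrDl.
elim=> {g} [b u ph|f f' _ IH _ IH']; last first.
  rewrite (_ : (fun x => _) = fun x => a * cos (dotr t x + th) * f x + a * cos (dotr t x + th) * f' x).
    exact: trigpolyD.
  by apply/funext => x; rewrite mulrDr.
rewrite (_ : (fun x => _) = fun x =>
    (a * b / 2) * cos (dotr (t + u) x + (th + ph)) +
    (a * b / 2) * cos (dotr (t - u) x + (th - ph))).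
  by apply: trigpolyD; exact: trigpoly_cos.
apply/funext => x.
have -> : dotr (t + u) x + (th + ph) = (dotr t x + th) + (dotr u x + ph).
  rewrite (_ : dotr (t + u) x = dotr t x + dotr u x); first by ring.
  by rewrite /dotr -big_split/=; apply: eq_bigr => i _; rewrite mxE mulrDl.
have -> : dotr (t - u) x + (th - ph) = (dotr t x + th) - (dotr u x + ph).
  rewrite (_ : dotr (t - u) x = dotr t x - dotr u x); first by ring.
  by rewrite /dotr -sumrB; apply: eq_bigr => i _; rewrite !mxE mulrBl.
by move: (dotr t x + th) (dotr u x + ph) => p q; rewrite (cosD p q) (cosB p q); field.
Qed.

Lemma trigpoly_cst c : trigpoly (fun=> c).
Proof.
rewrite (_ : (fun=> c) = fun x => c * cos (dotr 0 x + 0)); first exact: trigpoly_cos.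
apply/funext => x; rewrite /dotr big1 ?addr0 ?cos0 ?mulr1// => i _.
by rewrite mxE mul0r.
Qed.

Lemma trigpoly_sum (I : Type) (r : seq I) (h : I -> 'rV[R]_D -> R) :
  (forall i, trigpoly (h i)) -> trigpoly (fun x => \sum_(i <- r) h i x).
Proof.
move=> ph; elim: r => [|i r IH].
  by under eq_fun do rewrite big_nil; exact: trigpoly_cst.
by under eq_fun do rewrite big_cons; exact: trigpolyD.
Qed.

Lemma trigpoly_prod (I : Type) (r : seq I) (h : I -> 'rV[R]_D -> R) :
  (forall i, trigpoly (h i)) -> trigpoly (fun x => \prod_(i <- r) h i x).
Proof.
move=> ph; elim: r => [|i r IH].
  by under eq_fun do rewrite big_nil; exact: trigpoly_cst.
by under eq_fun do rewrite big_cons; exact: trigpolyM.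
Qed.

Lemma trigpoly_cos1 i a th : trigpoly (fun x => cos (a * x 0 i + th)).
Proof.
rewrite (_ : (fun x => _) = fun x => 1 * cos (dotr (a *: delta_mx 0 i) x + th)).
  exact: trigpoly_cos.
apply/funext => x; rewrite mul1r; congr (cos (_ + _)).
rewrite /dotr (bigD1 i)//= !mxE !eqxx mulr1 big1 ?addr0// => j ji.
by rewrite !mxE (negbTE ji) andbF mulr0 mul0r.
Qed.

Lemma trigpoly_sin1 i a th : trigpoly (fun x => sin (a * x 0 i + th)).
Proof.
rewrite (_ : (fun x => _) = fun x => cos (a * x 0 i + (th - pi / 2))).
  exact: trigpoly_cos1.
by apply/funext => x; rewrite addrA cosBpihalf.
Qed.

End trigonometric_polynomials.

Section fejer_kernel.
Context {R : realType}.
Variable m : nat.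
Hypothesis m_gt0 : (0 < m)%N.
Implicit Types (y : R) (k l : nat).

(** The Fejer kernel, normalised so that its translates by the m + 1 equidistant
    nodes of [- pi, pi[ sum to one. *)
Definition fejer y : R := (m * m.+1)%:R^-1 *
  ((\sum_(k < m) cos (k%:R * y)) ^+ 2 + (\sum_(k < m) sin (k%:R * y)) ^+ 2).

Definition node (j : nat) : R := - pi + j%:R * (2 * pi / m.+1%:R).

Lemma fejer_ge0 y : 0 <= fejer y.
Proof. by rewrite mulr_ge0 ?invr_ge0// addr_ge0// sqr_ge0. Qed.

Lemma fejerE y : fejer y = (m * m.+1)%:R^-1 *
  \sum_(k < m) \sum_(l < m) cos (k%:R * y - l%:R * y).
Proof.
congr (_ * _); rewrite !expr2 !big_distrlr/= -big_split/=.
apply: eq_bigr => k _; rewrite -big_split/=; apply: eq_bigr => l _.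
by rewrite cosB.
Qed.

(** Telescoping of sin under the product formula 2 sin h cos a =
    sin(a + h) - sin(a - h). *)
Let sum_cos_arith (h ph : R) (n : nat) :
  2 * sin h * (\sum_(j < n) cos (ph - 2 * h * j%:R)) =
  sin (ph + h) - sin (ph + h - 2 * h * n%:R).
Proof.
elim: n => [|n IH]; first by rewrite big_ord0 !mulr0 subr0 subrr.
rewrite big_ord_recr/= mulrDr IH.
have -> : ph + h - 2 * h * n%:R = (ph - 2 * h * n%:R) + h by ring.
have -> : ph + h - 2 * h * n.+1%:R = (ph - 2 * h * n%:R) - h.
  by rewrite -natr1; ring.
move: (ph - 2 * h * n%:R) => z; rewrite (sinD z h) (sinB z h); ring.
Qed.

(** Discrete orthogonality: the frequency k - l is smaller than the number of
    nodes, so the sum over the nodes runs over full periods unless k = l. *)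
Lemma sum_cos_node y k l : (k <= m)%N -> (l <= m)%N ->
  \sum_(j < m.+1) cos (k%:R * (y - node j) - l%:R * (y - node j)) =
  (k == l)%:R * m.+1%:R.
Proof.
have M0 : m.+1%:R != 0 :> R by rewrite pnatr_eq0.
have E a b : (a < b <= m)%N ->
    \sum_(j < m.+1) cos (b%:R * (y - node j) - a%:R * (y - node j)) = 0.
  move=> /andP[ab bm]; pose c := (b - a)%N.
  pose h : R := c%:R * pi / m.+1%:R.
  have h0 : 0 < h by rewrite divr_gt0// mulr_gt0 ?pi_gt0// ltr0n subn_gt0.
  have hpi : h < pi.
    rewrite ltr_pdivrMr// mulrC ltr_pM2l ?pi_gt0// ltr_nat ltnS.
    exact: leq_trans (leq_subr _ _) bm.
  have s0 : 2 * sin h != 0.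
    by rewrite mulf_neq0// gt_eqF// sin_gt0_pi// h0.
  apply: (mulfI s0); rewrite mulr0.
  have cE : c%:R = b%:R - a%:R :> R by rewrite natrB// ltnW.
  rewrite (eq_bigr (fun j : 'I_m.+1 => cos (c%:R * (y + pi) - 2 * h * j%:R))); last first.
    by move=> j _; congr cos; rewrite /node /h cE; field.
  rewrite sum_cos_arith (_ : 2 * h * m.+1%:R = (pi *+ 2) *+ c); last first.
    by rewrite /h -mulr_natr -[in RHS]mulr_natr; field.
  by rewrite -[X in sin X - _](subrK (pi *+ 2 *+ c)) (periodicn (@sinD2pi R)) subrr.
move=> km lm; have [kl|lk|->] := ltngtP k l.
- rewrite mul0r -[RHS](E k l) ?kl//; apply: eq_bigr => j _.
  by rewrite -cosN opprB.
- by rewrite mul0r (E l k)// lk.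
- rewrite mul1r (eq_bigr (fun=> 1)) ?sumr_const ?card_ord//.
  by move=> j _; rewrite subrr cos0.
Qed.

Let mM0 : (m * m.+1)%:R != 0 :> R.
Proof. by rewrite pnatr_eq0 muln_eq0 negb_or -lt0n m_gt0. Qed.

Lemma sum_fejer y : \sum_(j < m.+1) fejer (y - node j) = 1.
Proof.
under eq_bigr do rewrite fejerE.
rewrite -mulr_sumr exchange_big/=.
under eq_bigr do rewrite exchange_big/=.
rewrite (eq_bigr (fun k : 'I_m => m.+1%:R)); last first.
  move=> k _; rewrite (eq_bigr (fun l : 'I_m => ((k : nat) == l)%:R * m.+1%:R)); last first.
    by move=> l _; rewrite sum_cos_node// ltnW.
  rewrite (bigD1 k)//= eqxx mul1r big1 ?addr0// => l lk.
  by rewrite eq_sym (negbTE lk : (_ == _ :> nat) = false) mul0r.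
rewrite sumr_const card_ord (_ : m.+1%:R *+ m = (m * m.+1)%:R) ?mulVf//.
by rewrite natrM mulr_natl.
Qed.

Let count_eq (a : nat) : \sum_(k < m) ((k : nat) == a)%:R = (a < m)%N%:R :> R.
Proof.
have [am|ma] := ltnP a m; last first.
  rewrite big1// => k _; case: eqP => // ka.
  by have := ltn_ord k; rewrite ka ltnNge ma.
rewrite (bigD1 (Ordinal am))//= eqxx big1 ?addr0// => k ka.
by rewrite (negbTE ka : (_ == _ :> nat) = false).
Qed.

Let count_succ : \sum_(l < m) \sum_(k < m) (k.+1 == l)%:R = m.-1%:R :> R.
Proof.
case: m count_eq m_gt0 => // m' cnt _; rewrite big_ord_recl big1 ?add0r; last by [].
rewrite (eq_bigr (fun=> 1)) ?sumr_const ?card_ord// => l _.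
under eq_bigr do rewrite lift0 eqSS.
by rewrite cnt ltnS ltnW.
Qed.

(** The kernel concentrates near 0: its weight times 1 - cos only keeps the
    difference between m diagonal and m - 1 subdiagonal terms, that is 1 / m. *)
Lemma sum_fejer_cos y :
  \sum_(j < m.+1) fejer (y - node j) * (1 - cos (y - node j)) = m%:R^-1.
Proof.
under eq_bigr do rewrite mulrBr mulr1.
rewrite sumrB sum_fejer.
have -> : \sum_(j < m.+1) fejer (y - node j) * cos (y - node j) =
    (m * m.+1)%:R^-1 * (m.-1%:R * m.+1%:R).
  under eq_bigr do rewrite fejerE -mulrA mulr_suml.
  rewrite -mulr_sumr; congr (_ * _).
  rewrite exchange_big/=; under eq_bigr do under eq_bigr do rewrite mulr_suml.
  under eq_bigr do rewrite exchange_big/=.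
  rewrite (eq_bigr (fun k : 'I_m => \sum_(l < m)
     (2^-1 * (k.+1 == l)%:R * m.+1%:R + 2^-1 * (l.+1 == k)%:R * m.+1%:R))); last first.
    move=> k _; apply: eq_bigr => l _.
    rewrite -!mulrA -(sum_cos_node y) ?(ltn_ord k) ?(ltnW (ltn_ord l))//.
    rewrite [(l.+1 == k)%N]eq_sym -(sum_cos_node y) ?(ltn_ord l) ?(ltnW (ltn_ord k))//.
    rewrite !mulr_sumr -big_split/=; apply: eq_bigr => j _.
    move: (y - node j) => z; rewrite -[k.+1%:R]natr1 -[l.+1%:R]natr1.
    have -> : (k%:R + 1) * z - l%:R * z = (k%:R * z - l%:R * z) + z by ring.
    have -> : k%:R * z - (l%:R + 1) * z = (k%:R * z - l%:R * z) - z by ring.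
    by move: (k%:R * z - l%:R * z) => w; rewrite (cosD w z) (cosB w z); field.
  under eq_bigr do rewrite big_split/= -!mulr_suml -!mulr_sumr.
  rewrite big_split/= -!mulr_suml -!mulr_sumr count_succ exchange_big/= count_succ.
  by field.
case: m m_gt0 mM0 => // m' _ _; rewrite /= natrM -[m'.+2%:R]natr1 -[m'.+1%:R]natr1.
by field; rewrite !natr1 !pnatr_eq0.
Qed.

End fejer_kernel.

Section fejer_approximation.
Context {R : realType} {D : nat}.
Implicit Types (f : 'rV[R]_D -> R) (x y : 'rV[R]_D).

Lemma trigpoly_fejer (m : nat) (a c : R) (i : 'I_D) :
  trigpoly (fun x : 'rV[R]_D => fejer m (a * x 0 i - c)).
Proof.
rewrite /fejer; apply: trigpolyM; first exact: trigpoly_cst.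
under eq_fun do rewrite !expr2.
have pc : trigpoly (fun x : 'rV[R]_D => \sum_(k < m) cos (k%:R * (a * x 0 i - c))).
  apply: trigpoly_sum => k.
  under eq_fun do rewrite mulrBr mulrA.
  exact: trigpoly_cos1.
have ps : trigpoly (fun x : 'rV[R]_D => \sum_(k < m) sin (k%:R * (a * x 0 i - c))).
  apply: trigpoly_sum => k.
  under eq_fun do rewrite mulrBr mulrA.
  exact: trigpoly_sin1.
by apply: trigpolyD; exact: trigpolyM.
Qed.

Lemma cos_le_cos_off (dl z : R) : 0 <= dl -> dl <= pi / 2 ->
  dl <= `|z| -> `|z| <= 3 / 2 * pi -> cos z <= cos dl.
Proof.
move=> d0 d1 dz z1.
have pp : 0 < pi :> R by exact: pi_gt0.
have -> : cos z = cos `|z|.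
  by case: (ger0P z) => _ //; rewrite cosN.
have [zp|zp] := leP `|z| pi.
  by rewrite leNgt; apply/negP => h; move: dz; rewrite leNgt -ltr_cos ?h// in_itv/= ?zp ?normr_ge0 ?d0//; lra.
have -> : cos `|z| = cos (2 * pi - `|z|).
  by rewrite -cosN -(@cosD2pi R) mulr2n; congr cos; ring.
by rewrite leNgt; apply/negP => h; have : 2 * pi - `|z| < dl;
  [rewrite -ltr_cos ?h// in_itv/=; lra|lra].
Qed.

(** Korovkin's argument in D dimensions: products of translated kernels are a
    partition of unity, so averaging the values of f at the nodes with these
    weights keeps the bound K; nodes far from x contribute at most 2 K times
    their weight, which is small by [sum_fejer_cos]. *)
Lemma fejer_approx f (K L kap : R) : 0 < L -> 0 < kap ->
  (forall x, `|f x| <= K) ->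
  (exists2 dl, 0 < dl & forall x y, (forall i, `|x 0 i| <= 4 * L) ->
     (forall i, `|y 0 i| <= 4 * L) ->
     (forall i, `|x 0 i - y 0 i| < dl) -> `|f x - f y| <= kap) ->
  exists T, [/\ trigpoly T, forall x, `|T x| <= K &
    forall x, (forall i, `|x 0 i| <= L) -> `|T x - f x| <= 2 * kap].
Proof.
move=> L0 k0 fK [dl0 dl0_gt0 unif].
have K0 : 0 <= K by exact: le_trans (fK 0).
have p0 : 0 < pi :> R by exact: pi_gt0.
(* [-L, L] is mapped onto a quarter of the period, so the distance between a
   point of it and a node stays below 3/2 pi, where 1 - cos controls it. *)
pose om : R := pi / (4 * L).
have om0 : 0 < om by rewrite divr_gt0// mulr_gt0.
pose dl := Num.min (om * dl0) (pi / 2).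
have dl_gt0 : 0 < dl by rewrite lt_min mulr_gt0//= divr_gt0.
have dl_le : dl <= pi / 2 by rewrite ge_min lexx orbT.
pose c : R := 1 - cos dl.
have c0 : 0 < c.
  rewrite subr_gt0 -cos0 ltr_cos// in_itv/=; first by rewrite lexx ltW.
  by rewrite ltW//=; apply: le_trans dl_le _; lra.
have [m m0 mP] : exists2 m : nat, (0 < m)%N & 2 * K / c * (D%:R / m%:R) <= kap.
  have B0 : 0 <= 2 * K / c * D%:R / kap.
    by rewrite !mulr_ge0 ?invr_ge0// ltW.
  have := truncnS_gt (2 * K / c * D%:R / kap).
  set m := (Num.trunc _).+1 => mB; exists m => //.
  by rewrite mulrA ler_pdivrMr ?ltr0n// [leRHS]mulrC -ler_pdivrMr// ltW.
pose w (J : {ffun 'I_D -> 'I_m.+1}) x := \prod_i fejer m (om * x 0 i - node m (J i)).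
pose nu (J : {ffun 'I_D -> 'I_m.+1}) : 'rV[R]_D := \row_i (node m (J i) / om).
have w0 J x : 0 <= w J x by apply: prodr_ge0 => i _; exact: fejer_ge0.
have w1 x : \sum_J w J x = 1.
  rewrite /w -(bigA_distr_bigA (fun i j => fejer m (om * x 0 i - node m (nat_of_ord j))))/=.
  by rewrite big1// => i _; rewrite sum_fejer.
have wc x i : \sum_J w J x * (1 - cos (om * x 0 i - node m (J i))) = m%:R^-1.
  pose G i' (j : 'I_m.+1) := fejer m (om * x 0 i' - node m j) *
    (if i' == i then 1 - cos (om * x 0 i' - node m j) else 1).
  rewrite (eq_bigr (fun J : {ffun 'I_D -> 'I_m.+1} => \prod_i' G i' (J i'))); last first.
    move=> J _; rewrite /G big_split/=; congr (_ * _).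
    by rewrite (bigD1 i)//= eqxx big1 ?mulr1// => j /negbTE ->.
  rewrite -(bigA_distr_bigA G)/= (bigD1 i)//= [X in _ * X]big1 ?mulr1.
    by under eq_bigr do rewrite /G eqxx; exact: sum_fejer_cos.
  move=> j /negbTE ji; rewrite /G ji -[RHS](sum_fejer m0 (om * x 0 j)).
  by apply: eq_bigr => k _; rewrite mulr1.
exists (fun x => \sum_J f (nu J) * w J x); split.
- apply: trigpoly_sum => J; apply: trigpolyM; first exact: trigpoly_cst.
  by apply: trigpoly_prod => i; exact: trigpoly_fejer.
- move=> x; rewrite (le_trans (ler_norm_sum _ _ _))//.
  rewrite -[K]mulr1 -(w1 x) mulr_sumr ler_sum// => J _.
  by rewrite normrM (ger0_norm (w0 J x)) ler_wpM2r.
- move=> x xL.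
  have node_le J (i : 'I_D) : `|node m (nat_of_ord ((J : {ffun 'I_D -> 'I_m.+1}) i))| <= pi :> R.
    rewrite /node; have := ltn_ord (J i); set j := nat_of_ord _ => jm.
    have : 0 <= j%:R * (2 * pi / m.+1%:R) :> R.
      by rewrite mulr_ge0// divr_ge0// mulr_ge0// ltW.
    have : j%:R * (2 * pi / m.+1%:R) <= 2 * pi :> R.
      rewrite mulrA ler_pdivrMr ?ltr0n// mulrC ler_pM2l ?mulr_gt0// ler_nat.
      exact: ltnW.
    by move: (_%:R * _) => q q2 q0; rewrite ler_norml; apply/andP; split; lra.
  have omL : om * L = pi / 4 by rewrite /om; field; rewrite gt_eqF.
  have omx i : `|om * x 0 i| <= pi / 4.
    by rewrite normrM (gtr0_norm om0) -omL ler_pM2l.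
  have nuL J i : `|nu J 0 i| <= 4 * L.
    rewrite mxE normrM normfV (gtr0_norm om0) ler_pdivrMr//.
    by rewrite (_ : 4 * L * om = pi) ?node_le//; rewrite /om; field; rewrite gt_eqF.
  have key J : `|f (nu J) - f x| <= kap + 2 * K / c * \sum_i (1 - cos (om * x 0 i - node m (J i))).
    have sum0 : 0 <= \sum_i (1 - cos (om * x 0 i - node m (J i))).
      by apply: sumr_ge0 => i _; rewrite subr_ge0 cos_le1.
    have [near|] := pselect (forall i, `|om * x 0 i - node m (J i)| < dl).
      rewrite (@le_trans _ _ kap)//; last first.
        by rewrite lerDl mulr_ge0// divr_ge0 ?mulr_ge0// ltW.
      apply: unif => [//|i|i].
        by apply: le_trans (xL i) _; lra.
      have -> : nu J 0 i - x 0 i = - (om * x 0 i - node m (J i)) / om.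
        by rewrite mxE; field; rewrite gt_eqF.
      rewrite normrM normrN normfV (gtr0_norm om0) ltr_pdivrMr// mulrC.
      have := near i; rewrite [om * _]mulrC => /lt_le_trans; apply.
      by rewrite /dl ge_min mulrC lexx.
    move=> /existsNP[i /negP]; rewrite -leNgt => far.
    have ci : c <= 1 - cos (om * x 0 i - node m (J i)).
      rewrite lerD2l lerN2; apply: (cos_le_cos_off (ltW dl_gt0) dl_le far).
      rewrite (le_trans (ler_normB _ _))//.
      by have := omx i; have := node_le J i; lra.
    have : c <= \sum_i (1 - cos (om * x 0 i - node m (J i))).
      rewrite (bigD1 i)//= (le_trans ci)// lerDl.
      by apply: sumr_ge0 => j _; rewrite subr_ge0 cos_le1.
    move=> cs; rewrite (@le_trans _ _ (2 * K))//.
      rewrite (le_trans (ler_normB _ _))//.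
      by have := fK (nu J); have := fK x; lra.
    apply: (@le_trans _ _ (2 * K / c * c)); first by rewrite divfK// gt_eqF.
    have : 2 * K / c * c <= 2 * K / c * \sum_i (1 - cos (om * x 0 i - node m (J i))).
      by rewrite ler_wpM2l// divr_ge0 ?mulr_ge0// ltW.
    by lra.
  have -> : \sum_J f (nu J) * w J x - f x = \sum_J (f (nu J) - f x) * w J x.
    rewrite -[X in _ - X]mulr1 -(w1 x) mulr_sumr -sumrB.
    by apply: eq_bigr => J _; rewrite mulrBl.
  rewrite (le_trans (ler_norm_sum _ _ _))//.
  apply: (@le_trans _ _ (\sum_J (kap * w J x + 2 * K / c *
      \sum_i w J x * (1 - cos (om * x 0 i - node m (J i)))))).
    apply: ler_sum => J _; rewrite normrM (ger0_norm (w0 J x)).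
    rewrite -mulr_sumr mulrCA [kap * _]mulrC -mulrDr [leLHS]mulrC.
    by rewrite ler_wpM2l.
  rewrite big_split/= -!mulr_sumr w1 mulr1 exchange_big/=.
  under eq_bigr do rewrite wc.
  rewrite sumr_const card_ord -[m%:R^-1 *+ D]mulr_natl.
  by move: mP; lra.
Qed.

End fejer_approximation.

Lemma uniformly_continuous_on_cube (R : realType) (D : nat) (f : 'rV[R]_D -> R)
    (L kap : R) :
  continuous f -> 0 < kap ->
  exists2 dl : R, 0 < dl & forall x y : 'rV[R]_D, (forall i, `|x 0 i| <= L) ->
     (forall i, `|x 0 i - y 0 i| < dl) -> `|f x - f y| <= kap.
Proof.
move=> cf k0.
have cK : compact [set v : 'rV[R]_D | forall i, `[- L, L]%classic (v ord0 i)].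
  by apply: (@rV_compact R D (fun=> `[- L, L]%classic)) => i; exact: segment_compact.
move/compact_near_coveringP : cK => /(_ _ (0 : R)^'+ (fun dl x => forall y : 'rV[R]_D,
  (forall i, `|x 0 i - y 0 i| < dl) -> `|f x - f y| <= kap)).
move=> cov; have {}cov := cov _; have H : \forall dl \near (0 : R)^'+,
    [set v : 'rV[R]_D | forall i, `[- L, L]%classic (v ord0 i)] `<=`
    (fun x : 'rV[R]_D => forall y : 'rV[R]_D,
       (forall i, `|x 0 i - y 0 i| < dl) -> `|f x - f y| <= kap).
  apply: cov.
  move=> x _.
  have k20 : 0 < kap / 2 by rewrite divr_gt0.
  have : nbhs (x : 'rV[R]_D) [set y | `|f x - f y| < kap / 2].
    exact: (cvgrPdist_lt _ _).1 (cf x) _ k20.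
  rewrite -nbhs_ballE => -[r /= r0 rP].
  exists (ball x (r / 2), [set dl | dl < r / 2]).
    split => /=; first by apply: nbhsx_ballx; rewrite divr_gt0.
    by apply: nbhs_right_lt; rewrite divr_gt0.
  move=> [x' dl]/= [xx' dlr] y yx'.
  have fx' : `|f x - f x'| < kap / 2.
    by apply: rP; apply: le_ball xx'; lra.
  have fy : `|f x - f y| < kap / 2.
    apply: rP; split=> // j i; rewrite (ord1 j).
    have := xx'.2 0 i; have := yx' i.
    rewrite /ball/= => h1 h2.
    by have := ler_distD (x' 0 i) (x 0 i) (y 0 i); move: h1 h2; lra.
  rewrite (le_trans (ler_distD (f x) _ _))//.
  by rewrite [`|f x' - _|]distrC; lra.
have [dl [dl0 dlP]] : exists dl, 0 < dl /\ forall x : 'rV[R]_D, (forall i, `[- L, L]%classic (x ord0 i)) ->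
   forall y : 'rV[R]_D, (forall i, `|x 0 i - y 0 i| < dl) -> `|f x - f y| <= kap.
  near (0 : R)^'+ => dl; exists dl; split; first by near: dl; exact: nbhs_right_gt.
  by near: dl; exact: H.
exists dl => // x y xL; apply: dlP => i /=.
by have := xL i; rewrite ler_norml in_itv/= -ler_norml.
Unshelve. all: by end_near. Qed.

Lemma fejer_approx_continuous (R : realType) (D : nat) (f : 'rV[R]_D -> R)
    (K L kap : R) : continuous f -> 0 < L -> 0 < kap -> (forall x, `|f x| <= K) ->
  exists T, [/\ trigpoly T, forall x, `|T x| <= K &
    forall x : 'rV[R]_D, (forall i, `|x 0 i| <= L) -> `|T x - f x| <= kap].
Proof.
move=> cf L0 k0 fK.
have k20 : 0 < kap / 2 by rewrite divr_gt0.
have [dl dl0 dlP] := @uniformly_continuous_on_cube R D f (4 * L) _ cf k20.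
have [|T [pT TK TP]] := fejer_approx L0 k20 fK; first by exists dl => // x y xL _; exact: dlP.
by exists T; split=> // x /TP; rewrite mulrC divfK.
Qed.

Section fubini.
Context {d1 d2 : measure_display} {T1 : measurableType d1}
  {T2 : measurableType d2} {R : realType}.
Variables (P : probability T1 R) (Q : probability T2 R).

Lemma Ex_fubini (K : R) (h : T1 * T2 -> R) : measurable_fun setT h ->
  (forall z, 0 <= h z) -> bounded_by K h ->
  Ex P (fun x => Ex Q (fun y => h (x, y))) = Ex Q (fun y => Ex P (fun x => h (x, y))).
Proof.
move=> mh h0 hK.
have mx x : measurable_fun setT (fun y => h (x, y)).
  exact: (measurableT_comp mh (measurable_pair1 x)).
have my y : measurable_fun setT (fun x => h (x, y)).
  exact: (measurableT_comp mh (measurable_pair2 y)).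
have Lx x : L1 Q (fun y => h (x, y)) by apply: (@L1_bounded _ _ _ Q K) => // y; exact: hK.
have Ly y : L1 P (fun x => h (x, y)) by apply: (@L1_bounded _ _ _ P K) => // x; exact: hK.
have mEh : measurable_fun setT (EFin \o h) by exact/measurable_EFinP.
rewrite {1}/Ex {2}/Ex /Rintegral; congr fine.
under eq_integral do rewrite -ExE//.
under [RHS]eq_integral do rewrite -ExE//.
by apply: (@fubini_tonelli _ _ _ _ _ P Q (EFin \o h) mEh) => z; rewrite lee_fin.
Qed.

Lemma measurable_Ex_section (K : R) (h : T1 * T2 -> R) : measurable_fun setT h ->
  (forall z, 0 <= h z) -> bounded_by K h ->
  measurable_fun setT (fun y => Ex P (fun x => h (x, y))).
Proof.
move=> mh h0 hK; apply: measurableT_comp => //=.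
have mEh : measurable_fun setT (EFin \o h) by exact/measurable_EFinP.
by apply: (@measurable_fun_fubini_tonelli_G _ _ _ _ _ P (EFin \o h) mEh) => z; rewrite lee_fin.
Qed.

End fubini.

Section levy_continuity.
Context {d1 d2 : measure_display} {T : measurableType d1}
  {T' : measurableType d2} {R : realType} {D : nat}.
Variables (P : probability T R) (P' : probability T' R).
Implicit Types (f : 'rV[R]_D -> R).

Lemma trigpoly_bounded f : trigpoly f -> exists K, forall x, `|f x| <= K.
Proof.
elim=> [a t th|g h _ [K gK] _ [K' hK]].
  exists `|a| => x; rewrite normrM ler_piMr//.
  exact: cos_max.
by exists (K + K') => x; rewrite (le_trans (ler_normD _ _))// lerD.
Qed.

Lemma measurable_trigpoly dO (O : measurableType dO) f (Y : O -> 'rV[R]_D) :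
  (forall i, measurable_fun setT (fun w => Y w 0 i)) -> trigpoly f ->
  measurable_fun setT (f \o Y).
Proof.
move=> mY; elim=> [a t th|g h _ mg _ mh]; last exact: measurable_funD.
apply: measurable_funM => //; apply: measurable_cos_comp.
apply: measurable_funD => //; apply: measurable_sum => i.
exact: measurable_funM.
Qed.

(** Measurability of the coordinates suffices because f is a pointwise limit of
    trigonometric polynomials, obtained on larger and larger cubes. *)
Lemma measurable_continuous_rV dO (O : measurableType dO) f (Y : O -> 'rV[R]_D) K :
  (forall i, measurable_fun setT (fun w => Y w 0 i)) -> continuous f ->
  (forall x, `|f x| <= K) -> measurable_fun setT (f \o Y).
Proof.
move=> mY cf fK.
have TP (k : nat) : {T | trigpoly T & forall x : 'rV[R]_D,
    (forall i, `|x 0 i| <= k.+1%:R) -> `|T x - f x| <= k.+1%:R^-1}.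
  apply/cid2; have [||Tk [? _ ?]] := @fejer_approx_continuous R D f K k.+1%:R k.+1%:R^-1 cf _ _ fK.
  - by [].
  - by rewrite invr_gt0.
  - by exists Tk.
pose Tk k := s2val (TP k).
apply: (@measurable_fun_cvg _ _ _ _ (fun k => Tk k \o Y) (f \o Y)).
  by move=> k; apply: measurable_trigpoly => //; exact: s2valP (TP k).
move=> w _; apply/cvgrPdist_le => e e0.
have [B YB] : exists B : R, forall i, `|Y w 0 i| <= B.
  exists (\sum_i `|Y w 0 i|) => i.
  by rewrite (bigD1 i)//= lerDl sumr_ge0.
near=> k; rewrite distrC (le_trans (s2valP' (TP k) _ _))//.
  move=> i; rewrite (le_trans (YB i))// ltW//.
  by rewrite (lt_le_trans (_ : B < k%:R)) ?ler_nat//; near: k; exact: nbhs_infty_gtr.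
rewrite invf_ple ?posrE// ltW// (@lt_le_trans _ _ k%:R) ?ler_nat//.
by near: k; exact: nbhs_infty_gtr.
Unshelve. all: by end_near. Qed.

(** A smooth substitute for the indicator of large |y|, chosen because it is a
    mixture of the functions 1 - cos(r z y). *)
Definition tail_gauge (r y : R) : R := 1 - expR (- ((r * y) ^+ 2 / 2)).

Lemma tail_gauge_ge0 r y : 0 <= tail_gauge r y.
Proof. by rewrite subr_ge0 -expR0 ler_expR oppr_le0 divr_ge0// sqr_ge0. Qed.

Lemma tail_gauge_le1 r y : tail_gauge r y <= 1.
Proof. by rewrite gerBl expR_ge0. Qed.

Lemma tail_gauge_bounded r (O : Type) (y : O -> R) w : `|tail_gauge r (y w)| <= 1.
Proof. by rewrite ger0_norm ?tail_gauge_ge0// tail_gauge_le1. Qed.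

Lemma measurable_tail_gauge dO (O : measurableType dO) r (y : O -> R) :
  measurable_fun setT y -> measurable_fun setT (fun w => tail_gauge r (y w)).
Proof.
move=> my; apply: measurable_funB => //; apply: measurableT_comp => //.
apply: measurableT_comp => //; apply: measurable_funM => //.
by apply: measurable_funX; exact: measurable_funM.
Qed.

(** The factor 2 / L brings |y| >= L to the range where e^{-2} <= 1/2. *)
Lemma tail_gauge_far L y : 0 < L -> L <= `|y| -> 1 / 2 <= tail_gauge (2 / L) y.
Proof.
move=> L0 Ly; rewrite /tail_gauge.
have h : 2 <= (2 / L * y) ^+ 2 / 2.
  have : 2 ^+ 2 <= `|2 / L * y| ^+ 2.
    rewrite lerXn2r ?nnegrE// normrM gtr0_norm ?divr_gt0//.
    by rewrite mulrAC ler_pdivlMr// ler_pM2l.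
  by rewrite -normrX ger0_norm ?sqr_ge0// => ?; lra.
have : expR (- ((2 / L * y) ^+ 2 / 2)) <= expR (- 2) :> R by rewrite ler_expR lerN2.
have : expR (- 2) <= 1 / 2 :> R.
  rewrite expRN mul1r lef_pV2 ?posrE ?expR_gt0//.
  by apply: le_trans (expR_ge1Dx _); lra.
by move=> *; lra.
Qed.

(** The mixture is over x.2, a standard Gaussian variable. *)
Let gap (O : Type) (r : R) (y : O -> R) (x : O * measurableTypeR R) : R :=
  1 - cos (r * x.2 * y x.1).

Let gap_ge0 (O : Type) r (y : O -> R) x : 0 <= gap r y x.
Proof. by rewrite subr_ge0 cos_le1. Qed.

Let gap_bounded dO (O : measurableType dO) r (y : O -> R) : bounded_by 2 (gap r y).
Proof.
move=> x; rewrite /gap; have := cos_le1 (r * x.2 * y x.1).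
have := cos_geN1 (r * x.2 * y x.1).
by move=> ? ?; rewrite ler_norml; apply/andP; split; lra.
Qed.

Let measurable_gap dO (O : measurableType dO) r (y : O -> R) :
  measurable_fun setT y -> measurable_fun setT (gap r y).
Proof.
move=> my; apply: measurable_funB => //; apply: measurable_cos_comp.
apply: measurable_funM; last exact: measurableT_comp.
by apply: measurable_funM => //; exact: measurable_snd.
Qed.

Let L1_cos dO (O : measurableType dO) (Q : probability O R) (y : O -> R) :
  measurable_fun setT y -> L1 Q (fun w => cos (y w)).
Proof.
move=> my; apply: (@L1_bounded _ _ _ _ 1); first exact: measurable_cos_comp.
by move=> w; exact: cos_max.
Qed.

(** The Gaussian characteristic function, followed by Fubini; the expectation of
    the gauge thus depends on the law of y through its characteristic function
    only. *)
Lemma tail_gauge_mixture r dO (O : measurableType dO) (Q : probability O R) (y : O -> R) :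
  measurable_fun setT y ->
  Ex Q (fun w => tail_gauge r (y w)) =
  Ex (normal_prob 0 1) (fun z => Ex Q (fun w => gap r y (w, z))).
Proof.
move=> my; have mh := measurable_gap r my.
transitivity (Ex Q (fun w => Ex (normal_prob 0 1) (fun z => gap r y (w, z)))).
  apply: eq_Ex => w; rewrite /gap/=.
  transitivity (1 - Ex (normal_prob 0 1) (fun z : measurableTypeR R => cos (0 + (r * y w) * z))).
    by rewrite gaussian_cf cos0 mul1r.
  rewrite -[X in X - _](Ex_cst (normal_prob (0 : R) 1)) -ExB; first last.
  - by apply: L1_cos; apply: measurable_funD => //; exact: measurable_funM.
  - exact: L1_cst.
  - by apply: eq_Ex => z /=; rewrite add0r mulrAC.
by apply: (@Ex_fubini _ _ _ _ _ Q (normal_prob 0 1) 2 (gap r y)) => //; exact: gap_bounded.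
Qed.

Lemma trig_approx_gauge f T0 (K L kap : R) y : 0 < L -> 0 <= kap ->
  (forall x, `|f x| <= K) -> (forall x, `|T0 x| <= K) ->
  (forall x : 'rV[R]_D, (forall i, `|x 0 i| <= L) -> `|T0 x - f x| <= kap) ->
  `|f y - T0 y| <= kap + 4 * K * \sum_i tail_gauge (2 / L) (y 0 i).
Proof.
move=> L0 k0 fK TK Tf; have K0 : 0 <= K by exact: le_trans (fK 0).
have [yL|] := pselect (forall i, `|y 0 i| <= L).
  rewrite distrC (le_trans (Tf _ yL))// lerDl mulr_ge0 ?mulr_ge0//.
  by apply: sumr_ge0 => i _; exact: tail_gauge_ge0.
move=> /existsNP[i /negP]; rewrite -ltNge => /ltW Ly.
rewrite (le_trans (ler_normB _ _))//.
have s0 : 1 / 2 <= \sum_i tail_gauge (2 / L) (y 0 i).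
  rewrite (bigD1 i)//= (le_trans (tail_gauge_far L0 Ly))// lerDl.
  by apply: sumr_ge0 => j _; exact: tail_gauge_ge0.
have := ler_wpM2l (mulr_ge0 (ler0n R 4) K0) s0.
by have := fK y; have := TK y; lra.
Qed.

Variables (Y_ : nat -> T -> 'rV[R]_D) (Y : T' -> 'rV[R]_D).
Hypothesis mY_ : forall n i, measurable_fun setT (fun w => Y_ n w 0 i).
Hypothesis mY : forall i, measurable_fun setT (fun w => Y w 0 i).
Hypothesis cvg_trig : forall t th,
  Ex P (fun w => cos (dotr t (Y_ n w) + th)) @[n --> \oo] -->
  Ex P' (fun w => cos (dotr t (Y w) + th)).

Lemma cvg_trigpoly f : trigpoly f ->
  Ex P (f \o Y_ n) @[n --> \oo] --> Ex P' (f \o Y).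
Proof.
elim=> [a t th|g h pg cg ph ch].
  have L1c dO (O : measurableType dO) (Q : probability O R) (y : O -> 'rV[R]_D) :
      (forall i, measurable_fun setT (fun w => y w 0 i)) ->
      L1 Q (fun w => cos (dotr t (y w) + th)).
    move=> my; apply: L1_cos; apply: measurable_funD => //.
    by apply: measurable_sum => i; exact: measurable_funM.
  rewrite /comp ExZ; last exact: L1c.
  under eq_fun do rewrite (ExZ _ (L1c _ _ _ _ (mY_ _))).
  by apply: cvgMr; exact: cvg_trig.
have L1t dO (O : measurableType dO) (Q : probability O R) (y : O -> 'rV[R]_D) k :
    (forall i, measurable_fun setT (fun w => y w 0 i)) -> trigpoly k -> L1 Q (k \o y).
  move=> my pk; have [e ke] := trigpoly_bounded pk.
  by apply: (@L1_bounded _ _ _ _ e); [exact: measurable_trigpoly|move=> w; exact: ke].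
rewrite /comp ExD; [|exact: L1t|exact: L1t].
by under eq_fun do rewrite (ExD (L1t _ _ _ _ _ (mY_ _) pg) (L1t _ _ _ _ _ (mY_ _) ph)); exact: cvgD.
Qed.

(** Dominated convergence in the mixing variable: this is where convergence of
    characteristic functions yields tightness. *)
Lemma cvg_tail_gauge r i :
  Ex P (fun w => tail_gauge r (Y_ n w 0 i)) @[n --> \oo] -->
  Ex P' (fun w => tail_gauge r (Y w 0 i)).
Proof.
rewrite tail_gauge_mixture//; under eq_fun do rewrite tail_gauge_mixture//.
have dotd (z : R) x : dotr (z *: delta_mx 0 i) x + 0 = z * x 0 i.
  rewrite addr0 /dotr (bigD1 i)//= !mxE !eqxx mulr1 big1 ?addr0// => j ji.
  by rewrite !mxE (negbTE ji) andbF mulr0 mul0r.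
have gapE dO (O : measurableType dO) (Q : probability O R) (y : O -> R) (z : R) :
    measurable_fun setT y ->
    Ex Q (fun w => gap r y (w, z)) = 1 - Ex Q (fun w => cos (r * z * y w)).
  move=> my; rewrite /gap/= ExB ?Ex_cst//; first exact: L1_cst.
  by apply: L1_cos; exact: measurable_funM.
have mE dO (O : measurableType dO) (Q : probability O R) (y : O -> R) :
    measurable_fun setT y ->
    measurable_fun setT (fun z : measurableTypeR R => Ex Q (fun w => gap r y (w, z))).
  move=> my; apply: (@measurable_Ex_section _ _ _ _ _ Q 2 (gap r y)).
  - exact: measurable_gap.
  - exact: gap_ge0.
  - exact: gap_bounded.
apply: (@dominated_Ex _ _ _ _ _ _ (cst 2)).
- by move=> n; apply: mE.
- exact: mE.
- move=> z; rewrite gapE//; under eq_fun do rewrite gapE//.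
  apply: cvgB; first exact: cvg_cst.
  have := @cvg_trig ((r * z) *: delta_mx 0 i) 0.
  under eq_fun do under eq_fun do rewrite dotd.
  by rewrite [Ex P' _](eq_Ex _ (fun w => congr1 cos (dotd _ _))).
- exact: L1_cst.
- move=> n z; apply: Ex_norm_bounded; last by move=> w; exact: gap_bounded.
  exact: measurableT_comp (measurable_gap r (mY_ n i)) (measurable_pair2 z).
Qed.

(** L is chosen so that the limit variable has little mass outside the cube, as
    measured by the gauge; by [cvg_tail_gauge] the same holds along the sequence,
    and on the cube f is replaced by a trigonometric polynomial. *)
Lemma levy_continuity f K : continuous f -> (forall x, `|f x| <= K) ->
  Ex P (f \o Y_ n) @[n --> \oo] --> Ex P' (f \o Y).
Proof.
move=> cf fK; have K0 : 0 <= K by exact: le_trans (fK 0).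
apply/cvgrPdist_le => e e0.
pose g r (x : 'rV[R]_D) := \sum_i tail_gauge r (x 0 i).
have L1g dO (O : measurableType dO) (Q : probability O R) (y : O -> 'rV[R]_D) r :
    (forall i, measurable_fun setT (fun w => y w 0 i)) -> L1 Q (g r \o y).
  move=> my; apply: L1_sum => i _; apply: (@L1_bounded _ _ _ _ 1).
    exact: measurable_tail_gauge.
  by move=> w; exact: tail_gauge_bounded.
have [L L0 LP] : exists2 L : R, 0 < L & 4 * K * Ex P' (g (2 / L) \o Y) <= e / 8.
  have : 4 * K * Ex P' (g (2 / n.+1%:R) \o Y) @[n --> \oo] --> 4 * K * Ex P' (cst 0).
    apply: cvgMr; apply: (@dominated_Ex _ _ _ _ _ _ (cst D%:R)).
    - by move=> n; exact: L1_meas (L1g _ _ P' _ _ _).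
    - exact: measurable_cst.
    - move=> w; rewrite /cst (_ : 0 = \sum_(i < D) (0 : R)); last by rewrite big1.
      apply: cvg_sum_fin => i; rewrite /tail_gauge.
      rewrite [X in _ --> X](_ : _ = 1 - expR (- ((2 * 0 * Y w 0 i) ^+ 2 / 2))); last first.
        by rewrite mulr0 mul0r expr0n/= mul0r oppr0 expR0 subrr.
      apply: cvgB; first exact: cvg_cst.
      apply: (@continuous_cvg _ _ _ _ _ _ expR); first exact: continuous_expR.
      apply: cvgN; apply: cvgMl; rewrite !expr2.
      have : 2 / n.+1%:R * Y w 0 i @[n --> \oo] --> 2 * 0 * Y w 0 i.
        by apply: cvgMl; apply: cvgMr; exact: cvg_harmonic.
      by move=> h; apply: cvgM.
    - exact: L1_cst.
    - move=> n w; rewrite (le_trans (ler_norm_sum _ _ _))//.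
      rewrite -[D in leRHS]card_ord -sumr_const ler_sum// => i _.
      exact: tail_gauge_bounded.
  rewrite Ex_cst mulr0 => /cvgrPdist_le/(_ (e / 8)); rewrite divr_gt0//.
  move=> /(_ isT)[k _ /(_ k (leqnn k))]; rewrite /= sub0r normrN => h.
  exists k.+1%:R => //; exact: le_trans (ler_norm _) h.
have [T0 [pT0 T0K T0f]] := fejer_approx_continuous cf L0 (divr_gt0 e0 (ltr0n R 8)) fK.
have bd dO (O : measurableType dO) (Q : probability O R) (y : O -> 'rV[R]_D) :
    (forall i, measurable_fun setT (fun w => y w 0 i)) ->
    `|Ex Q (f \o y) - Ex Q (T0 \o y)| <= e / 8 + 4 * K * Ex Q (g (2 / L) \o y).
  move=> my.
  have L1f : L1 Q (f \o y).
    by apply: (@L1_bounded _ _ _ _ K); [exact: measurable_continuous_rV|move=> w; exact: fK].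
  have L1T : L1 Q (T0 \o y).
    by apply: (@L1_bounded _ _ _ _ K); [exact: measurable_trigpoly|move=> w; exact: T0K].
  rewrite -ExB// -[e / 8](Ex_cst Q) -ExZ; last exact: L1g.
  rewrite -ExD; [|exact: L1_cst|by apply: L1Z; exact: L1g].
  apply: Ex_norm_le; first exact: L1B.
    by apply: L1D; [exact: L1_cst|apply: L1Z; exact: L1g].
  by move=> w; apply: trig_approx_gauge => //; rewrite ltW// divr_gt0.
have cg : 4 * K * Ex P (g (2 / L) \o Y_ n) @[n --> \oo] --> 4 * K * Ex P' (g (2 / L) \o Y).
  apply: cvgMr; rewrite /comp /g Ex_sum; last first.
    move=> i _; apply: (@L1_bounded _ _ _ _ 1); first exact: measurable_tail_gauge.
    by move=> w; exact: tail_gauge_bounded.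
  rewrite (_ : (fun n => _) = fun n => \sum_i Ex P (fun w => tail_gauge (2 / L) (Y_ n w 0 i))).
    by apply: cvg_sum_fin => i; exact: cvg_tail_gauge.
  apply/funext => n; rewrite Ex_sum// => i _.
  apply: (@L1_bounded _ _ _ _ 1); first exact: measurable_tail_gauge.
  by move=> w; exact: tail_gauge_bounded.
have e8 : 0 < e / 8 by rewrite divr_gt0.
have /cvgrPdist_le/(_ _ e8) Hg := cg.
have /cvgrPdist_le/(_ _ e8) HT := cvg_trigpoly pT0.
near=> n.
have h1 := bd _ _ P _ (mY_ n); have h2 := bd _ _ P' _ mY.
have h3 : `|4 * K * Ex P' (g (2 / L) \o Y) - 4 * K * Ex P (g (2 / L) \o Y_ n)| <= e / 8.
  by near: n.
have h4 : `|Ex P' (T0 \o Y) - Ex P (T0 \o Y_ n)| <= e / 8 by near: n.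
have := ler_distD (Ex P' (T0 \o Y)) (Ex P' (f \o Y)) (Ex P (f \o Y_ n)).
have := ler_distD (Ex P (T0 \o Y_ n)) (Ex P' (T0 \o Y)) (Ex P (f \o Y_ n)).
rewrite distrC in h1; move: h3; rewrite ler_norml => /andP[h3 _].
by move: LP h1 h2 h3 h4; lra.
Unshelve. all: by end_near. Qed.

End levy_continuity.

(** * Stable convergence of scalar martingale difference arrays *)

Section generated_approximation.
Context {disp : measure_display} {T : measurableType disp} {R : realType}.
Variables (P : probability T R) (H : nat -> set (set T)).
Hypothesis H_sigma : forall m, (0 < m)%N -> sigma_algebra setT (H m).
Hypothesis H_sub : forall m, (0 < m)%N -> H m `<=` measurable.
Hypothesis H_mono : forall l m, (0 < l)%N -> (l <= m)%N -> H l `<=` H m.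

Local Notation Hinf := (<<s \bigcup_(m in [set m | (1 <= m)%N]) H m >>).

Lemma generated_sub : Hinf `<=` measurable.
Proof. by apply: sub_measurable => A [m m0]; exact: H_sub. Qed.

Definition approximable (f : T -> R) := L1 P f /\ forall e : R, 0 < e ->
  exists m K g, [/\ (0 < m)%N, measurable_wrt (H m) g, bounded_by K g &
                    Ex P (fun w => `|f w - g w|) <= e].

Let L1_wrt m K g : (0 < m)%N -> measurable_wrt (H m) g -> bounded_by K g -> L1 P g.
Proof.
move=> m0 mg gK; apply: (@L1_bounded _ _ _ _ K) => //.
by apply: measurable_wrt_fun mg; exact: H_sub.
Qed.

Let approximable_lin a f f' : approximable f -> approximable f' ->
  approximable (fun w => a * f w + f' w).
Proof.
move=> [L1f af] [L1f' af']; split; first by apply: L1D => //; exact: L1Z.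
move=> e e0; pose c := `|a| + 1; have c0 : 0 < c by rewrite ltr_wpDl.
have [|m [K [g [m0 mg gK ge]]]] := af (e / 2 / c); first by rewrite !divr_gt0.
have [|l [K' [g' [l0 mg' gK' ge']]]] := af' (e / 2); first by rewrite divr_gt0.
have Hm := H_mono m0 (leq_maxl m l); have Hl := H_mono l0 (leq_maxr m l).
have L1g := L1_wrt m0 mg gK; have L1g' := L1_wrt l0 mg' gK'.
exists (maxn m l), (`|a| * K + K'), (fun w => a * g w + g' w); split.
- exact: leq_trans m0 (leq_maxl _ _).
- apply: measurable_funD; last exact: measurable_wrtS mg'.
  by apply: measurable_funM => //; exact: measurable_wrtS mg.
- by move=> w; rewrite (le_trans (ler_normD _ _))// lerD// normrM ler_wpM2l.
have L1d := L1_norm (L1B L1f L1g); have L1d' := L1_norm (L1B L1f' L1g').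
apply: (@le_trans _ _ (Ex P (fun w => c * `|f w - g w| + `|f' w - g' w|))).
  apply: Ex_le.
  - by apply: L1_norm; apply: L1B; apply: L1D => //; exact: L1Z.
  - by apply: L1D => //; exact: L1Z.
  - move=> w; rewrite (_ : _ - _ = a * (f w - g w) + (f' w - g' w)); last by ring.
    rewrite (le_trans (ler_normD _ _))// lerD2r normrM ler_wpM2r// /c.
    by rewrite lerDl.
rewrite ExD//; last exact: L1Z.
rewrite ExZ// [e]splitr lerD// mulrC -ler_pdivlMr//.
Qed.

Let approximable_lim f : L1 P f -> (forall e : R, 0 < e ->
    exists2 g, approximable g & Ex P (fun w => `|f w - g w|) <= e) ->
  approximable f.
Proof.
move=> L1f lim; split => // e e0; have e20 : 0 < e / 2 by rewrite divr_gt0.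
have [h [L1h ah] fh] := lim _ e20.
have [m [K [g [m0 mg gK hg]]]] := ah _ e20.
exists m, K, g; split => //; have L1g := L1_wrt m0 mg gK.
have L1fh := L1_norm (L1B L1f L1h); have L1hg := L1_norm (L1B L1h L1g).
apply: (@le_trans _ _ (Ex P (fun w => `|f w - h w| + `|h w - g w|))).
  apply: Ex_le; [by apply: L1_norm; exact: L1B|exact: L1D|].
  by move=> w; exact: ler_distD.
by rewrite ExD// [e]splitr lerD.
Qed.

(** The events whose indicator can be approximated form a lambda-system containing
    the pi-system formed by the union of the increasing fields H m. *)
Let approximable_indic A : Hinf A -> approximable (\1_A : T -> R).
Proof.
pose cl : set (set T) := [set A | measurable A /\ approximable (\1_A : T -> R)].
suff : Hinf `<=` cl by move=> + HA => /(_ _ HA)[].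
have gen m B : (0 < m)%N -> H m B -> cl B.
  move=> m0 HB; have mB := H_sub m0 HB; split => //.
  split; first exact: L1_indic.
  move=> e e0; exists m, 1, (\1_B); split => //.
  - exact: measurable_wrt_indic.
  - exact: bounded_by_indic.
  - rewrite (@eq_Ex _ _ _ _ _ (cst 0)) ?Ex_cst ?ltW// => w.
    by rewrite subrr normr0.
apply: lambda_system_subset => //.
- move=> A1 A2 [l l0 Hl] [m m0 Hm]; exists (maxn l m); first by rewrite /= leq_max l0.
  have sH : sigma_algebra setT (H (maxn l m)).
    by apply: H_sigma; exact: leq_trans l0 (leq_maxl _ _).
  rewrite -(sigma_algebra_id sH).
  apply: (@measurableI _ (g_sigma_algebraType (H (maxn l m)))).
    by apply: sub_sigma_algebra; exact: (H_mono l0 (leq_maxl l m)).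
  by apply: sub_sigma_algebra; exact: (H_mono m0 (leq_maxr l m)).
- split => //.
  + apply: (gen 1%N) => //; case: (H_sigma (ltn0Sn 0)) => s0 sC _.
    by rewrite -(setD0 setT); exact: sC.
  + move=> B C CB [mB aB] [mC aC]; split; first exact: measurableD.
    have := approximable_lin (-1) aC aB; congr approximable.
    apply/funext => w; rewrite !indicE mulN1r addrC in_setD.
    have [wC|wC] := boolP (w \in C); have [wB|wB] := boolP (w \in B) => //=; try by rewrite ?subrr ?subr0.
    by move: wC; rewrite inE => /CB; rewrite -[B w]in_setE (negbTE wB).
  + move=> F ndF clF; have mF n : measurable (F n) by case: (clF n).
    have mU : measurable (\bigcup_n F n) by exact: bigcup_measurable.
    split => //; apply: approximable_lim; first exact: L1_indic.
    have FU n : F n `<=` \bigcup_n F n by move=> w Fw; exists n.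
    have : Ex P (fun w => `|\1_(\bigcup_n F n) w - \1_(F n) w|) @[n --> \oo] --> Ex P (cst (0 : R)).
      apply: (@dominated_Ex _ _ _ _ _ _ (cst 1)) => //.
      * move=> n; apply: measurableT_comp => //.
        by apply: measurable_funB; exact: measurable_indic.
      * move=> w; apply: cvg_near_cst.
        have [[k _ Fkw]|Uw] := pselect ((\bigcup_n F n) w); last first.
          apply: nearW => n; rewrite !indicE (memNset Uw) memNset ?subrr ?normr0//.
          by move=> Fw; apply: Uw; exact: FU Fw.
        near=> n; rewrite !indicE mem_set; last by exists k.
        rewrite mem_set ?subrr ?normr0//.
        have /ndF/subsetPset : (k <= n)%N by near: n; exact: nbhs_infty_ge.
        exact.
      * exact: L1_cst.
      * move=> n w; rewrite !indicE normr_id.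
        by case: (_ \in _); case: (_ \in _); rewrite /= ?subrr ?subr0 ?sub0r ?normrN ?normr0 ?normr1.
    rewrite Ex_cst => /cvgrPdist_le cv e e0; have [n _ /(_ n (leqnn n))] := cv _ e0.
    rewrite /= sub0r normrN => h; exists (\1_(F n)); first by case: (clF n).
    exact: le_trans (ler_norm _) h.
- by move=> B [m m0]; exact: gen m0.
Unshelve. all: by end_near. Qed.

Lemma bounded_approximable K f : measurable_wrt Hinf f -> bounded_by K f -> approximable f.
Proof.
apply: (bounded_measurable_ind (smallest_sigma_algebra _ _)).
- exact: approximable_indic.
- exact: approximable_lin.
- move=> g mg lim; have mgT := measurable_wrt_fun generated_sub mg.
  have L1g : L1 P g.
    have [h [L1h _] gh] := lim 1 ltr01.
    apply: (@L1_le _ _ _ _ _ (fun w => `|h w| + 1)) => //.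
      by apply: L1D; [exact: L1_norm|exact: L1_cst].
    by move=> w; have := ler_distD (h w) (g w) 0; rewrite !subr0; have := gh w; lra.
  apply: approximable_lim => // e e0; have [h ah gh] := lim e e0; exists h => //.
  rewrite -(Ex_cst P e); apply: Ex_le => //; last exact: L1_cst.
  by apply: L1_norm; apply: L1B => //; case: ah.
Qed.

End generated_approximation.

Lemma expR_sub1_le {R : realType} (x : R) : `|x| <= 1 / 2 -> `|expR x - 1| <= 2 * `|x|.
Proof.
have [x0|x0] := ger0P x => xh; last first.
  have h := expR_ge1Dx x; have : expR x <= 1 by rewrite -expR0 ler_expR ltW.
  by move=> h'; rewrite ler_norml; apply/andP; split; lra.
have h := expR_ge1Dx (- x); have e0 := expR_gt0 x.
have h1 : expR x * (1 - x) <= 1.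
  by rewrite -[leRHS](mulfV (lt0r_neq0 e0)) -expRN ler_pM2l.
have h2 : 1 <= expR x by rewrite -expR0 ler_expR.
by rewrite ger0_norm ?subr_ge0//; nra.
Qed.

Definition row_sum {T : Type} {R : realType} (N : nat -> nat)
    (x : nat -> nat -> T -> R) (n : nat) (w : T) : R :=
  \sum_(k < N n) x n k w.

Section stable_scalar.
Context {disp : measure_display} {T : measurableType disp} {R : realType}.
Variables (P : probability T R) (N : nat -> nat) (G : nat -> nat -> set (set T)).
Variables (H : nat -> set (set T)) (M : nat -> nat).
Variables (xi v : nat -> nat -> T -> R) (lam : nat -> R -> nat -> T -> R).
Hypothesis H_sigma : forall m, (0 < m)%N -> sigma_algebra setT (H m).
Hypothesis H_sub : forall m, (0 < m)%N -> H m `<=` measurable.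
Hypothesis H_mono : forall l m, (0 < l)%N -> (l <= m)%N -> H l `<=` H m.
Hypothesis M_le : forall m n, (0 < m)%N -> (m <= n)%N -> (M m <= N n)%N.
Hypothesis HG : forall m n, (0 < m)%N -> (m <= n)%N -> H m `<=` G n (M m).
Hypothesis filtG : forall n, (0 < n)%N -> filtration (N n) (G n).
Hypothesis xi_meas : forall n k, (0 < n)%N -> (k < N n)%N ->
  measurable_wrt (G n k.+1) (xi n k).
Hypothesis v_meas : forall n k, (0 < n)%N -> (k < N n)%N -> measurable_wrt (G n k) (v n k).
Hypothesis lam_meas : forall n e k, (0 < n)%N -> 0 < e -> (k < N n)%N ->
  measurable_wrt (G n k) (lam n e k).
Hypothesis v_ge0 : forall n k w, 0 <= v n k w.
Hypothesis lam_ge0 : forall n e k w, 0 <= lam n e k w.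
Hypothesis xi_L2 : forall n k, (0 < n)%N -> (k < N n)%N -> L1 P (fun w => xi n k w ^+ 2).
Hypothesis v_L1 : forall n k, (0 < n)%N -> (k < N n)%N -> L1 P (v n k).
Hypothesis lam_L1 : forall n e k, (0 < n)%N -> 0 < e -> (k < N n)%N -> L1 P (lam n e k).
Hypothesis xi_mart : forall n k, (0 < n)%N -> (k < N n)%N ->
  forall K h, measurable_wrt (G n k) h -> bounded_by K h ->
  Ex P (fun w => h w * xi n k w) = 0.
Hypothesis xi_var : forall n k, (0 < n)%N -> (k < N n)%N ->
  forall K h, measurable_wrt (G n k) h -> bounded_by K h ->
  Ex P (fun w => h w * xi n k w ^+ 2) = Ex P (fun w => h w * v n k w).
Hypothesis xi_lind : forall n e k, (0 < n)%N -> 0 < e -> (k < N n)%N ->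
  forall K h, measurable_wrt (G n k) h -> bounded_by K h -> (forall w, 0 <= h w) ->
  Ex P (fun w => h w * (xi n k w ^+ 2 * (e <= `|xi n k w|)%R%:R)) <=
  Ex P (fun w => h w * lam n e k w).

Local Notation Hinf := (<<s \bigcup_(m in [set m | (1 <= m)%N]) H m >>).
Local Notation S := (row_sum N xi).
Local Notation V := (row_sum N v).
Local Notation Lam n e := (row_sum N (fun n => lam n e) n).

Variable A : T -> R.
Hypothesis A_meas : measurable_wrt Hinf A.
Hypothesis A_ge0 : forall w, 0 <= A w.
Hypothesis V_cvg : forall rho dl : R, 0 < rho -> 0 < dl -> \forall n \near \oo,
  fine (P [set w | rho <= `|V n w - A w|]) <= dl.
Hypothesis Lam_cvg : forall e rho dl : R, 0 < e -> 0 < rho -> 0 < dl -> \forall n \near \oo,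
  fine (P [set w | rho <= `|Lam n e w|]) <= dl.

Let A_fun : measurable_fun setT A.
Proof. by apply: measurable_wrt_fun A_meas; exact: generated_sub. Qed.

Let G_fun n k (f : T -> R) : (0 < n)%N -> (k <= N n)%N -> measurable_wrt (G n k) f ->
  measurable_fun setT f.
Proof. by move=> n0 kN; apply: measurable_wrt_fun; case: (filtG n0) => _ + _; exact. Qed.

Let S_fun n : (0 < n)%N -> measurable_fun setT (S n).
Proof. by move=> n0; apply: measurable_sum => k; apply: (@G_fun n k.+1) => //; exact: xi_meas. Qed.

Let V_fun n : (0 < n)%N -> measurable_fun setT (V n).
Proof.
by move=> n0; apply: measurable_sum => k; apply: (@G_fun n k) => //; [exact: ltnW|exact: v_meas].
Qed.

Let Lam_fun n e : (0 < n)%N -> 0 < e -> measurable_fun setT (Lam n e).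
Proof.
move=> n0 e0; apply: measurable_sum => k; apply: (@G_fun n k) => //; first exact: ltnW.
exact: lam_meas.
Qed.

(** By monotonicity of the partial sums, no step is stopped if the totals are
    below the thresholds. *)
Lemma exp_mart_unstopped n e C th w : V n w <= C -> Lam n e w <= e ^+ 2 ->
  exp_mart (xi n) (v n) (lam n e) e C th (N n) w = cos (S n w + th) * expR (V n w / 2).
Proof.
move=> VC LC.
have mono (u : nat -> T -> R) (k : 'I_(N n)) : (forall j w, 0 <= u j w) ->
    \sum_(i < k.+1) u i w <= \sum_(i < N n) u i w.
  move=> u0; rewrite (big_ord_widen (N n) (fun i => u i w))//.
  rewrite [leRHS](bigID (fun i : 'I_(N n) => (i < k.+1)%N))/= lerDl.
  exact: sumr_ge0.
have tau1 (k : 'I_(N n)) : tau (v n) (lam n e) e C k w = 1.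
  rewrite /tau indicE mem_set//; split.
    exact: le_trans (mono _ k (v_ge0 n)) VC.
  exact: le_trans (mono _ k (lam_ge0 n e)) LC.
rewrite /exp_mart /stopped_sum /stopped_var.
by under eq_bigr do rewrite tau1 mul1r; under [X in expR (X / 2)]eq_bigr do rewrite tau1 mul1r.
Qed.

(** The martingale is tested against g, an approximation of
    zeta = eta e^{-A / 2} 1{A < C - 1} known at a fixed time of all later rows.
    Off the events bad1 and bad2 the stopped process is cos(S_n + th) e^{V_n / 2},
    and V_n is close to A, so multiplying by zeta restores eta cos(S_n + th). *)
Lemma stable_cos th K eta : measurable_wrt Hinf eta -> bounded_by K eta ->
  Ex P (fun w => eta w * cos (S n w + th)) @[n --> \oo] -->
  cos th * Ex P (fun w => eta w * expR (- (A w / 2))).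
Proof.
move=> eta_m etaK; apply/cvgrPdist_le => e e0.
have K0 : 0 <= K by exact: le_trans (etaK point).
have eta_fun := measurable_wrt_fun (generated_sub H_sub) eta_m.
(* the final estimate is the sum of the five errors below, (3 K + 4) kap *)
pose kap := e / (3 * K + 4).
have kap0 : 0 < kap by rewrite divr_gt0// ltr_wpDl// mulr_ge0.
have decay_le1 w : expR (- (A w / 2)) <= 1.
  by rewrite -expR0 ler_expR oppr_le0 divr_ge0.
have decay_fun : measurable_fun setT (fun w => expR (- (A w / 2))).
  by apply: measurableT_comp => //; apply: measurableT_comp => //; exact: measurable_funM.
have decay_meas : measurable_wrt Hinf (fun w => expR (- (A w / 2))).
  by apply: measurableT_comp => //; apply: measurableT_comp => //; exact: measurable_funM.
(* A is finite, so truncating it costs little; the margin 1 between the cutoff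
   C - 1 and the stopping level C absorbs the error of V_n *)
have [C C1 farC] : exists2 C : R, 1 <= C & Ex P (\1_[set w | C - 1 <= A w]) <= kap.
  have : Ex P (\1_[set w | n%:R <= A w]) @[n --> \oo] --> Ex P (cst (0 : R)).
    apply: (@dominated_Ex _ _ _ _ _ _ (cst 1)) => //.
    - by move=> n; apply: measurable_indic; exact: measurable_ge.
    - move=> w; apply: cvg_near_cst; near=> n; rewrite indicE memNset//=.
      by apply/negP; rewrite -ltNge; near: n; exact: nbhs_infty_gtr.
    - exact: L1_cst.
    - by move=> n w; exact: bounded_by_indic.
  rewrite Ex_cst => /cvgrPdist_le/(_ _ kap0)[n _ /(_ n (leqnn n))].
  rewrite /= sub0r normrN => h; exists (n%:R + 1); first by rewrite lerDr.
  by rewrite addrK; exact: le_trans (ler_norm _) h.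
have C0 : 0 <= C by exact: le_trans C1.
pose far := [set w | C - 1 <= A w].
have m_far : measurable far by exact: measurable_ge.
pose E := expR (C / 2); have E1 : 1 <= E by rewrite -expR0 ler_expR divr_ge0.
have E0 : 0 < E by exact: expR_gt0.
pose zeta w := (1 - \1_far w) * (eta w * expR (- (A w / 2))).
have etaE_le w : `|eta w * expR (- (A w / 2))| <= K.
  by rewrite normrM (ger0_norm (expR_ge0 _)) -[K]mulr1 ler_pM ?expR_ge0//; exact: etaK.
have nfar01 w : 0 <= 1 - (\1_far w : R) <= 1.
  by rewrite indicE; case: (_ \in _); rewrite /= ?subrr ?subr0 ?lexx ?ler01.
have zetaK : bounded_by K zeta.
  move=> w; have /andP[n0 n1] := nfar01 w.
  by rewrite normrM (ger0_norm n0) -[K]mul1r ler_pM.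
have zeta_meas : measurable_wrt Hinf zeta.
  apply: measurable_funM; last exact: measurable_funM.
  apply: measurable_funB => //; apply: measurable_wrt_indic.
  have := measurable_wrt_preimage (smallest_sigma_algebra _ _) A_meas
    (measurable_itv `[C - 1, +oo[).
  by congr (Hinf _); apply/seteqP; split => w /=; rewrite in_itv/= andbT.
have zeta_fun := measurable_wrt_fun (generated_sub H_sub) zeta_meas.
have L1zeta := L1_bounded P zeta_fun zetaK.
have [_ /(_ (kap / E))] := bounded_approximable P H_sigma H_sub H_mono zeta_meas zetaK.
rewrite divr_gt0// => /(_ isT)[m [K' [g [m0 g_meas gK' zg]]]].
have K'0 : 0 <= K' by exact: le_trans (gK' point).
have g_fun := measurable_wrt_fun (H_sub m0) g_meas.
have L1g := L1_bounded P g_fun gK'.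
(* m, K' and C are fixed at this point, so eps may depend on them; n is chosen last *)
have [eps eps01 eps_small] : exists2 eps : R, 0 < eps <= 1 &
    K' * E * (eps * (4 * (M m)%:R + 3 + 5 * C)) <= kap.
  pose B := K' * E * (4 * (M m)%:R + 3 + 5 * C) + 1.
  have B0 : 0 < B.
    by rewrite ltr_wpDl// !mulr_ge0 ?(ltW E0)// !addr_ge0// mulr_ge0.
  exists (Num.min 1 (kap / B)).
    by rewrite lt_min ltr01 divr_gt0//= ge_min lexx.
  apply: (@le_trans _ _ (kap / B * B)); last by rewrite divfK ?gt_eqF.
  apply: (@le_trans _ _ (Num.min 1 (kap / B) * B)).
    have : 0 <= Num.min 1 (kap / B) by rewrite le_min ler01 divr_ge0 ?ltW.
    move: (Num.min 1 _) => x x0; rewrite /B.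
    by move: (K' * E) (4 * _ + 3 + 5 * C) => y z; rewrite mulrDr mulr1 mulrCA lerDl.
  by rewrite ler_wpM2r ?(ltW B0)// ge_min lexx orbT.
have /andP[eps0 eps1] := eps01.
pose rho := Num.min 1 kap.
have rho0 : 0 < rho by rewrite lt_min ltr01.
pose dl := kap / (2 * (K * (E + 1)) + 1).
have dlB : 0 < 2 * (K * (E + 1)) + 1.
  by rewrite ltr_wpDl// !mulr_ge0// addr_ge0// ltW.
have dl0 : 0 < dl by rewrite divr_gt0.
near=> n.
have n0 : (0 < n)%N by near: n; exact: nbhs_infty_gt.
have mn : (m <= n)%N by near: n; exact: nbhs_infty_ge.
pose bad1 := [set w | rho <= `|V n w - A w|].
pose bad2 := [set w | eps ^+ 2 <= `|Lam n eps w|].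
have P1 : fine (P bad1) <= dl by rewrite /bad1; near: n; exact: V_cvg.
have P2 : fine (P bad2) <= dl by rewrite /bad2; near: n; apply: Lam_cvg => //; exact: exprn_gt0.
have m_bad1 : measurable bad1.
  by apply: measurable_ge; apply: measurableT_comp => //; apply: measurable_funB => //; exact: V_fun.
have m_bad2 : measurable bad2.
  by apply: measurable_ge; apply: measurableT_comp => //; exact: Lam_fun.
pose X := exp_mart (xi n) (v n) (lam n eps) eps C th (N n).
have X_fun : measurable_fun setT X.
  apply: (@G_fun n (N n)) => //; apply: (@exp_mart_meas _ _ _ (N n)) => //.
  - exact: filtG.
  - by move=> k; exact: xi_meas.
  - by move=> k; exact: v_meas.
  - by move=> k; exact: lam_meas.
have XE : bounded_by E X by exact: bounded_exp_mart.
pose ecos w := eta w * cos (S n w + th).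
have ecos_fun : measurable_fun setT ecos.
  apply: measurable_funM => //; apply: measurable_cos_comp; apply: measurable_funD => //.
  exact: S_fun.
have ecosK : bounded_by K ecos.
  by move=> w; rewrite normrM -[K]mulr1 ler_pM// cos_max.
have L1ecos := L1_bounded P ecos_fun ecosK.
have bound_core : `|Ex P (fun w => g w * X w) - cos th * Ex P g| <= kap.
  apply: le_trans eps_small; apply: (@exp_mart_bound _ _ _ P (N n) (G n)) => //.
  - exact: filtG.
  - by move=> k; exact: xi_meas.
  - by move=> k; exact: v_meas.
  - by move=> k; exact: lam_meas.
  - by move=> k; exact: xi_L2.
  - by move=> k; exact: v_L1.
  - by move=> k; exact: lam_L1.
  - by move=> k; exact: xi_mart.
  - by move=> k; exact: xi_var.
  - by move=> k; exact: xi_lind.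
  - exact: M_le.
  - by apply: measurable_wrtS g_meas; exact: HG.
have L1dzg := L1_norm (L1B L1zeta L1g).
have L1zX : L1 P (fun w => zeta w * X w) by under eq_fun do rewrite mulrC; exact: (L1_mulb X_fun XE L1zeta).
have L1gX : L1 P (fun w => g w * X w) by under eq_fun do rewrite mulrC; exact: (L1_mulb X_fun XE L1g).
have b1 : `|Ex P (fun w => eta w * expR (- (A w / 2))) - Ex P zeta| <= K * kap.
  have L1e : L1 P (fun w => eta w * expR (- (A w / 2))).
    by apply: (L1_bounded P (measurable_funM eta_fun decay_fun) etaE_le).
  rewrite -ExB//; apply: (@le_trans _ _ (Ex P (fun w => K * \1_far w))); last first.
    by rewrite ExZ; [rewrite ler_wpM2l|exact: L1_indic].
  apply: Ex_norm_le; [exact: L1B|by apply: L1Z; exact: L1_indic|].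
  move=> w; rewrite (_ : _ - zeta w = \1_far w * (eta w * expR (- (A w / 2)))); last first.
    by rewrite /zeta; ring.
  by rewrite normrM mulrC (ger0_norm (_ : 0 <= \1_far w)) ?indicE// ler_wpM2r.
have b2 : `|Ex P zeta - Ex P g| <= kap.
  rewrite -ExB//; apply: (@le_trans _ _ (kap / E)).
    apply: le_trans zg; apply: Ex_norm_le => //; exact: L1B.
  by rewrite ler_pdivrMr// ler_peMr// ltW.
have b3 : `|Ex P (fun w => g w * X w) - Ex P (fun w => zeta w * X w)| <= kap.
  rewrite -ExB//; apply: (@le_trans _ _ (Ex P (fun w => E * `|zeta w - g w|))).
    apply: Ex_norm_le; [exact: L1B|exact: L1Z|].
    move=> w; rewrite -mulrBl normrM distrC mulrC ler_wpM2r//; exact: XE.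
  by rewrite ExZ// mulrC -ler_pdivlMr.
have b4 : `|Ex P (fun w => zeta w * X w) - Ex P ecos| <= 2 * K * kap + kap.
  rewrite -ExB//.
  apply: (@le_trans _ _ (Ex P (fun w => K * rho + K * \1_far w + (K * (E + 1)) * (\1_bad1 w + \1_bad2 w)))).
    apply: Ex_norm_le; first exact: L1B.
      apply: L1D; first by apply: L1D; [exact: L1_cst|by apply: L1Z; exact: L1_indic].
      by apply: L1Z; apply: L1D; exact: L1_indic.
    move=> w.
    have i1 : 0 <= \1_bad1 w :> R by rewrite indicE.
    have i2 : 0 <= \1_bad2 w :> R by rewrite indicE.
    have [Fw|Fw] := pselect (far w).
      have F1 : \1_far w = 1 :> R by rewrite indicE mem_set.
      rewrite /zeta F1 subrr !mul0r sub0r normrN mulr1.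
      rewrite (le_trans (ecosK w))// -addrA addrCA lerDl.
      by rewrite addr_ge0 ?mulr_ge0 ?addr_ge0// ?ltW.
    have F0 : \1_far w = 0 :> R by rewrite indicE memNset.
    have zE : zeta w = eta w * expR (- (A w / 2)) by rewrite /zeta F0 subr0 mul1r.
    rewrite F0 mulr0 addr0.
    have [Bw|Bw] := pselect (bad1 w \/ bad2 w).
      apply: (@le_trans _ _ (K * (E + 1))).
        rewrite (le_trans (ler_normB _ _))// mulrDr mulr1 lerD//.
        by rewrite normrM ler_pM//; exact: XE.
      have : 1 <= \1_bad1 w + \1_bad2 w :> R.
        case: Bw => Bw.
          by rewrite (_ : \1_bad1 w = 1) ?lerDl// indicE mem_set.
        by rewrite (_ : \1_bad2 w = 1) ?lerDr// indicE mem_set.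
      move=> h; rewrite ler_wpDl ?mulr_ge0// ?(ltW rho0)//.
      by rewrite ler_peMr// mulr_ge0// addr_ge0// ltW.
    have [/negP + /negP] := (not_orP _ _).1 Bw; rewrite -!ltNge => Vw Lw.
    have Aw : A w < C - 1 by rewrite ltNge; apply/negP.
    have rho1 : rho <= 1 by rewrite ge_min lexx.
    have VC : V n w <= C by move: Vw; rewrite ltr_norml => /andP[_ +]; lra.
    have XwE : X w = cos (S n w + th) * expR (V n w / 2).
      by apply: exp_mart_unstopped => //; exact: le_trans (ler_norm _) (ltW Lw).
    rewrite zE XwE /ecos.
    rewrite (_ : _ - _ = eta w * cos (S n w + th) * (expR ((V n w - A w) / 2) - 1)); last first.
      by rewrite (_ : (V n w - A w) / 2 = V n w / 2 + - (A w / 2)) ?expRD; [ring|ring].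
    rewrite ler_wpDr ?mulr_ge0 ?addr_ge0 ?(ltW E0)//.
    rewrite normrM ler_pM//; first exact: ecosK.
    have h : `|(V n w - A w) / 2| <= rho / 2.
      by rewrite normrM [`|2^-1|]gtr0_norm// ler_pM2r// ltW.
    by apply: le_trans (expR_sub1_le _) _; lra.
  rewrite ExD; [|by apply: L1D; [exact: L1_cst|by apply: L1Z; exact: L1_indic]
                |by apply: L1Z; apply: L1D; exact: L1_indic].
  rewrite ExD; [|exact: L1_cst|by apply: L1Z; exact: L1_indic].
  rewrite (Ex_cst P (K * rho)) ExZ; last exact: L1_indic.
  rewrite ExZ; last by apply: L1D; exact: L1_indic.
  rewrite ExD; [|exact: L1_indic|exact: L1_indic].
  rewrite !(Ex_indic P m_bad1, Ex_indic P m_bad2).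
  have r1 : K * rho <= K * kap by rewrite ler_wpM2l// ge_min lexx orbT.
  have r2 : K * Ex P (\1_far) <= K * kap by rewrite ler_wpM2l.
  have r3 : K * (E + 1) * (fine (P bad1) + fine (P bad2)) <= kap.
    apply: (@le_trans _ _ (K * (E + 1) * (dl + dl))).
      by rewrite ler_wpM2l ?lerD// mulr_ge0// addr_ge0// ltW.
    rewrite (_ : _ * (dl + dl) = (2 * (K * (E + 1))) * dl); last by ring.
    by move: dlB; rewrite /dl; move: (2 * _) => B B0; rewrite mulrCA ger_pMr// ler_pdivrMr// mul1r lerDl.
  lra.
set a := Ex P (fun w => eta w * expR _) in b1 *.
have c1 := cos_max th.
have step1 : `|cos th * a - cos th * Ex P g| <= K * kap + kap.
  rewrite -mulrBr normrM -[leRHS]mul1r ler_pM//.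
  by rewrite (le_trans (ler_distD (Ex P zeta) _ _))// lerD.
have := ler_distD (cos th * Ex P g) (cos th * a) (Ex P ecos).
have := ler_distD (Ex P (fun w => g w * X w)) (cos th * Ex P g) (Ex P ecos).
have := ler_distD (Ex P (fun w => zeta w * X w)) (Ex P (fun w => g w * X w)) (Ex P ecos).
have -> : e = K * kap + kap + kap + kap + (2 * K * kap + kap).
  by rewrite /kap; field; rewrite gt_eqF// ltr_wpDl// mulr_ge0.
rewrite [`|Ex P _ - cos th * _|]distrC in bound_core.
by lra.
Unshelve. all: by end_near. Qed.

End stable_scalar.

(** * Projections of the array and the decomposition of its sum *)

Section conditional_expectation_algebra.
Context {disp : measure_display} {T : measurableType disp} {R : realType}.
Variables (P : probability T R) (F : set (set T)).
Hypotheses (sF : sigma_algebra setT F) (Fm : F `<=` measurable).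
Implicit Types (X Y h : T -> R).

Lemma is_condexpI X Y : L1 P X -> L1 P Y -> measurable_wrt F Y ->
  (forall A, F A -> Ex P (fun w => \1_A w * X w) = Ex P (fun w => \1_A w * Y w)) ->
  is_condexp P F X Y.
Proof.
move=> L1X L1Y mY XY; split => // A FA; have mA := Fm FA.
have fin (Z : T -> R) : L1 P Z -> (\int[P]_(w in A) (Z w)%:E)%E \is a fin_num.
  by move=> L1Z; apply: integrable_fin_num => //; apply: integrableS L1Z.
have := XY A FA; rewrite !(Ex_indicM P _ mA) => XYA.
by rewrite -(fineK (fin _ L1Y)) -(fineK (fin _ L1X)) XYA.
Qed.

Lemma is_condexp_lin a X X' Y Y' : L1 P X -> L1 P X' ->
  is_condexp P F X Y -> is_condexp P F X' Y' ->
  is_condexp P F (fun w => a * X w + X' w) (fun w => a * Y w + Y' w).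
Proof.
move=> L1X L1X' cX cX'; have [mY L1Y _] := cX; have [mY' L1Y' _] := cX'.
apply: is_condexpI.
- by apply: L1D => //; exact: L1Z.
- by apply: L1D => //; exact: L1Z.
- by apply: measurable_funD => //; exact: measurable_funM.
move=> A FA; have mA := measurable_wrt_indic (R := R) FA.
have bA : bounded_by 1 (\1_A : T -> R) by exact: bounded_by_indic.
have mAT := measurable_wrt_fun Fm mA.
have L1A Z : L1 P Z -> L1 P (fun w => \1_A w * Z w) by exact: L1_mulb.
have E Z Z' : L1 P Z -> L1 P Z' -> Ex P (fun w => \1_A w * (a * Z w + Z' w)) =
    a * Ex P (fun w => \1_A w * Z w) + Ex P (fun w => \1_A w * Z' w).
  move=> LZ LZ'; rewrite -ExZ ?L1A// -ExD ?L1A//; last by apply: L1Z; exact: L1A.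
  by apply: eq_Ex => w; ring.
by rewrite !E// (condexp_pull sF Fm L1X cX mA bA) (condexp_pull sF Fm L1X' cX' mA bA).
Qed.

Lemma is_condexp_sum (I : Type) (r : seq I) (a : I -> R) (X Y : I -> T -> R) :
  (forall i, L1 P (X i)) -> (forall i, is_condexp P F (X i) (Y i)) ->
  is_condexp P F (fun w => \sum_(i <- r) a i * X i w) (fun w => \sum_(i <- r) a i * Y i w).
Proof.
move=> L1X cX; elim: r => [|i r IH].
  under eq_fun do rewrite big_nil; under [X in is_condexp _ _ _ X]eq_fun do rewrite big_nil.
  by apply: is_condexp_self; [exact: measurable_cst|exact: (L1_cst P 0)].
under eq_fun do rewrite big_cons; under [X in is_condexp _ _ _ X]eq_fun do rewrite big_cons.
apply: is_condexp_lin => //; apply: L1_sum => j _; exact: L1Z.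
Qed.

(** The means of X over the events of G are means of its projection on F, which
    vanishes. *)
Lemma is_condexp_tower G X Y : sigma_algebra setT G -> G `<=` F -> L1 P X ->
  is_condexp P F X Y -> {ae P, forall w, Y w = 0} -> 
  {ae P, forall w, condexp P G X w = 0}.
Proof.
move=> sG GF L1X [mY L1Y XY] Y0.
have Gm : G `<=` measurable by exact: subset_trans GF Fm.
have cG := condexpP Gm L1X; have [mZ L1Z ZX] := cG.
apply: (condexp_uniq0 sG Gm) => // A GA; rewrite ZX// -XY; last exact: GF.
have mA := Gm _ GA.
rewrite (ae_eq_integral (cst 0%E)) ?integral0//.
- by apply/measurable_EFinP/measurable_funTS; exact: (L1_meas L1Y).
- by apply: filterS Y0 => w -> .
Qed.

End conditional_expectation_algebra.

Section horizon_facts.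
Variables (N : nat) (p : nat -> nat) (s : nat).

(** The horizon is by construction at least the lag of the entry it points to. *)
Lemma lag_horizon k : (s <= k)%N ->
  (lag N p (k + horizon N p s k) <= horizon N p s k)%N.
Proof.
move=> sk; rewrite /horizon subSn//= subnKC// /next_horizon.
by case: ex_minnP => q /andP[_ ->].
Qed.

End horizon_facts.

Lemma sum_shift {V : zmodType} (N s : nat) (g : nat -> V) : (0 < s <= N)%N ->
  \sum_(s <= k < N.+1) g k = \sum_(j < N) (if (s <= j.+1)%N then g j.+1 else 0).
Proof.
move=> /andP[s0 sN]; transitivity (\sum_(1 <= k < N.+1) (if (s <= k)%N then g k else 0)).
  rewrite [RHS](big_cat_nat _ (n := s))//=; last exact: leqW.
  rewrite [X in _ = X + _]big_nat_cond [X in _ = X + _]big1 ?add0r.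
    by apply: eq_big_nat => k /andP[-> _].
  by move=> k /andP[/andP[_ ks] _]; rewrite leqNgt ks.
by rewrite big_add1/= big_mkord.
Qed.

Section square_integrability.
Context {disp : measure_display} {T : measurableType disp} {R : realType}.
Variable P : probability T R.
Implicit Types (f g : T -> R).

Definition L2 f := measurable_fun setT f /\ L1 P (fun w => f w ^+ 2).

Lemma L2_mul f g : L2 f -> L2 g -> L1 P (fun w => f w * g w).
Proof.
move=> [mf f2] [mg g2]; apply: (@L1_le _ _ _ _ _ (fun w => f w ^+ 2 + g w ^+ 2)).
- exact: measurable_funM.
- exact: L1D.
- move=> w; rewrite normrM -(real_normK (num_real (f w))) -(real_normK (num_real (g w))).
  have := normr_ge0 (f w); have := normr_ge0 (g w); nra.
Qed.

Lemma L2_cst c : L2 (cst c).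
Proof. by split; [exact: measurable_cst|exact: (L1_cst P (c ^+ 2))]. Qed.

Lemma L2_L1 f : L2 f -> L1 P f.
Proof.
by move=> f2; have := L2_mul (L2_cst 1) f2; under eq_fun do rewrite /cst mul1r.
Qed.

Lemma L2_lin a f g : L2 f -> L2 g -> L2 (fun w => a * f w + g w).
Proof.
move=> f2 g2; split.
  by apply: measurable_funD; [apply: measurable_funM => //; case: f2|case: g2].
rewrite (_ : (fun w => _) = fun w => a ^+ 2 * f w ^+ 2 + (2 * a * (f w * g w) + g w ^+ 2)).
  apply: L1D; first by apply: L1Z; case: f2.
  by apply: L1D; [apply: L1Z; exact: L2_mul|case: g2].
by apply/funext => w; ring.
Qed.

Lemma L2_sum (I : Type) (r : seq I) (a : I -> R) (f : I -> T -> R) :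
  (forall i, L2 (f i)) -> L2 (fun w => \sum_(i <- r) a i * f i w).
Proof.
move=> f2; elim: r => [|i r IH]; first by under eq_fun do rewrite big_nil; exact: L2_cst.
by under eq_fun do rewrite big_cons; exact: L2_lin.
Qed.

End square_integrability.

Lemma measurable_sum_nat {disp : measure_display} {T : measurableType disp} {R : realType}
    (m n : nat) (h : nat -> T -> R) :
  (forall k, (m <= k < n)%N -> measurable_fun setT (h k)) ->
  measurable_fun setT (fun w => \sum_(m <= k < n) h k w).
Proof.
move=> mh; rewrite (_ : (fun w => _) = fun w =>
    \sum_(m <= k < n) (if (m <= k < n)%N then h k else cst 0) w).
  by apply: measurable_sum => k; case: ifP => // /mh.
by apply/funext => w; apply: eq_big_nat => k ->.
Qed.

Lemma ae_range {disp : measure_display} {T : measurableType disp} {R : realType}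
    (P : probability T R) (m n : nat) (A : nat -> T -> Prop) :
  (forall k, (m <= k <= n)%N -> {ae P, forall w, A k w}) ->
  {ae P, forall w k, (m <= k <= n)%N -> A k w}.
Proof.
move=> Ak; apply/ae_foralln => k.
have [kb|kb] := boolP (m <= k <= n)%N; last by apply: aeW => w.
by apply: filterS (Ak k kb) => w.
Qed.

(** A bound for the Euclidean norm of the projection direction u, with 1 added to
    make it positive. *)
Definition dot_bound {R : realType} {d : nat} (u : 'cV[R]_d) : R := 1 + \sum_i `|u i 0|.

Lemma dot_bound_gt0 {R : realType} {d : nat} (u : 'cV[R]_d) : 0 < dot_bound u.
Proof. by rewrite ltr_wpDr// sumr_ge0. Qed.

Section array_row.
Context {disp : measure_display} {T : measurableType disp} {R : realType}
  {d : nat}.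
Variables (P : probability T R) (kn sn : nat -> nat)
  (F : nat -> nat -> set (set T)) (p : nat -> nat -> nat)
  (X : nat -> nat -> T -> 'cV[R]_d) (n : nat).
Hypothesis n_gt0 : (0 < n)%N.
Hypothesis F_filt : filtration (kn n) (F n).
Hypothesis sn_bd : (1 <= sn n <= kn n)%N.
Hypothesis X_lmd : lag_martingale_difference P kn sn F p X.
Hypothesis X_L2 : square_integrable P kn sn X.

Local Notation q := (qh kn sn p n).
Let Xe j i (w : T) : R := Xext kn X n j w i 0.
Let E j l i : T -> R := condexp P (F n l) (Xe j i).
Local Notation Dn := (Dproj P kn sn F p X n).

Let F_sigma l : (l <= kn n)%N -> sigma_algebra setT (F n l).
Proof. by case: F_filt => + _ _; exact. Qed.

Let F_sub l : (l <= kn n)%N -> F n l `<=` measurable.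
Proof. by case: F_filt => _ + _; exact. Qed.

Let F_mono l l' : (l <= l')%N -> (l' <= kn n)%N -> F n l `<=` F n l'.
Proof. by case: F_filt => _ _; exact. Qed.

Let XeE j i : Xe j i = if (j <= kn n)%N then (fun w => X n j w i 0) else cst 0.
Proof.
by apply/funext => w; rewrite /Xe /Xext; case: leqP => // _; rewrite mxE.
Qed.

Let Xe_L1 j i : (sn n <= j)%N -> L1 P (Xe j i).
Proof.
move=> sj; rewrite XeE; case: leqP => jN; last exact: L1_cst.
have [|_ /(_ i) + _] := X_lmd n_gt0 (k := j); first by rewrite sj.
by move=> /Lfun1_integrable.
Qed.

Let Xe_L2 j i : (sn n <= j)%N -> L2 P (Xe j i).
Proof.
move=> sj; split; first exact: (L1_meas (Xe_L1 i sj)).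
rewrite XeE; case: leqP => jN; last by under eq_fun do rewrite /cst expr0n; exact: L1_cst.
by apply: Lfun2_integrable_sqr; apply: X_L2 => //; rewrite sj.
Qed.

Let E_condexp j l i : (sn n <= j)%N -> (l <= kn n)%N ->
  is_condexp P (F n l) (Xe j i) (E j l i).
Proof. by move=> sj lN; apply: condexpP; [exact: F_sub|exact: Xe_L1]. Qed.

Let E_L2 j l i : (sn n <= j)%N -> (l <= kn n)%N -> L2 P (E j l i).
Proof.
move=> sj lN; have cE := E_condexp i sj lN; have [mE L1E _] := cE.
split; first exact: (L1_meas L1E).
by apply: (condexp_L2 (F_sigma lN) (F_sub lN) (Xe_L1 i sj) _ cE); case: (Xe_L2 i sj).
Qed.

Let projE j l i w : Defs.proj P kn F X n j l w i 0 = E j l i w.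
Proof. by rewrite mxE. Qed.

Let DkE k i w : Dn k w i 0 =
  \sum_(0 <= r < (q k).+1) (E (k + r) k i w - E (k + r) (k - 1) i w).
Proof.
rewrite /Dproj summxE; apply: eq_bigr => r _.
by rewrite mxE [in X in _ + X]mxE !projE.
Qed.

Let row_bound k : (sn n <= k <= kn n)%N ->
  [/\ forall r, (sn n <= k + r)%N, (k <= kn n)%N, (k - 1 <= kn n)%N & (0 < k)%N].
Proof.
move=> /andP[sk kN]; have /andP[s0 _] := sn_bd; split => //.
- by move=> r; rewrite (leq_trans sk)// leq_addr.
- exact: leq_trans (leq_subr _ _) kN.
- exact: leq_trans s0 sk.
Qed.

Lemma Dproj_meas k i : (sn n <= k <= kn n)%N -> measurable_wrt (F n k) (fun w => Dn k w i 0).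
Proof.
move=> kb; have [sr kN k1N k0] := row_bound kb.
under eq_fun do rewrite DkE.
apply: measurable_sum => r; apply: measurable_funB.
  by have [+ _ _] := E_condexp i (sr r) kN.
have [+ _ _] := E_condexp i (sr r) k1N.
by apply: measurable_wrtS; apply: F_mono => //; exact: leq_subr.
Qed.

Lemma Dproj_L2 k i : (sn n <= k <= kn n)%N -> L2 P (fun w => Dn k w i 0).
Proof.
move=> kb; have [sr kN k1N k0] := row_bound kb.
under eq_fun do rewrite DkE.
have := L2_sum (index_iota 0 (q k).+1) (fun=> 1) (fun r => L2_lin (-1) (E_L2 i (sr r) k1N) (E_L2 i (sr r) kN)).
by congr L2; apply/funext => w; apply: eq_bigr => r _; rewrite mul1r mulN1r addrC.
Qed.

Lemma Dproj_mart k i : (sn n <= k <= kn n)%N -> forall K h,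
  measurable_wrt (F n (k - 1)) h -> bounded_by K h -> Ex P (fun w => h w * Dn k w i 0) = 0.
Proof.
move=> kb K h mh hK; have [sr kN k1N k0] := row_bound kb.
have mhk : measurable_wrt (F n k) h.
  by apply: measurable_wrtS mh; apply: F_mono => //; exact: leq_subr.
have mhT := measurable_wrt_fun (F_sub kN) mhk.
have L1hE j l : (sn n <= j)%N -> (l <= kn n)%N -> L1 P (fun w => h w * E j l i w).
  by move=> sj lN; apply: (L1_mulb mhT hK); exact: L2_L1 (E_L2 i sj lN).
have -> : Ex P (fun w => h w * Dn k w i 0) =
    \sum_(0 <= r < (q k).+1) Ex P (fun w => h w * E (k + r) k i w - h w * E (k + r) (k - 1) i w).
  rewrite -Ex_sum; last by move=> r _; apply: L1B; exact: L1hE.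
  apply: eq_Ex => w; rewrite DkE mulr_sumr; apply: eq_bigr => r _; exact: mulrBr.
rewrite big1// => r _; rewrite ExB ?L1hE//.
rewrite -(condexp_pull (F_sigma kN) (F_sub kN) (Xe_L1 i (sr r)) (E_condexp i (sr r) kN) mhk hK).
rewrite -(condexp_pull (F_sigma k1N) (F_sub k1N) (Xe_L1 i (sr r)) (E_condexp i (sr r) k1N) mh hK).
by rewrite subrr.
Qed.

Let E_adapted k i : (sn n <= k <= kn n)%N -> {ae P, forall w, E k k i w = X n k w i 0}.
Proof.
move=> kb; have [sr kN k1N k0] := row_bound kb; have sk : (sn n <= k)%N by case/andP: kb.
have XeX : Xe k i = fun w => X n k w i 0 by rewrite XeE kN.
have mX : measurable_wrt (F n k) (Xe k i) by rewrite XeX; have [+ _ _] := X_lmd n_gt0 kb; exact.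
have := is_condexp_uniq (F_sigma kN) (F_sub kN) (E_condexp i sk kN)
  (is_condexp_self mX (Xe_L1 i sk)).
by apply: filterS => w ->; rewrite XeX.
Qed.

(** Since q k is at least the lag of the entry at time j = k + q k, the past at
    time k - 1 is contained in the past given which that entry is centred.
    Beyond the end of the row the entry itself is 0. *)
Let E_horizon k i : (sn n <= k <= kn n)%N ->
  {ae P, forall w, E (k + q k) (k - 1) i w = 0}.
Proof.
move=> kb; have [sr kN k1N k0] := row_bound kb; have sk : (sn n <= k)%N by case/andP: kb.
have := lag_horizon (kn n) (p n) sk; rewrite -/(qh kn sn p n k) /lag.
have [jN plq|jN _] := leqP (k + q k) (kn n); last first.
  have cE := E_condexp i (sr (q k)) k1N.
  have Xe0 : Xe (k + q k) i = cst 0 by rewrite XeE leqNgt jN.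
  have c0 : is_condexp P (F n (k - 1)) (Xe (k + q k) i) (cst 0).
    by rewrite Xe0; apply: is_condexp_self; [exact: measurable_cst|exact: (L1_cst P 0)].
  exact: (is_condexp_uniq (F_sigma k1N) (F_sub k1N) cE c0).
set j := (k + q k)%N; have jb : (sn n <= j <= kn n)%N by rewrite sr.
have lN : (j - p n j - 1 <= kn n)%N by rewrite -subnDA (leq_trans (leq_subr _ _)).
have kl : (k - 1 <= j - p n j - 1)%N.
  have pj : (p n j + k <= j)%N by rewrite [j in (_ <= j)%N]addnC leq_add2r.
  by apply: leq_sub2r; have := leq_sub2r (p n j) pj; rewrite addnC addnK.
have cX := condexpP (F_sub lN) (Xe_L1 i (sr (q k))).
apply: (is_condexp_tower (F_sub lN) (F_sigma k1N) _ (Xe_L1 i (sr (q k))) cX).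
  exact: F_mono.
have [_ _] := X_lmd n_gt0 jb; apply: filterS => w /matrixP/(_ i 0).
by rewrite !mxE XeE jN.
Qed.

(** At every time k, D + U - W telescopes to E k k - E (k + q k) (k - 1), that is
    to X k by [E_horizon]. *)
Lemma Xbar_decomposition i :
  {ae P, forall w, Xbar kn sn X n w i 0 =
     \sum_(sn n <= k < (kn n).+1) Dn k w i 0 + Rrem P kn sn F p X n w i 0}.
Proof.
have : {ae P, forall w k, (sn n <= k <= kn n)%N ->
    E k k i w = X n k w i 0 /\ E (k + q k) (k - 1) i w = 0}.
  by apply: ae_range => k kb; apply: filterS2 (E_adapted i kb) (E_horizon i kb) => w.
apply: filterS => w Ew; rewrite /Xbar /Rrem !summxE -big_split/=.
rewrite big_nat_cond [RHS]big_nat_cond; apply: eq_bigr => k /andP[/andP[sk kN] _].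
rewrite ltnS in kN; have [|E1 E2] := Ew k; first by rewrite sk.
rewrite -E1 mxE [in X in _ + (_ + X)]mxE DkE /Urem /Wrem !summxE.
have UE : \sum_(0 <= r < q k) (Defs.proj P kn F X n (k + r) (k - 1) w) i 0 =
   \sum_(0 <= r < (q k).+1) E (k + r) (k - 1) i w.
  by rewrite big_nat_recr//= E2 addr0; apply: eq_bigr => r _; rewrite projE.
have WE : E k k i w + \sum_(1 <= r < (q k).+1) (Defs.proj P kn F X n (k + r) k w) i 0 =
   \sum_(0 <= r < (q k).+1) E (k + r) k i w.
  by rewrite [RHS]big_ltn// addn0; congr (_ + _); apply: eq_bigr => r _; rewrite projE.
by rewrite UE sumrB -WE; ring.
Qed.


Lemma Xbar_meas i : measurable_fun setT (fun w => Xbar kn sn X n w i 0).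
Proof.
under eq_fun do rewrite summxE; apply: measurable_sum_nat => k; rewrite ltnS => kb.
have [sr kN k1N k0] := row_bound kb.
have [/(_ i 0) + _ _] := X_lmd n_gt0 kb; exact: measurable_wrt_fun (F_sub kN).
Qed.

Lemma Rrem_meas i : measurable_fun setT (fun w => Rrem P kn sn F p X n w i 0).
Proof.
have mE j l : (sn n <= j)%N -> (l <= kn n)%N ->
    measurable_fun setT (fun w => Defs.proj P kn F X n j l w i 0).
  move=> sj lN; under eq_fun do rewrite projE.
  by have [+ _ _] := E_condexp i sj lN; exact: measurable_wrt_fun (F_sub lN).
under eq_fun do rewrite summxE; apply: measurable_sum_nat => k; rewrite ltnS => kb.
have [sr kN k1N k0] := row_bound kb.
under eq_fun do rewrite mxE [in X in _ + X]mxE !summxE.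
by apply: measurable_funB; apply: measurable_sum => r; exact: mE.
Qed.

Lemma qfE (Q : 'M[R]_d) u : qf Q u u = \sum_a \sum_b u a 0 * u b 0 * Q a b.
Proof.
rewrite /qf mxE exchange_big/=; apply: eq_bigr => b _; rewrite mxE mulr_suml.
by apply: eq_bigr => a _; rewrite mxE; ring.
Qed.

(** A version of the conditional expectation which is nonnegative everywhere and
    not just almost surely, as the stopping argument requires. *)
Lemma condexp_max0 (G : set (set T)) (Y Y' : T -> R) : sigma_algebra setT G ->
  G `<=` measurable -> L1 P Y -> (forall w, 0 <= Y w) -> is_condexp P G Y Y' ->
  [/\ measurable_wrt G (fun w => Num.max 0 (Y' w)), L1 P (fun w => Num.max 0 (Y' w)),
      {ae P, forall w, Num.max 0 (Y' w) = Y' w} &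
      forall K h, measurable_wrt G h -> bounded_by K h ->
        Ex P (fun w => h w * Y w) = Ex P (fun w => h w * Num.max 0 (Y' w))].
Proof.
move=> sG Gm L1Y Y0 cY; have [mY' L1Y' _] := cY.
have mM : measurable_wrt G (fun w => Num.max 0 (Y' w)) by exact: measurable_maxr.
have aeM : {ae P, forall w, Num.max 0 (Y' w) = Y' w}.
  by apply: filterS (condexp_ge0 sG Gm L1Y cY Y0) => w /max_r.
have mMT := measurable_wrt_fun Gm mM.
have L1M : L1 P (fun w => Num.max 0 (Y' w)).
  apply: (@L1_le _ _ _ _ _ (fun w => `|Y' w|)) => //; first exact: L1_norm.
  by move=> w; have [y0|y0] := leP 0 (Y' w); rewrite ?normr0.
split => // K h mh hK; have mhT := measurable_wrt_fun Gm mh.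
rewrite (condexp_pull sG Gm L1Y cY mh hK); apply: eq_Ex_ae.
- by apply: measurable_funM => //; exact: L1_meas L1Y'.
- exact: measurable_funM.
- by apply: filterS aeM => w ->.
Qed.

Variable u : 'cV[R]_d.
Local Notation c := (dot_bound u).

Let c_gt0 : 0 < c. Proof. exact: dot_bound_gt0. Qed.

Definition proj_diff k w : R := \sum_i u i 0 * Dn k w i 0.

Definition cond_var k w : R :=
  Num.max 0 (qf (condexp_mx P (F n (k - 1)) (fun w' => Dn k w' *m (Dn k w')^T) w) u u).

(** The Lindeberg mass of the vector dominates the one of its projection:
    |u . D| <= c |D|, so |u . D| >= e forces |D| >= e / c. *)
Definition cond_tail e k w : R := c ^+ 2 * Num.max 0 (condexp P (F n (k - 1))
  (fun w' => enorm (Dn k w') ^+ 2 * \1_[set w'' | e / c <= enorm (Dn k w'')] w') w).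

Lemma enormE (x : 'cV[R]_d) : enorm x ^+ 2 = \sum_i x i 0 ^+ 2.
Proof. by rewrite sqr_sqrtr// sumr_ge0// => i _; exact: sqr_ge0. Qed.

Lemma enorm_ge0 (x : 'cV[R]_d) : 0 <= enorm x.
Proof. exact: sqrtr_ge0. Qed.

Lemma proj_diff_le k w : `|proj_diff k w| <= c * enorm (Dn k w).
Proof.
apply: (@le_trans _ _ (\sum_i `|u i 0| * enorm (Dn k w))).
  rewrite (le_trans (ler_norm_sum _ _ _))// ler_sum// => i _.
  rewrite normrM ler_wpM2l// -(@ler_pXn2r _ 2) ?nnegrE ?enorm_ge0//.
  rewrite enormE real_normK ?num_real// (bigD1 i)//= lerDl.
  by apply: sumr_ge0 => j _; exact: sqr_ge0.
by rewrite -mulr_suml ler_wpM2r ?enorm_ge0// lerDr.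
Qed.

Section in_range.
Variable k : nat.
Hypothesis kb : (sn n <= k <= kn n)%N.

Let k_le : (k <= kn n)%N. Proof. by case/andP: kb. Qed.
Let k1_le : (k - 1 <= kn n)%N. Proof. exact: leq_trans (leq_subr _ _) k_le. Qed.

Lemma proj_diff_meas : measurable_wrt (F n k) (proj_diff k).
Proof.
by apply: measurable_sum => i; apply: measurable_funM => //; exact: Dproj_meas.
Qed.

Lemma proj_diff_L2 : L2 P (proj_diff k).
Proof. by apply: (L2_sum _ (fun i => u i 0)) => i; exact: Dproj_L2. Qed.

Lemma proj_diff_mart K h : measurable_wrt (F n (k - 1)) h -> bounded_by K h ->
  Ex P (fun w => h w * proj_diff k w) = 0.
Proof.
move=> mh hK; have mhT := measurable_wrt_fun (F_sub k1_le) mh.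
have -> : Ex P (fun w => h w * proj_diff k w) = \sum_i u i 0 * Ex P (fun w => h w * Dn k w i 0).
  have L1hD i : L1 P (fun w => h w * Dn k w i 0).
    by apply: (L1_mulb mhT hK); exact: L2_L1 (Dproj_L2 i kb).
  under eq_bigr do rewrite -ExZ//.
  rewrite -Ex_sum; last by move=> i _; exact: L1Z.
  by apply: eq_Ex => w; rewrite mulr_sumr; apply: eq_bigr => i _; ring.
by rewrite big1// => i _; rewrite (Dproj_mart i kb mh hK) mulr0.
Qed.

Let proj_diff_sqr_condexp : is_condexp P (F n (k - 1)) (fun w => proj_diff k w ^+ 2)
  (fun w => qf (condexp_mx P (F n (k - 1)) (fun w' => Dn k w' *m (Dn k w')^T) w) u u).
Proof.
have outerE a b w : (Dn k w *m (Dn k w)^T) a b = Dn k w a 0 * Dn k w b 0.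
  by rewrite mxE big_ord1 mxE.
have L1ab a b : L1 P (fun w => (Dn k w *m (Dn k w)^T) a b).
  by under eq_fun do rewrite outerE; apply: L2_mul; exact: Dproj_L2.
have := is_condexp_sum (F_sigma k1_le) (F_sub k1_le) (index_enum ('I_d * 'I_d)%type)
  (fun ab => u ab.1 0 * u ab.2 0) (fun ab => L1ab ab.1 ab.2)
  (fun ab => condexpP (F_sub k1_le) (L1ab ab.1 ab.2)).
congr is_condexp; apply/funext => w.
  rewrite /proj_diff expr2 big_distrlr/= pair_bigA/=; apply: eq_bigr => ab _.
  by rewrite outerE; ring.
rewrite qfE pair_bigA/=; apply: eq_bigr => ab _.
by rewrite mxE.
Qed.

Lemma cond_varP :
  [/\ measurable_wrt (F n (k - 1)) (cond_var k), L1 P (cond_var k),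
      {ae P, forall w, cond_var k w =
         qf (condexp_mx P (F n (k - 1)) (fun w' => Dn k w' *m (Dn k w')^T) w) u u} &
      forall K h, measurable_wrt (F n (k - 1)) h -> bounded_by K h ->
        Ex P (fun w => h w * proj_diff k w ^+ 2) = Ex P (fun w => h w * cond_var k w)].
Proof.
apply: condexp_max0 => //; [exact: F_sigma|exact: F_sub|by case: proj_diff_L2|].
by move=> w; exact: sqr_ge0.
Qed.

Let enorm_meas : measurable_fun setT (fun w => enorm (Dn k w)).
Proof.
apply: measurable_sqrt_comp; first by move=> w; apply: sumr_ge0 => i _; exact: sqr_ge0.
apply: measurable_sum => i; apply: measurable_funX.
exact: measurable_wrt_fun (F_sub k_le) (Dproj_meas i kb).
Qed.

Lemma tail_L1 r : L1 P (fun w' => enorm (Dn k w') ^+ 2 *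
  \1_[set w'' | r <= enorm (Dn k w'')] w').
Proof.
under eq_fun do rewrite mulrC; apply: (@L1_mulb _ _ _ _ 1).
- by apply: measurable_indic; exact: measurable_ge.
- exact: bounded_by_indic.
- under eq_fun do rewrite enormE.
  by apply: L1_sum => i _; case: (Dproj_L2 i kb).
Qed.

Lemma cond_tailP e : 0 < e ->
  [/\ measurable_wrt (F n (k - 1)) (cond_tail e k), L1 P (cond_tail e k),
      {ae P, forall w, cond_tail e k w = c ^+ 2 * condexp P (F n (k - 1))
        (fun w' => enorm (Dn k w') ^+ 2 * \1_[set w'' | e / c <= enorm (Dn k w'')] w') w} &
      forall K h, measurable_wrt (F n (k - 1)) h -> bounded_by K h -> (forall w, 0 <= h w) ->
        Ex P (fun w => h w * (proj_diff k w ^+ 2 * (e <= `|proj_diff k w|)%R%:R)) <=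
        Ex P (fun w => h w * cond_tail e k w)].
Proof.
move=> e0; have L1t := tail_L1 (e / c).
have t0 w : 0 <= enorm (Dn k w) ^+ 2 * \1_[set w'' | e / c <= enorm (Dn k w'')] w.
  by rewrite mulr_ge0 ?sqr_ge0// indicE.
have [mM L1M aeM EM] := condexp_max0 (F_sigma k1_le) (F_sub k1_le) L1t t0
  (condexpP (F_sub k1_le) L1t).
split.
- exact: measurable_funM.
- exact: L1Z.
- by apply: filterS aeM => w; rewrite /cond_tail => ->.
move=> K h mh hK h0; have mhT := measurable_wrt_fun (F_sub k1_le) mh.
have L1hM := L1_mulb mhT hK L1M; have L1ht := L1_mulb mhT hK L1t.
have -> : Ex P (fun w => h w * cond_tail e k w) = c ^+ 2 * Ex P (fun w => h w *
    (enorm (Dn k w) ^+ 2 * \1_[set w'' | e / c <= enorm (Dn k w'')] w)).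
  rewrite (EM K h mh hK) -ExZ//; apply: eq_Ex => w; rewrite /cond_tail; ring.
rewrite -ExZ//; apply: Ex_le; last first.
- move=> w; rewrite [leRHS]mulrCA ler_wpM2l// indicE mulrA -exprMn.
  have cD : 0 <= c * enorm (Dn k w) by rewrite mulr_ge0 ?enorm_ge0 ?ltW.
  have dc := proj_diff_le k w.
  have [ed|_] := leP e `|proj_diff k w|; last by rewrite mulr0 mulr_ge0// sqr_ge0.
  rewrite mulr1 mem_set/=; last by rewrite ler_pdivrMr// mulrC (le_trans ed).
  by rewrite mulr1 -real_normK ?num_real// ler_pXn2r ?nnegrE.
- exact: L1Z.
- apply: (L1_mulb mhT hK); have [mD L1D2] := proj_diff_L2.
  under eq_fun do rewrite mulrC; apply: (@L1_mulb _ _ _ _ 1) => //; last first.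
    by move=> w; rewrite normr_nat; case: (e <= _).
  rewrite (_ : (fun w => _) = \1_[set w | e <= `|proj_diff k w|]); last first.
    apply/funext => w; rewrite indicE; have [ed|ed] := boolP (e <= `|proj_diff k w|).
      by rewrite mem_set.
    by rewrite memNset//=; exact/negP.
  by apply: measurable_indic; apply: measurable_ge; exact: measurableT_comp.
Qed.

End in_range.


Lemma condcov_meas a b :
  measurable_fun setT (fun w => condcov_sum P kn sn F p X n w a b).
Proof.
under eq_fun do rewrite summxE; apply: measurable_sum_nat => k; rewrite ltnS => kb.
have [sr kN k1N k0] := row_bound kb; under eq_fun do rewrite mxE.
have L1ab : L1 P (fun w => (Dn k w *m (Dn k w)^T) a b).
  under eq_fun do rewrite mxE big_ord1 mxE.
  by apply: L2_mul; exact: Dproj_L2.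
by have [+ _ _] := condexpP (F_sub k1N) L1ab; exact: measurable_wrt_fun (F_sub k1N).
Qed.

Lemma lindeberg_meas r : measurable_fun setT (lindeberg_sum P kn sn F p X r n).
Proof.
apply: measurable_sum_nat => k; rewrite ltnS => kb.
have [sr kN k1N k0] := row_bound kb.
have [+ _ _] := condexpP (F_sub k1N) (tail_L1 kb r); exact: measurable_wrt_fun (F_sub k1N).
Qed.

Lemma sum_cond_var : {ae P, forall w,
  \sum_(sn n <= k < (kn n).+1) cond_var k w = qf (condcov_sum P kn sn F p X n w) u u}.
Proof.
have := ae_range (fun k kb => let: And4 _ _ aev _ := cond_varP kb in aev).
apply: filterS => w ew; rewrite qfE.
under [RHS]eq_bigr do under eq_bigr do rewrite summxE mulr_sumr.
under [RHS]eq_bigr do rewrite exchange_big/=.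
rewrite [RHS]exchange_big/=; apply: eq_big_nat => k; rewrite ltnS => kb.
by rewrite ew// qfE.
Qed.

Lemma sum_cond_tail e : 0 < e -> {ae P, forall w,
  \sum_(sn n <= k < (kn n).+1) cond_tail e k w =
  c ^+ 2 * lindeberg_sum P kn sn F p X (e / c) n w}.
Proof.
move=> e0; have := ae_range (fun k kb => let: And4 _ _ aev _ := cond_tailP kb e0 in aev).
apply: filterS => w ew; rewrite mulr_sumr; apply: eq_big_nat => k; rewrite ltnS => kb.
by rewrite ew.
Qed.

End array_row.

(** * Convergence in probability and assembly of the proof *)

Section matrix_norm.
Context {R : realType} {m n : nat}.

Lemma mx_entry_le (A : 'M[R]_(m, n)) i j : `|A i j| <= `|A|.
Proof.
rewrite [leRHS](_ : _ = mx_norm A)// mx_normrE.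
exact: (le_bigmax 0 (fun ij : 'I_m * 'I_n => `|A ij.1 ij.2|) (i, j)).
Qed.

Lemma measurable_mx_norm {disp : measure_display} {T : measurableType disp}
    (M : T -> 'M[R]_(m, n)) :
  (forall i j, measurable_fun setT (fun w => M w i j)) ->
  measurable_fun setT (fun w => `|M w|).
Proof.
move=> mM; rewrite (_ : (fun w => _) = fun w =>
    \big[Num.max/0]_(ij : 'I_m * 'I_n) `|M w ij.1 ij.2|); last first.
  by apply/funext => w; rewrite -mx_normrE.
elim: (index_enum _) => [|ij r IH].
  by under eq_fun do rewrite big_nil; exact: measurable_cst.
under eq_fun do rewrite big_cons.
by apply: measurable_maxr => //; exact: measurableT_comp.
Qed.

End matrix_norm.

Lemma qf_norm_le {R : realType} {d : nat} (Q : 'M[R]_d) (u : 'cV[R]_d) :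
  `|qf Q u u| <= (\sum_a \sum_b `|u a 0 * u b 0|) * `|Q|.
Proof.
rewrite qfE (le_trans (ler_norm_sum _ _ _))// mulr_suml ler_sum// => a _.
rewrite (le_trans (ler_norm_sum _ _ _))// mulr_suml ler_sum// => b _.
by rewrite normrM ler_wpM2l// mx_entry_le.
Qed.

Section in_probability.
Context {disp : measure_display} {T : measurableType disp} {R : realType}.
Variable P : probability T R.
Implicit Types (X S : nat -> T -> R).

Definition vanishes X := forall rho dl : R, 0 < rho -> 0 < dl ->
  \forall n \near \oo, fine (P [set w | rho <= `|X n w|]) <= dl.

Lemma prob_le_ae (A B : set T) : measurable A -> measurable B ->
  {ae P, forall w, A w -> B w} -> fine (P A) <= fine (P B).
Proof.
move=> mA mB AB; rewrite -!Ex_indic//.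
apply: (@le_trans _ _ (Ex P (\1_(A `&` B)))); last first.
  apply: Ex_le; [by apply: L1_indic; exact: measurableI|exact: L1_indic|].
  move=> w; rewrite !indicE ler_nat; have [|//] := boolP (w \in A `&` B).
  by rewrite in_setI => /andP[_ ->].
have mAB : measurable (A `&` B) by exact: measurableI.
rewrite (@eq_Ex_ae _ _ _ _ _ (\1_(A `&` B)))//.
apply: filterS AB => w AB; rewrite !indicE in_setI.
by have [|//] := boolP (w \in A); rewrite inE => /AB Bw; rewrite mem_set.
Qed.

(** Only an almost sure domination is asked for, because conditional expectations
    and the decomposition of the sum hold almost surely. *)
Lemma vanishes_dominated (V : normedModType R) (Y_ : nat -> T -> V) (Y : T -> V) X (c : R) :
  0 < c -> cvg_in_probability P Y_ Y ->
  (forall n, (0 < n)%N -> measurable_fun setT (X n)) ->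
  (forall n, (0 < n)%N -> measurable_fun setT (fun w => `|Y_ n w - Y w|)) ->
  (forall n, (0 < n)%N -> {ae P, forall w, `|X n w| <= c * `|Y_ n w - Y w|}) ->
  vanishes X.
Proof.
move=> c0 YY mX mY XY rho dl rho0 dl0.
have /fine_cvg/cvgrPdist_le/(_ _ dl0) := YY (rho / c) (divr_gt0 rho0 c0).
move=> H; near=> n.
have n0 : (0 < n)%N by near: n; exact: nbhs_infty_gt.
apply: (@le_trans _ _ (fine (P [set w | rho / c <= `|Y_ n w - Y w|]))).
  apply: prob_le_ae.
  - by apply: measurable_ge; apply: measurableT_comp => //; exact: mX.
  - by apply: measurable_ge; exact: mY.
  - apply: filterS (XY n n0) => w h /= h'.
    by rewrite ler_pdivrMr// mulrC (le_trans h').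
have : `|0 - fine (P [set w | rho / c <= `|Y_ n w - Y w|])| <= dl by near: n.
by rewrite sub0r normrN; apply: le_trans; exact: ler_norm.
Unshelve. all: by end_near. Qed.

(** The cosine is 1-Lipschitz, and bounded on the event where the two sequences are
    not close. *)
Lemma cos_slutsky S X (eta : T -> R) K th (l : R) :
  measurable_fun setT eta -> bounded_by K eta ->
  (forall n, (0 < n)%N -> measurable_fun setT (S n)) ->
  (forall n, (0 < n)%N -> measurable_fun setT (X n)) ->
  vanishes (fun n w => X n w - S n w) ->
  Ex P (fun w => eta w * cos (S n w + th)) @[n --> \oo] --> l ->
  Ex P (fun w => eta w * cos (X n w + th)) @[n --> \oo] --> l.
Proof.
move=> meta etaK mS mX van cvS.
have K0 : 0 <= K by exact: le_trans (etaK point).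
apply/cvgrPdist_le => e e0.
pose kap := e / (1 + 3 * K); have B0 : 0 < 1 + 3 * K by rewrite ltr_pwDl// mulr_ge0.
have kap0 : 0 < kap by rewrite divr_gt0.
have /cvgrPdist_le/(_ _ kap0) cvS' := cvS.
near=> n.
have n0 : (0 < n)%N by near: n; exact: nbhs_infty_gt.
have h1 : `|l - Ex P (fun w => eta w * cos (S n w + th))| <= kap by near: n.
have h2 : fine (P [set w | kap <= `|X n w - S n w|]) <= kap.
  by near: n; exact: van.
have L1c (Y : T -> R) : measurable_fun setT Y -> L1 P (fun w => eta w * cos (Y w + th)).
  move=> mY; apply: (@L1_bounded _ _ _ _ K).
    apply: measurable_funM => //; apply: measurable_cos_comp.
    exact: measurable_funD.
  by move=> w; rewrite normrM -[K]mulr1 ler_pM// cos_max.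
pose B := [set w | kap <= `|X n w - S n w|].
have mB : measurable B.
  by apply: measurable_ge; apply: measurableT_comp => //; apply: measurable_funB; [exact: mX|exact: mS].
have h3 : `|Ex P (fun w => eta w * cos (S n w + th)) - Ex P (fun w => eta w * cos (X n w + th))|
    <= K * kap + 2 * K * kap.
  rewrite -ExB; [|by apply: L1c; exact: mS|by apply: L1c; exact: mX].
  apply: (@le_trans _ _ (Ex P (fun w => K * kap + 2 * K * \1_B w))).
    apply: Ex_norm_le; [by apply: L1B; apply: L1c; [exact: mS|exact: mX]| |].
      by apply: L1D; [exact: L1_cst|apply: L1Z; exact: L1_indic].
    move=> w; rewrite -mulrBr normrM.
    have [Bw|Bw] := pselect (B w).
      have Kk : 0 <= K * kap by apply: mulr_ge0 => //; exact: ltW.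
      rewrite indicE mem_set// mulr1 ler_wpDl//.
      have c2 : `|cos (S n w + th) - cos (X n w + th)| <= 2.
        by rewrite (le_trans (ler_normB _ _))// -[2]/(1 + 1) lerD// cos_max.
      by rewrite [leRHS]mulrC ler_pM//; exact: etaK.
    have ck : `|cos (S n w + th) - cos (X n w + th)| <= kap.
      have -> : S n w + th = (X n w + th) + (S n w - X n w) by ring.
      rewrite (le_trans (cosD_abs_le _ _))// distrC.
      by move: Bw => /negP; rewrite -ltNge => /ltW.
    by rewrite indicE memNset// mulr0 addr0 ler_pM//; exact: etaK.
  rewrite ExD; [|exact: L1_cst|by apply: L1Z; exact: L1_indic].
  rewrite (Ex_cst P (K * kap)) ExZ; last exact: L1_indic.
  by rewrite Ex_indic// lerD2l ler_wpM2l// mulr_ge0.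
have := ler_distD (Ex P (fun w => eta w * cos (S n w + th))) l (Ex P (fun w => eta w * cos (X n w + th))).
have -> : e = kap + (K * kap + 2 * K * kap) by rewrite /kap; field; rewrite gt_eqF.
by move=> h4; rewrite (le_trans h4)// lerD.
Unshelve. all: by end_near. Qed.

End in_probability.

Section extension_facts.
Context {R : realType} {d1 d2 : measure_display} {T : measurableType d1}
  {T' : measurableType d2}.
Variables (P : probability T R) (P' : probability T' R) (pi : T' -> T).
Hypothesis pi_ext : extension P P' pi.
Variable G : set (set T).
Hypotheses (sG : sigma_algebra setT G) (Gm : G `<=` measurable).

(** The projection of the extension maps P' to P. *)
Lemma Ex_extension K (g : T -> R) : measurable_fun setT g -> bounded_by K g ->
  Ex P' (g \o pi) = Ex P g.
Proof.
move=> mg gK; have [mpi Ppi] := pi_ext.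
have mgp : measurable_fun setT (g \o pi) by exact: measurableT_comp.
have L1gp : L1 P' (g \o pi) by apply: (@L1_bounded _ _ _ _ K) => // w; exact: gK.
rewrite /Ex /Rintegral; congr fine.
transitivity (\int[pushforward P' pi]_(x in setT) (EFin \o g) x)%E.
  rewrite (@integral_pushforward _ _ T' T R pi mpi P' setT (EFin \o g))//.
  exact/measurable_EFinP.
by apply: eq_measure_integral => A mA _; rewrite /pushforward; exact: Ppi.
Qed.

Local Notation H := (preimage_set_system setT pi G).

Lemma extension_sigma : sigma_algebra setT H.
Proof. exact: sigma_algebra_preimage. Qed.

Lemma extension_sub : H `<=` measurable.
Proof.
move=> _ [A GA <-]; have [mpi _] := pi_ext.
by apply: mpi => //; exact: Gm.
Qed.

Lemma extension_meas (f : T -> R) : measurable_wrt G f -> measurable_wrt H (f \o pi).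
Proof.
move=> mf _ B mB; apply: sub_sigma_algebra; exists (f @^-1` B) => //.
exact: measurable_wrt_preimage.
Qed.

End extension_facts.

Section packing.
Context {R : realType} {d : nat}.

(** The pair (x, v) as one row vector, on which the continuity theorem operates. *)
Definition pack (x : 'cV[R]_d) (v : R) : 'rV[R]_(d + 1) := row_mx x^T v%:M.

Definition unpack (y : 'rV[R]_(d + 1)) : 'cV[R]_d * R := ((lsubmx y)^T, rsubmx y 0 0).

Lemma packK x v : unpack (pack x v) = (x, v).
Proof. by rewrite /unpack /pack row_mxKl row_mxKr trmxK mxE eqxx mulr1n. Qed.

Lemma unpack_continuous : continuous unpack.
Proof.
have c1 : continuous (fun y : 'rV[R]_(d + 1) => (lsubmx y)^T).
  move=> y /= s /= /nbhs_ballP[e e0 es]; apply/nbhs_ballP; exists e => // y' [_ yy'].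
  by apply: es; split => // i j; rewrite !mxE; exact: yy'.
have c2 : continuous (fun y : 'rV[R]_(d + 1) => rsubmx y 0 0).
  by under eq_fun do rewrite mxE; exact: coord_continuous.
by move=> y; exact: (cvg_pair (c1 y) (c2 y)).
Qed.

Lemma dotr_pack t x v : dotr t (pack x v) =
  \sum_i (lsubmx t)^T i 0 * x i 0 + t 0 (rshift d 0) * v.
Proof.
rewrite /dotr big_split_ord/= big_ord1; congr (_ + _).
  by apply: eq_bigr => i _; rewrite row_mxEl !mxE.
by rewrite row_mxEr mxE eqxx mulr1n.
Qed.

Lemma pack_meas dO (O : measurableType dO) (x : O -> 'cV[R]_d) (y : O -> R) :
  (forall i, measurable_fun setT (fun w => x w i 0)) -> measurable_fun setT y ->
  forall i, measurable_fun setT (fun w => pack (x w) (y w) 0 i).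
Proof.
move=> mx my i; case: (split_ordP i) => j ->.
  by under eq_fun do rewrite /pack row_mxEl mxE; exact: mx.
by under eq_fun do rewrite /pack row_mxEr mxE ord1 eqxx mulr1n.
Qed.

End packing.

Section stable_limit.
Context (R : realType) (disp : measure_display) (T : measurableType disp).
Variables (P : probability T R) (d : nat) (kn sn : nat -> nat).
Variables (F : nat -> nat -> set (set T)) (p : nat -> nat -> nat).
Variable (X : nat -> nat -> T -> 'cV[R]_d).
Hypothesis kn_mono : forall m n, (0 < m)%N -> (m <= n)%N -> (kn m <= kn n)%N.
Hypothesis F_filtration : forall n, (0 < n)%N -> filtration (kn n) (F n).
Hypothesis sn_bounds : forall n, (0 < n)%N -> (1 <= sn n <= kn n)%N.
Hypothesis X_lmd : lag_martingale_difference P kn sn F p X.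
Hypothesis X_L2 : square_integrable P kn sn X.
Hypothesis lindeberg : forall e : R, 0 < e ->
  cvg_in_probability P (lindeberg_sum P kn sn F p X e) (cst (0 : R)).
Variable (Psi : T -> 'M[R]_d).
Hypothesis Psi_psd : forall w, psd (Psi w).
Hypothesis Psi_meas : measurable_mx (Ginf kn F) Psi.
Hypothesis condcov : cvg_in_probability P (condcov_sum P kn sn F p X) Psi.
Hypothesis remainder : cvg_in_probability P (Rrem P kn sn F p X) (cst 0).

Lemma Gn_sigma m : (0 < m)%N -> sigma_algebra setT (Gn kn F m).
Proof.
move=> m0.
have sF n : (m <= n)%N -> sigma_algebra setT (F n (kn m)).
  move=> mn; have [+ _ _] := F_filtration (leq_trans m0 mn); apply.
  exact: kn_mono.
split.
- by move=> n /= mn; case: (sF n mn).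
- by move=> A GA n /= mn; have [_ + _] := sF n mn; apply; exact: GA.
- by move=> A GA n /= mn; have [_ _ +] := sF n mn; apply => i; exact: GA.
Qed.

Lemma Gn_sub m : (0 < m)%N -> Gn kn F m `<=` measurable.
Proof.
by move=> m0 A /(_ m (leqnn m)); have [_ + _] := F_filtration m0; apply.
Qed.

Lemma Gn_mono l m : (0 < l)%N -> (l <= m)%N -> Gn kn F l `<=` Gn kn F m.
Proof.
move=> l0 lm A GA n /= mn; have ln := leq_trans lm mn.
have [_ _ +] := F_filtration (leq_trans l0 ln); apply; last exact: GA.
  exact: kn_mono.
by apply: kn_mono => //; exact: leq_trans l0 lm.
Qed.

Lemma Ginf_sub : Ginf kn F `<=` measurable.
Proof. exact: (generated_sub Gn_sub). Qed.

Section projection.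
Variable u : 'cV[R]_d.

(** Row n runs over the times s_n, ..., k_n, the scalar theorem over 0, ...,
    k_n - 1: the index is shifted by one and the missing differences are 0. *)
Let at_row (x : nat -> nat -> T -> R) n j : T -> R :=
  if (sn n <= j.+1)%N then x n j.+1 else fun=> 0.

Let xi := at_row (fun n => proj_diff P kn sn F p X n u).
Let v := at_row (fun n => cond_var P kn sn F p X n u).
Let lam n e := at_row (fun n => cond_tail P kn sn F p X n u e) n.

Let row_sum_at x n w : (0 < n)%N ->
  row_sum kn (at_row x) n w = \sum_(sn n <= k < (kn n).+1) x n k w.
Proof.
move=> n0; rewrite sum_shift ?sn_bounds//; apply: eq_bigr => j _.
by rewrite /at_row; case: ifP.
Qed.

Let range n j : (j < kn n)%N -> (sn n <= j.+1)%N -> (sn n <= j.+1 <= kn n)%N.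
Proof. by move=> jk ->. Qed.

Let F_meas n k (f : T -> R) : (0 < n)%N -> (k <= kn n)%N -> measurable_wrt (F n k) f ->
  measurable_fun setT f.
Proof. by move=> n0 kN; apply: measurable_wrt_fun; have [_ + _] := F_filtration n0; exact. Qed.

Let Psi_fun a b : measurable_fun setT (fun w => Psi w a b).
Proof. exact: measurable_wrt_fun Ginf_sub (Psi_meas a b). Qed.

(** The scalar theorem for the projections of D on u, followed by Slutsky's
    argument for the remainder. *)
Lemma cvg_cos_projection th K eta : measurable_wrt (Ginf kn F) eta -> bounded_by K eta ->
  Ex P (fun w => eta w * cos ((\sum_i u i 0 * Xbar kn sn X n w i 0) + th)) @[n --> \oo] -->
  cos th * Ex P (fun w => eta w * expR (- (qf (Psi w) u u / 2))).
Proof.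
move=> eta_m etaK.
have xi_m n k : (0 < n)%N -> (k < kn n)%N -> measurable_wrt (F n k.+1) (xi n k).
  move=> n0 kN; rewrite /xi/at_row; case: ifP => [sk|_]; last exact: measurable_cst.
  exact: (proj_diff_meas n0 (F_filtration n0) (sn_bounds n0) X_lmd u (range kN sk)).
have v_P n k (n0 : (0 < n)%N) (kN : (k < kn n)%N) (sk : (sn n <= k.+1)%N) :=
  cond_varP n0 (F_filtration n0) (sn_bounds n0) X_lmd X_L2 u (range kN sk).
have lam_P n k (n0 : (0 < n)%N) (kN : (k < kn n)%N) (sk : (sn n <= k.+1)%N) :=
  cond_tailP n0 (F_filtration n0) (sn_bounds n0) X_lmd X_L2 u (range kN sk).
have v_m n k : (0 < n)%N -> (k < kn n)%N -> measurable_wrt (F n k) (v n k).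
  move=> n0 kN; rewrite /v/at_row; case: ifP => [sk|_]; last exact: measurable_cst.
  by have [+ _ _ _] := v_P n k n0 kN sk; rewrite subn1.
have lam_m n e k : (0 < n)%N -> 0 < e -> (k < kn n)%N -> measurable_wrt (F n k) (lam n e k).
  move=> n0 e0 kN; rewrite /lam/at_row; case: ifP => [sk|_]; last exact: measurable_cst.
  by have [+ _ _ _] := lam_P n k n0 kN sk e e0; rewrite subn1.
have Vm n : (0 < n)%N -> measurable_fun setT (row_sum kn v n).
  by move=> n0; apply: measurable_sum => k; apply: (@F_meas n k) => //; [exact: ltnW|exact: v_m].
have Lm n e : (0 < n)%N -> 0 < e -> measurable_fun setT (row_sum kn (fun n => lam n e) n).
  by move=> n0 e0; apply: measurable_sum => k; apply: (@F_meas n k) => //; [exact: ltnW|exact: lam_m].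
have Sm n : (0 < n)%N -> measurable_fun setT (row_sum kn xi n).
  by move=> n0; apply: measurable_sum => k; apply: (@F_meas n k.+1) => //; exact: xi_m.
have Vvan : vanishes P (fun n w => row_sum kn v n w - qf (Psi w) u u).
  pose c := \sum_a \sum_b `|u a 0 * u b 0| + 1.
  have c0 : 0 <= \sum_a \sum_b `|u a 0 * u b 0|.
    by apply: sumr_ge0 => a _; exact: sumr_ge0.
  apply: (@vanishes_dominated _ _ _ _ _ _ _ _ c _ condcov).
  - by rewrite ltr_wpDl.
  - move=> n n0; apply: measurable_funB; first exact: Vm.
    under eq_fun do rewrite qfE.
    by apply: measurable_sum => a; apply: measurable_sum => b; exact: measurable_funM.
  - move=> n n0; apply: measurable_mx_norm => a b.
    under eq_fun do rewrite mxE [in X in _ + X]mxE.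
    apply: measurable_funB => //.
    exact: (condcov_meas n0 (F_filtration n0) (sn_bounds n0) X_lmd X_L2).
  - move=> n n0; have := sum_cond_var n0 (F_filtration n0) (sn_bounds n0) X_lmd X_L2 u.
    apply: filterS => w ew; rewrite row_sum_at// ew.
    have -> : qf (condcov_sum P kn sn F p X n w) u u - qf (Psi w) u u =
        qf (condcov_sum P kn sn F p X n w - Psi w) u u.
      rewrite !qfE -sumrB; apply: eq_bigr => a _; rewrite -sumrB; apply: eq_bigr => b _.
      by rewrite !mxE mulrBr.
    by rewrite (le_trans (qf_norm_le _ _))// ler_wpM2r// /c lerDl.
have Lvan e : 0 < e -> vanishes P (row_sum kn (fun n => lam n e)).
  move=> e0; have c0 := dot_bound_gt0 u.
  have ec0 : 0 < e / dot_bound u by rewrite divr_gt0.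
  apply: (@vanishes_dominated _ _ _ _ _ _ _ _ (dot_bound u ^+ 2) _ (lindeberg ec0)).
  - exact: exprn_gt0.
  - by move=> n n0; exact: Lm.
  - move=> n n0; apply: measurableT_comp => //; apply: measurable_funB => //.
    exact: (lindeberg_meas n0 (F_filtration n0) (sn_bounds n0) X_lmd X_L2).
  - move=> n n0; have := sum_cond_tail n0 (F_filtration n0) (sn_bounds n0) X_lmd X_L2 u e0.
    apply: filterS => w ew; rewrite (row_sum_at (fun n => cond_tail P kn sn F p X n u e))// ew.
    by rewrite subr0 normrM ger0_norm// sqr_ge0.
have clt : Ex P (fun w => eta w * cos (row_sum kn xi n w + th)) @[n --> \oo] -->
    cos th * Ex P (fun w => eta w * expR (- (qf (Psi w) u u / 2))).
  apply: (@stable_cos _ _ _ P kn F (Gn kn F) kn xi v lam Gn_sigma Gn_sub Gn_mono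
    _ _ _ _ _ _ _ _ _ _ _ _ _ _ (fun w => qf (Psi w) u u)) => //.
  - by move=> m n m0 mn A /(_ n mn).
  - move=> n k w; rewrite /v/at_row; case: ifP => // _.
    by rewrite /cond_var le_max lexx.
  - move=> n e k w; rewrite /lam/at_row; case: ifP => // _.
    by rewrite mulr_ge0 ?sqr_ge0// le_max lexx.
  - move=> n k n0 kN; rewrite /xi/at_row; case: ifP => [sk|_].
      have [] // := proj_diff_L2 n0 (F_filtration n0) (sn_bounds n0) X_lmd X_L2 u (range kN sk).
    by under eq_fun do rewrite expr0n; exact: (L1_cst P 0).
  - move=> n k n0 kN; rewrite /v/at_row; case: ifP => [sk|_]; last exact: (L1_cst P 0).
    by have [_ + _ _] := v_P n k n0 kN sk.
  - move=> n e k n0 e0 kN; rewrite /lam/at_row; case: ifP => [sk|_]; last exact: (L1_cst P 0).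
    by have [_ + _ _] := lam_P n k n0 kN sk e e0.
  - move=> n k n0 kN K' h mh hK'; rewrite /xi/at_row; case: ifP => [sk|_].
      apply: (proj_diff_mart n0 (F_filtration n0) (sn_bounds n0) X_lmd X_L2 u (range kN sk) (K := K')) => //.
      by rewrite subn1.
    by under eq_Ex do rewrite mulr0; rewrite (Ex_cst P 0).
  - move=> n k n0 kN K' h mh hK'; rewrite /xi/v/at_row; case: ifP => [sk|_].
      have [_ _ _ +] := v_P n k n0 kN sk; apply; last exact: hK'.
      by rewrite subn1.
    by apply: eq_Ex => w; rewrite expr0n.
  - move=> n e k n0 e0 kN K' h mh hK' h0; rewrite /xi/lam/at_row; case: ifP => [sk|_].
      have [_ _ _ +] := lam_P n k n0 kN sk e e0; apply => //.
      by rewrite subn1.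
    by rewrite expr0n/=; under eq_Ex do rewrite mul0r.
  - rewrite (_ : (fun w => _) = fun w => \sum_a \sum_b u a 0 * u b 0 * Psi w a b); last first.
      by apply/funext => w; rewrite qfE.
    by apply: measurable_sum => a; apply: measurable_sum => b; apply: measurable_funM => //; exact: Psi_meas.
  - by move=> w; case: (Psi_psd w) => _; exact.
  - by move=> e rho dl e0; exact: Lvan.
apply: (cos_slutsky (measurable_wrt_fun Ginf_sub eta_m) etaK Sm _ _ clt).
  move=> n n0; apply: measurable_sum => i; apply: measurable_funM => //.
  exact: (Xbar_meas n0 (F_filtration n0) (sn_bounds n0) X_lmd).
apply: (@vanishes_dominated _ _ _ _ _ _ _ _ (dot_bound u) _ remainder).
- exact: dot_bound_gt0.
- move=> n n0; apply: measurable_funB; last exact: Sm.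
  apply: measurable_sum => i; apply: measurable_funM => //.
  exact: (Xbar_meas n0 (F_filtration n0) (sn_bounds n0) X_lmd).
- move=> n n0; apply: measurable_mx_norm => i j; rewrite ord1.
  under eq_fun do rewrite subr0.
  exact: (Rrem_meas n0 (F_filtration n0) (sn_bounds n0) X_lmd).
- move=> n n0.
  have : {ae P, forall w (i : nat) (id : (i < d)%N), Xbar kn sn X n w (Ordinal id) 0 =
     \sum_(sn n <= k < (kn n).+1) Dproj P kn sn F p X n k w (Ordinal id) 0 +
     Rrem P kn sn F p X n w (Ordinal id) 0}.
    apply/ae_foralln => i; have [id|id] := pselect (i < d)%N; last by apply: aeW => w id'; case: id.
    have := Xbar_decomposition n0 (F_filtration n0) (sn_bounds n0) X_lmd (Ordinal id).
    by apply: filterS => w ew id'; rewrite (_ : Ordinal id' = Ordinal id) ?ew//; exact/val_inj.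
  apply: filterS => w ew; rewrite row_sum_at// subr0.
  have -> : \sum_i u i 0 * Xbar kn sn X n w i 0 -
      \sum_(sn n <= k < (kn n).+1) proj_diff P kn sn F p X n u k w =
      \sum_i u i 0 * Rrem P kn sn F p X n w i 0.
    rewrite /proj_diff exchange_big/= -sumrB; apply: eq_bigr => i _.
    by case: i => i id; rewrite ew -mulr_sumr; ring.
  rewrite (le_trans (ler_norm_sum _ _ _))// /dot_bound mulrDl mul1r mulr_suml.
  rewrite ler_wpDl// ler_sum// => i _.
  by rewrite normrM ler_wpM2l// mx_entry_le.
Qed.

End projection.

Context (disp' : measure_display) (T' : measurableType disp').
Variables (P' : probability T' R) (pi : T' -> T).
Hypothesis pi_ext : extension P P' pi.
Variable Z : T' -> 'cV[R]_d.
Hypothesis Z_gauss : standard_gaussian P' Z.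
Hypothesis Z_indep : independent_sets P'
  (preimage_set_system setT pi (Ginf kn F)) (sigma_vec Z).
Variable V : T -> R.
Hypothesis V_meas : measurable_wrt (Ginf kn F) V.

Local Notation limit := (fun w => psd_sqrt (Psi (pi w)) *m Z w).

Let G_sub : Ginf kn F `<=` measurable.
Proof. exact: Ginf_sub. Qed.

Let G_sigma : sigma_algebra setT (Ginf kn F).
Proof. exact: smallest_sigma_algebra. Qed.

Let V_fun : measurable_fun setT V.
Proof. exact: (measurable_wrt_fun G_sub V_meas). Qed.

Let S (u : 'cV[R]_d) n w : R := \sum_i u i 0 * Xbar kn sn X n w i 0.

Let S_fun u n : (0 < n)%N -> measurable_fun setT (S u n).
Proof.
move=> n0; apply: measurable_sum => i; apply: measurable_funM => //.
exact: (Xbar_meas n0 (F_filtration n0) (sn_bounds n0) X_lmd).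
Qed.

(** Expanding cos(S + (s V + th)) gives cosines of S with phases 0 and pi / 2,
    weighted by bounded G-measurable variables. *)
Lemma cvg_cos_joint (u : 'cV[R]_d) s th :
  Ex P (fun w => cos (S u n w + (s * V w + th))) @[n --> \oo] -->
  Ex P (fun w => cos (s * V w + th) * expR (- (qf (Psi w) u u / 2))).
Proof.
have mph : measurable_wrt (Ginf kn F) (fun w => s * V w + th).
  by apply: measurable_funD => //; exact: measurable_funM.
have mc : measurable_wrt (Ginf kn F) (fun w => cos (s * V w + th)).
  exact: (@measurable_cos_comp _ (g_sigma_algebraType (Ginf kn F))).
have ms : measurable_wrt (Ginf kn F) (fun w => sin (s * V w + th)).
  exact: (@measurable_sin_comp _ (g_sigma_algebraType (Ginf kn F))).
have clt := @cvg_cos_projection u.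
have c1 := clt 0 1 _ mc (fun w => cos_max _).
have c2 := clt (trigo.pi / 2) 1 _ ms (fun w => sin_max _).
rewrite cos0 mul1r in c1; rewrite cos_pihalf mul0r in c2.
rewrite -[X in _ --> X]addr0; apply: cvg_trans (cvgD c1 c2).
apply: near_eq_cvg; near=> n.
have n0 : (0 < n)%N by near: n; exact: nbhs_infty_gt.
have L1c (h : T -> R) ph : measurable_wrt (Ginf kn F) h -> (forall w, `|h w| <= 1) ->
    L1 P (fun w => h w * cos (S u n w + ph)).
  move=> mh h1; apply: (@L1_bounded _ _ _ _ 1).
    apply: measurable_funM; first exact: measurable_wrt_fun mh.
    by apply: measurable_cos_comp; apply: measurable_funD => //; exact: S_fun.
  by move=> w; rewrite normrM -[1]mulr1 ler_pM// ?h1// cos_max.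
rewrite -[LHS]/(Ex P (fun w => cos (s * V w + th) * cos (S u n w + 0)) +
  Ex P (fun w => sin (s * V w + th) * cos (S u n w + trigo.pi / 2))).
rewrite -ExD; [|by apply: L1c => // w; exact: cos_max|by apply: L1c => // w; exact: sin_max].
apply: eq_Ex => w; rewrite addr0 cosDpihalf (cosD (S u n w)).
by ring.
Unshelve. all: by end_near. Qed.

Lemma limit_meas i : measurable_fun setT (fun w => (limit w) i 0).
Proof.
under eq_fun do rewrite mxE; apply: measurable_sum => j; apply: measurable_funM.
  have := psd_sqrt_measurable Psi_meas Psi_psd i j => mS.
  apply: (measurableT_comp (measurable_wrt_fun G_sub mS)).
  by case: pi_ext.
by case: Z_gauss.
Qed.

(** The limit projected on u is a Gaussian mixture with coefficients b = Q u,
    Q = Psi^{1/2}, and |Q u|^2 = u^T Psi u. *)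
Lemma limit_cos (u : 'cV[R]_d) s th :
  Ex P' (fun w => cos (\sum_i u i 0 * (limit w) i 0 + (s * V (pi w) + th))) =
  Ex P (fun w => cos (s * V w + th) * expR (- (qf (Psi w) u u / 2))).
Proof.
pose Q w := psd_sqrt (Psi w).
have mQ a b : measurable_wrt (Ginf kn F) (fun w => Q w a b).
  exact: (psd_sqrt_measurable Psi_meas Psi_psd).
pose b i w : R := \sum_j u j 0 * Q (pi w) j i.
pose c w := s * V (pi w) + th.
have mb i : measurable_wrt (preimage_set_system setT pi (Ginf kn F)) (b i).
  by apply: measurable_sum => j; apply: measurable_funM => //; exact: (extension_meas G_sigma (mQ j i)).
have mc : measurable_wrt (preimage_set_system setT pi (Ginf kn F)) c.
  by apply: measurable_funD => //; apply: measurable_funM => //; exact: (extension_meas G_sigma V_meas).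
have := gaussian_mixture (extension_sigma pi G_sigma) (extension_sub pi_ext G_sub)
  Z_gauss Z_indep mb mc.
have -> : (fun w => cos (c w + \sum_i b i w * Z w i 0)) =
    fun w => cos (\sum_i u i 0 * (limit w) i 0 + (s * V (pi w) + th)).
  apply/funext => w; rewrite addrC; congr (cos (_ + _)).
  under [RHS]eq_bigr do rewrite mxE mulr_sumr.
  rewrite exchange_big/=; apply: eq_bigr => i _; rewrite mulr_suml.
  by apply: eq_bigr => j _; rewrite /Q; ring.
move=> ->; rewrite -(@Ex_extension _ _ _ _ _ P P' pi pi_ext 1).
- apply: eq_Ex => w; rewrite /c /=; congr (_ * expR (- (_ / 2))).
  have [[QT _] QQ] := psd_sqrtP (Psi_psd (pi w)).
  have Qu i : (Q (pi w) *m u) i 0 = b i w.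
    rewrite mxE; apply: eq_bigr => j _; rewrite mulrC; congr (_ * _).
    by have /matrixP/(_ j i) := QT; rewrite mxE.
  rewrite /qf -{1}QQ.
  have -> : u^T *m (psd_sqrt (Psi (pi w)) *m psd_sqrt (Psi (pi w))) *m u =
      (Q (pi w) *m u)^T *m (Q (pi w) *m u) by rewrite trmx_mul QT !mulmxA.
  by rewrite mxE; apply: eq_bigr => i _; rewrite mxE Qu expr2.
- apply: measurable_funM.
    apply: measurable_cos_comp; apply: measurable_funD => //.
    by apply: measurable_funM => //; exact: V_fun.
  apply: measurableT_comp => //; apply: measurableT_comp => //; apply: measurable_funM => //.
  under eq_fun do rewrite qfE.
  apply: measurable_sum => a; apply: measurable_sum => e; apply: measurable_funM => //.
  exact: measurable_wrt_fun G_sub (Psi_meas a e).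
- move=> w; rewrite normrM (ger0_norm (expR_ge0 _)) -[1]mulr1 ler_pM ?expR_ge0 ?cos_max//.
  by rewrite -expR0 ler_expR oppr_le0 divr_ge0//; case: (Psi_psd w) => _; exact.
Qed.

(** The continuity theorem applied to the packed pair.  The sequence starts at
    n = 1, since the row of index 0 is unconstrained and need not even be
    measurable. *)
Lemma stable_limit : cvg_in_distribution P P' (fun n w => (Xbar kn sn X n w, V w))
  (fun w => (limit w, V (pi w))).
Proof.
move=> f cf bf.
have [K fK] : exists K, forall z, `|f z| <= K.
  have [M [_ fM]] := bf; exists (M + 1) => z.
  by apply: (fM (M + 1)); rewrite // ltrDl.
pose g y := f (unpack y).
have cg : continuous g by move=> y; apply: continuous_comp; [exact: unpack_continuous|exact: cf].
have gK y : `|g y| <= K by exact: fK.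
pose Y_ n w := pack (Xbar kn sn X n.+1 w) (V w).
pose Y w := pack (limit w) (V (pi w)).
have mY_ n i : measurable_fun setT (fun w => Y_ n w 0 i).
  apply: pack_meas => // j.
  exact: (Xbar_meas (ltn0Sn n) (F_filtration (ltn0Sn n)) (sn_bounds (ltn0Sn n)) X_lmd).
have mY i : measurable_fun setT (fun w => Y w 0 i).
  apply: pack_meas => // [j|]; first exact: limit_meas.
  by apply: measurableT_comp => //; case: pi_ext.
have trig t th : Ex P (fun w => cos (dotr t (Y_ n w) + th)) @[n --> \oo] -->
    Ex P' (fun w => cos (dotr t (Y w) + th)).
  rewrite (_ : Ex P' _ = Ex P' (fun w => cos (\sum_i (lsubmx t)^T i 0 * (limit w) i 0 +
      (t 0 (rshift d 0) * V (pi w) + th)))); last first.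
    by apply: eq_Ex => w; rewrite dotr_pack addrA.
  rewrite limit_cos.
  have := @cvg_cos_joint (lsubmx t)^T (t 0 (rshift d 0)) th.
  rewrite -(cvg_shiftS _); apply: cvg_trans; apply: near_eq_cvg; apply: nearW => n.
  by apply: eq_Ex => w; rewrite dotr_pack /S addrA.
have cvE := levy_continuity mY_ mY trig cg gK.
have EE dO (O : measurableType dO) (Q : probability O R) (x : O -> 'cV[R]_d) (y : O -> R) :
    (forall i, measurable_fun setT (fun w => pack (x w) (y w) 0 i)) ->
    ('E_Q[f \o (fun w => (x w, y w))] = (Ex Q (g \o (fun w => pack (x w) (y w))))%:E)%E.
  move=> mxy; rewrite unlock -ExE.
    by apply: eq_integral => w _; rewrite /= /g packK.
  by apply: (@L1_bounded _ _ _ _ K); [exact: (measurable_continuous_rV mxy cg gK)|move=> w; exact: gK].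
rewrite EE// -(cvg_shiftS _).
rewrite (_ : [sequence _]_n = fun n => (Ex P (g \o Y_ n))%:E); last first.
  by apply/funext => n; exact: (EE _ _ P (Xbar kn sn X n.+1) V (mY_ n)).
by apply: cvg_EFin => //; apply: nearW.
Qed.

End stable_limit.

Unset Implicit Arguments.

Theorem theorem1
    (R : realType) (disp : measure_display) (T : measurableType disp)
    (P : probability T R) (d : nat) (d_gt0 : (0 < d)%N)
    (kn sn : nat -> nat) (F : nat -> nat -> set (set T))
    (p : nat -> nat -> nat) (X : nat -> nat -> T -> 'cV[R]_d)
    (kn_mono : forall m n, (0 < m)%N -> (m <= n)%N -> (kn m <= kn n)%N)
    (kn_ge : forall n, (0 < n)%N -> (n <= kn n)%N)
    (F_filtration : forall n, (0 < n)%N -> filtration (kn n) (F n))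
    (sn_bounds : forall n, (0 < n)%N -> (1 <= sn n <= kn n)%N)
    (p_bounds : forall n k, (0 < n)%N -> (sn n <= k <= kn n)%N ->
       (p n k < k)%N)
    (X_lmd : lag_martingale_difference P kn sn F p X)
    (X_L2 : square_integrable P kn sn X)
    (lindeberg : forall e : R, 0 < e ->
       cvg_in_probability P (lindeberg_sum P kn sn F p X e) (cst (0 : R)))
    (Psi : T -> 'M[R]_d)
    (Psi_psd : forall w, psd (Psi w))
    (Psi_meas : measurable_mx (Ginf kn F) Psi)
    (condcov : cvg_in_probability P (condcov_sum P kn sn F p X) Psi)
    (remainder : cvg_in_probability P (Rrem P kn sn F p X) (cst 0))
    (disp' : measure_display) (T' : measurableType disp')
    (P' : probability T' R) (pi : T' -> T) (pi_ext : extension P P' pi)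
    (Z : T' -> 'cV[R]_d) (Z_gauss : standard_gaussian P' Z)
    (Z_indep : independent_sets P'
       (preimage_set_system setT pi (Ginf kn F)) (sigma_vec Z)) :
  stable_cvg P P' (Ginf kn F) pi (Xbar kn sn X)
    (fun w => psd_sqrt (Psi (pi w)) *m Z w).
Proof.
move=> V V_meas.
exact: (stable_limit kn_mono F_filtration sn_bounds X_lmd X_L2 lindeberg
  Psi_psd Psi_meas condcov remainder pi_ext Z_gauss Z_indep V_meas).
Qed.
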